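(* Consider a $CM_L$ model $$x_k=G_{k,k-1}x_{k-1}+G_{k,N}x_N+e_k,\quad k\in[1,N-1],$$ with parameters $(G_{k,k-1},G_{k,N},G_k)$, $k\in[1,N-1]$, where $G_k=\mathrm{Cov}(e_k)$ is positive definite. The model is for a reciprocal sequence if and only if it can be induced by a Markov model, that is, if and only if there exist $d\times d$ matrices $M_{k,k-1}$ and $d\times d$ positive definite matrices $M_k$, $k\in[1,N]$, such that for all $k\in[1,N-1]$ $$G_{k,k-1}=M_{k,k-1}-G_{k,N}M_{N|k}M_{k,k-1},\qquad G_{k,N}=G_kM_{N|k}'C_{N|k}^{-1},\qquad G_k=\left(M_k^{-1}+M_{N|k}'C_{N|k}^{-1}M_{N|k}\right)^{-1},$$ where $M_{N|k}=M_{N,N-1}\cdots M_{k+1,k}$ for $k\in[1,N-1]$, $M_{N|N}=I$, and $C_{N|k}=\sum_{n=k}^{N-1}M_{N|n+1}M_{n+1}M_{N|n+1}'$ for $k\in[1,N-1]$.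
   Context: $N$ is a positive integer and $[i,j]=\{i,i+1,\ldots,j\}$ (empty if $i>j$); $[x_k]$ denotes $(x_k)_{k\in[0,N]}$, with $x_k$ valued in $\mathbb{R}^d$. The prime denotes matrix transposition. A zero-mean white nonsingular Gaussian sequence $[e_k]$ is a jointly Gaussian, zero-mean sequence whose terms are mutually uncorrelated, with each $\mathrm{Cov}(e_k)$ nonsingular. A sequence $[x_k]$ is reciprocal if, conditioned on the states at any two times $j<l$, the segment inside $(j,l)$ is independent of the two segments outside $[j,l]$. A $CM_L$ model is the displayed equation (without boundary condition), where $[e_k]$ is zero-mean white nonsingular Gaussian; it is completed by a boundary condition $x_N=e_N$, $x_0=G_{0,N}x_N+e_0$ with an arbitrary matrix $G_{0,N}$ and positive definite $\mathrm{Cov}(e_0)=G_0$, $\mathrm{Cov}(e_N)=G_N$. The model is said to be for a reciprocal sequence if the Gaussian sequences governed by it together with such a boundary condition are reciprocal (this is known not to depend on the boundary parameters: it is equivalent to $G_k^{-1}G_{k,N}=G_{k+1,k}'G_{k+1}^{-1}G_{k+1,N}$ for all $k\in[1,N-2]$). A Markov model is $y_k=M_{k,k-1}y_{k-1}+\epsilon_k$, $k\in[1,N]$, with $(\epsilon_k)$ zero-mean white nonsingular Gaussian and $\mathrm{Cov}(\epsilon_k)=M_k$; the $CM_L$ model with the parameters displayed in the claim is the $CM_L$ model induced by it. *)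

(* Defs.v *)
From HB Require Import structures.
From mathcomp Require Import all_boot all_order all_algebra.
From mathcomp Require Import all_classical all_reals all_analysis.

Set Implicit Arguments.
Unset Strict Implicit.
Unset Printing Implicit Defensive.

Import Order.TTheory GRing.Theory Num.Theory.
Import numFieldNormedType.Exports.

Local Open Scope classical_set_scope.
Local Open Scope ring_scope.

(* Time indices are natural numbers. A sequence (x_k), k in [0,N], is a family
   indexed by nat of which only the terms of index at most N are ever
   constrained; likewise for families of matrices. An R^d-valued random vector
   is given by its d real random variables. *)

Definition posdef (R : realType) (d : nat) (A : 'M[R]_d) : Prop :=
  A^T = A /\ forall v : 'cV[R]_d, v != 0 -> 0 < (v^T *m A *m v) 0 0.

Section RandomVectors.
Context (R : realType) (d : nat) (disp : measure_display)
  (T : measurableType disp) (P : probability T R).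

Definition random_vector := 'I_d -> {RV P >-> R}.

Definition value (X : random_vector) (t : T) : 'cV[R]_d := \col_i X i t.

(* In the library [normal_prob m 0] is not the Dirac mass at m, so the
   degenerate normal law is treated separately. *)
Definition normal_law (Y : T -> R) : Prop :=
  exists m s : R, forall A : set R, measurable A ->
    P (Y @^-1` A) = if s == 0 then \d_m A else normal_prob m s A.

(* (x_0, ..., x_N) is jointly Gaussian: all linear combinations of the scalar
   components are normal, possibly degenerate. *)
Definition jointly_gaussian (N : nat) (x : nat -> random_vector) : Prop :=
  forall a : nat -> 'I_d -> R,
    normal_law (fun t => \sum_(k < N.+1) \sum_(i < d) a k i * x k i t).

(* [fine] loses nothing on square-integrable, e.g. Gaussian, vectors. *)
Definition cov (X Y : random_vector) : 'M[R]_d :=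
  \matrix_(i, j) fine (covariance P (X i) (Y j)).

Definition zero_mean (X : random_vector) : Prop :=
  forall i, ('E_P[X i] = 0)%E.

Definition white_gaussian (N : nat) (e : nat -> random_vector) : Prop :=
  [/\ jointly_gaussian N e,
      forall k, (k <= N)%N -> zero_mean (e k),
      forall k l, (k <= N)%N -> (l <= N)%N -> k <> l -> cov (e k) (e l) = 0 &
      forall k, (k <= N)%N -> cov (e k) (e k) \in unitmx].

Definition sigma_of (x : nat -> random_vector) (S : set nat) : set (set T) :=
  <<s \bigcup_(k in S) \bigcup_(i in [set: 'I_d])
        preimage_set_system setT (x k i) measurable >>.

(* g is a version of the conditional probability P(A | F). *)
Definition cond_prob_version (F : set (set T)) (A : set T) (g : T -> R) : Prop :=
  [/\ forall B : set R, measurable B -> F (g @^-1` B),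
      P.-integrable setT (EFin \o g) &
      forall D, F D -> (\int[P]_(t in D) (g t)%:E = P (A `&` D))%E].

(* P(A `&` B | F) = P(A | F) P(B | F) almost surely. Versions exist and are
   a.s. unique, so asking for one pair (f, g) or for all of them is the same. *)
Definition cond_indep (F FA FB : set (set T)) : Prop :=
  forall A B, FA A -> FB B ->
    exists f g, [/\ cond_prob_version F A f, cond_prob_version F B g &
                    cond_prob_version F (A `&` B) (fun t => f t * g t)].

Definition reciprocal (N : nat) (x : nat -> random_vector) : Prop :=
  forall j l, (j < l <= N)%N ->
    cond_indep (sigma_of x [set k | k = j \/ k = l])
               (sigma_of x [set k | (j < k < l)%N])
               (sigma_of x [set k | (k < j)%N \/ (l < k <= N)%N]).

(* x is governed by the CM_L model with G_{k,k-1} = Gprev k, G_{k,N} = Glast k,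
   G_k = G k for 0 < k < N, and with the boundary parameters
   G_{0,N} = B, Cov(e_0) = C0, Cov(e_N) = CN. *)
Definition CML_governed (N : nat) (Gprev Glast G : nat -> 'M[R]_d)
    (B C0 CN : 'M[R]_d) (x : nat -> random_vector) : Prop :=
  exists e : nat -> random_vector,
    [/\ white_gaussian N e,
        [/\ cov (e 0%N) (e 0%N) = C0, cov (e N) (e N) = CN &
            forall k, (0 < k < N)%N -> cov (e k) (e k) = G k],
        {ae P, forall t, value (x N) t = value (e N) t},
        {ae P, forall t,
           value (x 0%N) t = B *m value (x N) t + value (e 0%N) t} &
        forall k, (0 < k < N)%N -> {ae P, forall t,
           value (x k) t = Gprev k *m value (x k.-1) t
                           + Glast k *m value (x N) t + value (e k) t}].

End RandomVectors.

Definition CML_for_reciprocal (R : realType) (d N : nat)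
    (Gprev Glast G : nat -> 'M[R]_d) : Prop :=
  forall B C0 CN : 'M[R]_d, posdef C0 -> posdef CN ->
  forall (disp : measure_display) (T : measurableType disp)
    (P : probability T R) (x : nat -> random_vector d P),
    CML_governed N Gprev Glast G B C0 CN x -> reciprocal N x.

(* For Mprev k = M_{k,k-1}, the ordered product
   M_{N|k} = M_{N,N-1} ... M_{k+1,k}; it is the identity for k = N. *)
Definition trans_prod (R : realType) (d N : nat) (Mprev : nat -> 'M[R]_d)
    (k : nat) : 'M[R]_d :=
  \big[mulmx/1%:M]_(i <- rev (index_iota k.+1 N.+1)) Mprev i.

(* C_{N|k}, for Mprev k = M_{k,k-1} and M k = M_k. *)
Definition trans_cov (R : realType) (d N : nat) (Mprev M : nat -> 'M[R]_d)
    (k : nat) : 'M[R]_d :=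
  \sum_(k <= n < N) trans_prod N Mprev n.+1 *m M n.+1
                      *m (trans_prod N Mprev n.+1)^T.

(* The CM_L model (Gprev, Glast, G) is the one induced by the Markov model
   y_k = Mprev k y_{k-1} + eps_k, Cov(eps_k) = M k. *)
Definition CML_induced (R : realType) (d N : nat)
    (Gprev Glast G Mprev M : nat -> 'M[R]_d) : Prop :=
  forall k, (0 < k < N)%N ->
    let MNk := trans_prod N Mprev k in
    let CNk := trans_cov N Mprev M k in
    [/\ Gprev k = Mprev k - Glast k *m MNk *m Mprev k,
        Glast k = G k *m MNk^T *m invmx CNk &
        G k = invmx (invmx (M k) + MNk^T *m invmx CNk *m MNk)].

(* Main.v *)
(* A CM_L model reads e = T x with T block triangular, so the precision matrix Q
   of x is T' D^-1 T, where D is the block diagonal covariance of e. The block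
   Q_{k,l} of an interior time k and a time l other than k-1, k, k+1 vanishes
   unless l = N, and Q_{k,N} vanishes iff
   G_k^-1 G_{k,N} = G_{k+1,k}' G_{k+1}^-1 G_{k+1,N}.
   For a Gaussian vector, two groups of coordinates are conditionally independent
   given the remaining ones iff the corresponding block of the precision matrix
   is zero; hence x is reciprocal iff the displayed identity holds for all
   0 < k < N-1. This identity is in turn equivalent to the existence of an
   inducing Markov model: one direction is the Woodbury formula applied to
   C_{N|k} = C_{N|k+1} + M_{N|k+1} M_{k+1} M_{N|k+1}', the other an explicit
   solution of the induction equations. Since reciprocity is required of all
   sequences governed by the model, one such sequence has to be constructed, from
   independent standard normal variables on a product space. *)
Require Import Defs.
From HB Require Import structures.
From mathcomp Require Import finmap.
From mathcomp Require Import all_boot all_order all_algebra.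
From mathcomp Require Import all_classical all_reals all_analysis.
From mathcomp Require Import measurable_realfun ring lra zify.

Set Implicit Arguments.
Unset Strict Implicit.
Unset Printing Implicit Defensive.

Import Order.TTheory GRing.Theory Num.Theory.
Import numFieldNormedType.Exports.

Local Open Scope classical_set_scope.
Local Open Scope ring_scope.

(** * Events determined by trigonometric integrals *)

(** Joint normality speaks of the laws of single linear combinations, whereas [reciprocal] compares
    whole sigma-algebras. The bridge is the integral of a cosine of a linear combination: it
    factorizes for uncorrelated combinations, and a bounded function with zero integral against all
    such cosines has zero integral over every event they generate. The only property of the normal
    characteristic function used for this is [std_charf r = std_charf a * std_charf b] when
    [r ^+ 2 = a ^+ 2 + b ^+ 2], a form of rotation invariance. The standard variance is never
    evaluated either, so covariance matrices are carried divided by [std_variance R]. Conversely,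
    conditional independence has to yield a matrix identity; it does so through a residual that
    turns out to be independent of the inner coordinates. The boundary parameters drop out of the
    precision blocks that matter, so one sequence with one boundary condition is enough to extract
    the identity, which then serves all boundary conditions. The inducing Markov model leaves a
    positive definite matrix free, the inverse of C_{N|0}; the identity is chosen for it. *)

Lemma pow_one_minus_le (R : realFieldType) (u : R) m : 0 <= u <= 1 ->
  (1 - u) ^+ m * (1 + m%:R * u) <= 1.
Proof.
move=> /andP[u0 u1]; elim: m => [|m IH]; first by rewrite expr0 mul0r addr0 mulr1.
apply: le_trans IH; rewrite exprSr -mulrA ler_wpM2l ?exprn_ge0 ?subr_ge0//.
rewrite -natr1; have : 0 <= m%:R :> R by []. nra.
Qed.

Lemma pow_one_minus_ge (R : realFieldType) (u : R) m : 0 <= u <= 1 ->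
  1 - m%:R * u <= (1 - u) ^+ m.
Proof.
move=> /andP[u0 u1]; elim: m => [|m IH]; first by rewrite expr0 mul0r subr0.
rewrite exprSr; apply: (@le_trans _ _ ((1 - m%:R * u) * (1 - u))).
  by rewrite -natr1; have : 0 <= m%:R :> R by []; nra.
by rewrite ler_wpM2r// subr_ge0.
Qed.

Lemma natr_mul_expr_cvg (R : realType) (r : R) : 0 <= r < 1 ->
  (fun n => n.+1%:R * r ^+ n) @ \oo --> (0 : R).
Proof.
(* The square root splits [r ^+ n] into two factors [q ^+ n]: one keeps [n.+1%:R * q ^+ n] below the
   geometric sum, the other tends to zero. *)
move=> /andP[r0 r1]; pose q := Num.sqrt r.
have q0 : 0 <= q by exact: sqrtr_ge0.
have rq : r = q ^+ 2 by rewrite sqr_sqrtr.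
have q1 : q < 1 by rewrite -sqrtr1 ltr_sqrt.
have bound n : n.+1%:R * q ^+ n <= (1 - q)^-1.
  rewrite -[leRHS]mul1r ler_pdivlMr ?subr_gt0//.
  suff : n.+1%:R * q ^+ n * (1 - q) <= 1 - q ^+ n.+1.
    by move=> /le_trans; apply; rewrite gerBl exprn_ge0.
  elim: n => [|n IH]; first by rewrite expr0 !mul1r expr1.
  have p0 : 0 <= q ^+ n by exact: exprn_ge0.
  have p1 : q * q ^+ n <= 1 by rewrite -exprS exprn_ile1// ltW.
  have IH' : q * (n.+1%:R * q ^+ n * (1 - q)) <= q * (1 - q ^+ n.+1) by rewrite ler_wpM2l.
  have H : (q * q ^+ n) * (1 - q) <= 1 * (1 - q) by rewrite ler_wpM2r// subr_ge0 ltW.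
  have -> : n.+2%:R = n.+1%:R + 1 :> R by rewrite natr1.
  by move: IH' H p0; rewrite !exprS; move: (n.+1%:R) (q ^+ n) => m p; nra.
apply: (@squeeze_cvgr _ _ _ _ (cst 0) (fun n => (1 - q)^-1 * q ^+ n)).
- apply: nearW => n; apply/andP; split; first by rewrite mulr_ge0// exprn_ge0.
  by rewrite rq -exprM mulnC exprM expr2 mulrA ler_wpM2r// exprn_ge0.
- exact: cvg_cst.
- rewrite -[X in _ --> X](mulr0 (1 - q)^-1); apply: cvgM; first exact: cvg_cst.
  by apply: cvg_expr; rewrite ger0_norm.
Qed.

(** Everything depends on the exponent times [u ^+ n], that is on [n.+1%:R * (2 * u) ^+ n]: it tends
    to 0 below [2^-1] and to infinity from [2^-1] on, the factor [n.+1] settling the case of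
    equality. Indicators thus become limits of polynomials with values in [0, 1]. *)
Lemma threshold_cvg (R : realType) (u : R) : 0 <= u <= 1 ->
  (fun n => 1 - (1 - u ^+ n) ^+ (n.+1 * 2 ^ n)) @ \oo --> ((2^-1 <= u)%R%:R : R).
Proof.
move=> /andP[u0 u1].
have un n : 0 <= u ^+ n <= 1 by rewrite exprn_ge0//= exprn_ile1.
have [h|h] := leP 2^-1 u.
  rewrite -[X in _ --> X]subr0; apply: cvgB; first exact: cvg_cst.
  apply: (@squeeze_cvgr _ _ _ _ (cst 0) (fun n => n.+1%:R^-1)).
  - apply: nearW => n; have /andP[a b] := un n; apply/andP; split.
      by rewrite exprn_ge0// subr_ge0.
    have := pow_one_minus_le (n.+1 * 2 ^ n) (un n).
    rewrite -[n.+1%:R^-1]mul1r ler_pdivlMr ?ltr0n//; apply: le_trans.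
    rewrite ler_wpM2l ?exprn_ge0 ?subr_ge0//.
    rewrite ler_wpDl// natrM -mulrA ler_peMr// natrX -exprMn exprn_ege1//.
    by rewrite mulrC -ler_pdivrMr// mul1r.
  - exact: cvg_cst.
  - exact: cvg_harmonic.
apply: (@squeeze_cvgr _ _ _ _ (cst 0) (fun n => n.+1%:R * (2 * u) ^+ n)).
- apply: nearW => n; have /andP[a b] := un n; apply/andP; split.
    by rewrite subr_ge0 exprn_ile1// ?subr_ge0// gerBl.
  rewrite lerBlDr -lerBlDl.
  have := pow_one_minus_ge (n.+1 * 2 ^ n) (un n).
  by rewrite natrM natrX -mulrA -exprMn.
- exact: cvg_cst.
- apply: natr_mul_expr_cvg; rewrite mulr_ge0//=.
  by rewrite mulrC -ltr_pdivlMr// mul1r.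
Qed.

(* A route to the uniqueness theorem for characteristic functions that avoids
   inversion formulas: the functions [f] such that [f * cos (g + th) * k] has
   integral zero for all [g] in [L] and all [th] are stable under multiplication
   by a cosine, hence by limits of polynomials in cosines, hence by the
   indicators of the events generated by [L]. *)
Section trig_class.
Context d (T : measurableType d) (R : realType) (P : probability T R).
Variables (L : set (T -> R)) (k : T -> R).
Hypothesis L0 : L (cst 0).
Hypothesis LD : forall f g, L f -> L g -> L (f \+ g).
Hypothesis LZ : forall a f, L f -> L (fun x => a * f x).
Hypothesis Lm : forall f, L f -> measurable_fun setT f.
Hypothesis km : measurable_fun setT k.
Hypothesis kb : exists M : R, forall x, `|k x| <= M.
Hypothesis Hk : forall f th, L f -> (\int[P]_x (cos (f x + th) * k x)%:E = 0)%E.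

Definition trig_null (f : T -> R) := [/\ measurable_fun setT f,
  exists M : R, forall x, `|f x| <= M &
  forall g th, L g -> (\int[P]_x (f x * cos (g x + th) * k x)%:E = 0)%E].

Lemma bounded_integrable (f : T -> R) : measurable_fun setT f ->
  (exists M : R, forall x, `|f x| <= M) -> P.-integrable setT (EFin \o f).
Proof.
move=> mf [M fM]; apply: measurable_bounded_integrable => //.
  by apply: (@le_lt_trans _ _ 1%E); [exact: probability_le1|rewrite ltry].
exists M; split; first exact: num_real.
by move=> x Mx y _; exact: le_trans (fM y) (ltW Mx).
Qed.

Lemma measurable_cosD (g : T -> R) th : measurable_fun setT g ->
  measurable_fun setT (fun x => cos (g x + th)).
Proof.
move=> mg; apply: (measurableT_comp (continuous_measurable_fun (@continuous_cos R))).
exact: measurable_funD.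
Qed.

Lemma trig_null_integrable (f g : T -> R) th : measurable_fun setT f ->
  (exists M : R, forall x, `|f x| <= M) -> L g ->
  P.-integrable setT (fun x => (f x * cos (g x + th) * k x)%:E).
Proof.
move=> mf [M fM] Lg; have [M' kM] := kb.
apply: (@bounded_integrable (fun x => f x * cos (g x + th) * k x)).
  apply: measurable_funM => //; apply: measurable_funM => //.
  by apply: measurable_cosD; exact: Lm.
exists (M * M') => x; rewrite normrM ler_pM// normrM.
by rewrite -[leRHS]mulr1 ler_pM// cos_max.
Qed.

Lemma trig_null1 : trig_null (cst 1).
Proof.
split; [exact: measurable_cst|by exists 1 => x; rewrite normr1|].
move=> g th Lg; rewrite -[RHS](Hk th Lg); apply: eq_integral => x _.
by rewrite mul1r.
Qed.

Lemma trig_null_lin a b (f g : T -> R) : trig_null f -> trig_null g ->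
  trig_null (fun x => a * f x + b * g x).
Proof.
move=> [mf bf nf] [mg bg ng]; split.
- by apply: measurable_funD; apply: measurable_funM.
- have [M fM] := bf; have [M' gM] := bg; exists (`|a| * M + `|b| * M') => x.
  by rewrite (le_trans (ler_normD _ _))// !normrM lerD// ler_wpM2l.
- move=> h th Lh.
  transitivity (\int[P]_x (a%:E * (f x * cos (h x + th) * k x)%:E +
     b%:E * (g x * cos (h x + th) * k x)%:E))%E.
    by apply: eq_integral => x _; rewrite -!EFinM -EFinD; congr EFin; ring.
  have If := trig_null_integrable th mf bf Lh.
  have Ig := trig_null_integrable th mg bg Lh.
  rewrite integralD//; [|exact: integrableZl|exact: integrableZl].
  by rewrite !integralZl// nf// ng// !mule0 adde0.
Qed.

(** A product of cosines is half the sum of the cosines of [g + h] and [g - h]; this is where the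
    stability of [L] under sums and multiples enters. *)
Lemma trig_null_cos f g eta : trig_null f -> L g ->
  trig_null (fun x => f x * cos (g x + eta)).
Proof.
move=> [mf bf nf] Lg; split.
- by apply: measurable_funM => //; apply: measurable_cosD; exact: Lm.
- have [M fM] := bf; exists M => x.
  by rewrite normrM -[leRHS]mulr1 ler_pM// cos_max.
- move=> h th Lh.
  have Lp := LD Lg Lh.
  have Lq : L (fun x => g x + -1 * h x) by apply: LD => //; exact: LZ.
  transitivity (\int[P]_x
     ((2^-1)%:E * (f x * cos ((g \+ h) x + (eta + th)) * k x)%:E +
     (2^-1)%:E * (f x * cos ((g x + -1 * h x) + (eta - th)) * k x)%:E))%E.
    apply: eq_integral => x _; rewrite -!EFinM -EFinD; congr EFin => /=.
    have -> : g x + h x + (eta + th) = (g x + eta) + (h x + th) by ring.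
    have -> : g x + -1 * h x + (eta - th) = (g x + eta) - (h x + th) by ring.
    set A := g x + eta; set B := h x + th; by rewrite (cosD A) (cosB A); field.
  have If := trig_null_integrable (eta + th) mf bf Lp.
  have Ig := trig_null_integrable (eta - th) mf bf Lq.
  rewrite integralD//; [|exact: integrableZl|exact: integrableZl].
  by rewrite !integralZl// nf// nf// !mule0 adde0.
Qed.

Lemma trig_null_lim (f_ : nat -> T -> R) (f : T -> R) (M : R) :
  (forall n, trig_null (f_ n)) -> (forall n x, `|f_ n x| <= M) ->
  (forall x, f_ ^~ x @ \oo --> f x) -> trig_null f.
Proof.
move=> nf_ fM ff.
have mf : measurable_fun setT f.
  by apply: (measurable_fun_cvg (h := f_)) => //; move=> n; have [] := nf_ n.
split=> //.
  exists M => x; have nf : (fun n => `|f_ n x|) @ \oo --> `|f x| by apply: cvg_norm; exact: ff.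
  rewrite -(cvg_lim _ nf)//; apply: limr_le; first by apply/cvg_ex; eexists; exact: nf.
  by apply: nearW => n; exact: fM.
move=> g th Lg.
have [M' kM] := kb.
have mfn n : measurable_fun setT (EFin \o (fun x => f_ n x * cos (g x + th) * k x)).
  apply/measurable_EFinP; apply: measurable_funM => //; apply: measurable_funM => //.
    by have [] := nf_ n.
  by apply: measurable_cosD; exact: Lm.
have mfl : measurable_fun setT (EFin \o (fun x => f x * cos (g x + th) * k x)).
  apply/measurable_EFinP; apply: measurable_funM => //; apply: measurable_funM => //.
  by apply: measurable_cosD; exact: Lm.
have ig : P.-integrable setT (EFin \o cst (M * M')).
  by apply: bounded_integrable; [exact: measurable_cst|exists `|M * M'|].
have cfl : {ae P, forall x, setT x ->
    (EFin \o (fun x => f_ n x * cos (g x + th) * k x)) x @[n --> \oo] -->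
    (EFin \o (fun x => f x * cos (g x + th) * k x)) x}.
  apply: aeW => x _; apply/cvg_EFin; first exact: nearW.
  by apply: cvgM; [apply: cvgM; [exact: ff|exact: cvg_cst]|exact: cvg_cst].
have [|_ _] := @dominated_convergence _ _ _ P setT measurableT _ _ _ mfn mfl cfl ig.
  apply: aeW => x n _; rewrite /= lee_fin normrM ler_pM// normrM.
  by rewrite -[leRHS]mulr1 ler_pM// cos_max.
move=> H; have E : (fun n => \int[P]_x (f_ n x * cos (g x + th) * k x)%:E)%E = cst 0%E.
  by apply/funext => n /=; have [_ _ ->] := nf_ n.
have {}H : cst 0%E @ \oo --> (\int[P]_x (f x * cos (g x + th) * k x)%:E)%E.
  by rewrite -E; exact: H.
by rewrite -(cvg_lim _ H)// lim_cst.
Qed.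

Section threshold.
Variables (g : T -> R) (al be eta : R).
Hypothesis Lg : L g.
Let y x := al + be * cos (g x + eta).

Lemma trig_null_affine f : trig_null f -> trig_null (fun x => f x * y x).
Proof.
move=> nf; rewrite (_ : (fun x => _) =
    (fun x => al * f x + be * (f x * cos (g x + eta)))).
  by apply: trig_null_lin => //; exact: trig_null_cos.
by apply/funext => x; rewrite /y; ring.
Qed.

Lemma trig_null_affineX f n : trig_null f -> trig_null (fun x => f x * y x ^+ n).
Proof.
move=> nf; elim: n => [|n IH].
  by rewrite (_ : (fun x => _) = f)//; apply/funext => x; rewrite expr0 mulr1.
rewrite (_ : (fun x => _) = (fun x => f x * y x ^+ n * y x)).
  exact: trig_null_affine.
by apply/funext => x; rewrite exprSr mulrA.
Qed.

Lemma trig_null_affineXX f n m : trig_null f ->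
  trig_null (fun x => f x * (1 - y x ^+ n) ^+ m).
Proof.
move=> nf; elim: m => [|m IH].
  by rewrite (_ : (fun x => _) = f)//; apply/funext => x; rewrite expr0 mulr1.
rewrite (_ : (fun x => _) = (fun x => 1 * (f x * (1 - y x ^+ n) ^+ m) +
    -1 * (f x * (1 - y x ^+ n) ^+ m * y x ^+ n))).
  by apply: trig_null_lin => //; exact: trig_null_affineX.
by apply/funext => x; rewrite exprSr; ring.
Qed.

Lemma trig_null_threshold f : (forall x, 0 <= y x <= 1) -> trig_null f ->
  trig_null (fun x => f x * (2^-1 <= y x)%R%:R).
Proof.
move=> y01 nf; have [_ [M fM] _] := nf.
pose p n (u : R) := 1 - (1 - u ^+ n) ^+ (n.+1 * 2 ^ n).
have p01 n u : 0 <= u <= 1 -> 0 <= p n u <= 1.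
  move=> /andP[u0 u1]; rewrite /p.
  have w0 : 0 <= 1 - u ^+ n by rewrite subr_ge0 exprn_ile1.
  rewrite subr_ge0 gerBl exprn_ge0// andbT exprn_ile1//.
  by rewrite gerBl exprn_ge0.
apply: (@trig_null_lim (fun n x => f x * p n (y x)) _ M).
- move=> n; rewrite (_ : (fun x => _) = (fun x => 1 * f x +
    -1 * (f x * (1 - y x ^+ n) ^+ (n.+1 * 2 ^ n)))).
    by apply: trig_null_lin => //; exact: trig_null_affineXX.
  by apply/funext => x; rewrite /p; ring.
- move=> n x; rewrite normrM -[leRHS]mulr1 ler_pM//.
  by have /andP[? ?] := p01 n _ (y01 x); rewrite ger0_norm.
- by move=> x; apply: cvgM; [exact: cvg_cst|exact: threshold_cvg].
Qed.

End threshold.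

(* [`|z| <= r] amounts to [cos (r * t) <= cos (z * t)] for [t] small. *)
Lemma trig_null_ball (f g : T -> R) c r : L g -> 0 <= r -> trig_null f ->
  trig_null (fun x => f x * (`|g x - c| <= r)%R%:R).
Proof.
move=> Lg r0 nf; have [_ [M fM] _] := nf.
(* [N0] exceeds [r], so [r * t n < 1]: both arguments are to stay in a range where the cosine
   decreases. *)
pose N0 := (Num.trunc r).+1.
pose t n : R := (N0 + n)%:R^-1.
have Nr n : r < (N0 + n)%:R.
  apply: (@lt_le_trans _ _ N0%:R); last by rewrite ler_nat leq_addr.
  by have /andP[_ ->] := truncn_itv r0.
have t0 n : 0 < t n by rewrite invr_gt0; exact: le_lt_trans r0 (Nr n).
have rt n : r * t n < 1 by rewrite /t ltr_pdivrMr ?mul1r// (le_lt_trans r0).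
(* [y] is [2^-1] plus a quarter of the difference of the two cosines to be compared: it lies in
   [0, 1] and passes [2^-1] exactly when the comparison holds. *)
pose al n := 2^-1 - cos (r * t n) / 4.
pose y n x := al n + 4^-1 * cos (t n * g x + - (c * t n)).
have yE n x : (2^-1 <= y n x) = (cos (r * t n) <= cos (t n * (g x - c))).
  rewrite /y /al (_ : t n * g x + - (c * t n) = t n * (g x - c)); last by ring.
  by apply/idP/idP; lra.
apply: (@trig_null_lim (fun n x => f x * (2^-1 <= y n x)%R%:R) _ M).
- move=> n; apply: trig_null_threshold => //; first exact: LZ.
  move=> x; rewrite /al; have := cos_le1 (r * t n); have := cos_geN1 (r * t n).
  have := cos_le1 (t n * g x + - (c * t n)); have := cos_geN1 (t n * g x + - (c * t n)).
  by move=> ? ? ? ?; apply/andP; split; lra.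
- move=> n x; rewrite normrM -[leRHS]mulr1 ler_pM//.
  by rewrite normr_nat lern1 leq_b1.
- move=> x; apply: cvgM; first exact: cvg_cst.
  (* At a fixed point [x], once [t n] is small enough for [|g x - c| * t n <= 1], the comparison of
     cosines no longer depends on [n]. *)
  apply: cvg_near_cst; exists (Num.trunc `|g x - c|).+1 => // n /= hn.
  rewrite yE -(cos_norm (t n * _)) normrM (gtr0_norm (t0 n)).
  have xn : `|g x - c| * t n <= 1.
    rewrite /t ler_pdivrMr ?(le_lt_trans r0)// mul1r.
    have /andP[_ /ltW/le_trans] := truncn_itv (normr_ge0 (g x - c)); apply.
    by rewrite ler_nat (leq_trans hn)// leq_addl.
  have pi1 : (1 : R) <= pi by rewrite (le_trans _ (pi_ge2 R))// ler1n.
  rewrite [t n * _]mulrC.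
  have in1 z : 0 <= z <= 1 -> z \in `[0, (pi : R)].
    by move=> /andP[z0 z1]; rewrite in_itv /= z0 (le_trans z1).
  have -> : (cos (r * t n) <= cos (`|g x - c| * t n)) = (`|g x - c| <= r); last by [].
  rewrite leNgt ltr_cos ?in1// -?leNgt ?ler_pM2r//.
  + by rewrite mulr_ge0 ?(ltW (t0 n))//= ?xn ?(ltW (rt n)).
  + by rewrite mulr_ge0 ?(ltW (t0 n))//= ?xn ?(ltW (rt n)).
Qed.

(** Asking that multiplication by the indicator preserve the class, rather than that the indicator
    belong to it, makes intersection a composition. The stable events are then a sigma-algebra
    outright, with no pi-system argument. *)
Definition trig_null_stable (E : set T) :=
  measurable E /\ forall f, trig_null f -> trig_null (fun x => f x * \1_E x).

Lemma trig_null_stable_sigma_algebra : sigma_algebra setT trig_null_stable.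
Proof.
have sT : trig_null_stable setT.
  split=> // f nf; rewrite (_ : (fun x => _) = f)//.
  by apply/funext => x; rewrite indicT mulr1.
have sC E : trig_null_stable E -> trig_null_stable (~` E).
  move=> [mE sE]; split; first exact: measurableC.
  move=> f nf; rewrite (_ : (fun x => _) = (fun x => 1 * f x + -1 * (f x * \1_E x))).
    by apply: trig_null_lin => //; exact: sE.
  by apply/funext => x; rewrite !indicE in_setC; case: (x \in E) => /=; ring.
have sI E F : trig_null_stable E -> trig_null_stable F -> trig_null_stable (E `&` F).
  move=> [mE sE] [mF sF]; split; first exact: measurableI.
  move=> f nf; rewrite (_ : (fun x => _) = (fun x => f x * \1_E x * \1_F x)).
    by apply: sF; exact: sE.
  by apply/funext => x; rewrite indicI /= mulrA.
have sU E F : trig_null_stable E -> trig_null_stable F -> trig_null_stable (E `|` F).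
  by move=> sE sF; rewrite -(setCK (_ `|` _)) setCU; apply/sC/sI; exact: sC.
split.
- by rewrite -setCT; exact: sC.
- by move=> E sE; rewrite setTD; exact: sC.
- move=> F sF.
  have sFn n : trig_null_stable (\big[setU/set0]_(i < n) F i).
    elim: n => [|n IH]; first by rewrite big_ord0 -setCT; exact: sC.
    by rewrite big_ord_recr; exact: sU.
  split; first by apply: bigcupT_measurable => n; have [] := sF n.
  move=> f nf; have [_ [M fM] _] := nf.
  apply: (@trig_null_lim (fun n x => f x * \1_(\big[setU/set0]_(i < n) F i) x) _ M).
  + by move=> n; apply (sFn n).2.
  + move=> n x; rewrite normrM -[leRHS]mulr1 ler_pM//.
    by rewrite indicE normr_nat lern1 leq_b1.
  + move=> x; apply: cvgM; first exact: cvg_cst.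
    have [[n _ Fx]|nF] := pselect ((\bigcup_n F n) x).
      apply: cvg_near_cst; exists n.+1 => // m /= nm.
      rewrite !indicE !mem_set//; first by exists n.
      by rewrite -bigcup_mkord; exists n.
    apply: cvg_near_cst; apply: nearW => m.
    rewrite !indicE !memNset//; rewrite -bigcup_mkord => -[n _ Fx].
    by apply: nF; exists n.
Qed.

Lemma trig_null_stable_preimage g (B : set R) : L g -> measurable B ->
  trig_null_stable (g @^-1` B).
Proof.
move=> Lg mB; have mg := Lm Lg.
have sA := trig_null_stable_sigma_algebra.
have sitv c r : 0 <= r -> trig_null_stable (g @^-1` [set z | `|z - c| <= r]).
  move=> r0; split.
    rewrite -[_ @^-1` _]setTI; apply: mg => //.
    rewrite (_ : [set z | _] = `[c - r, c + r]%classic) //.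
    by apply/seteqP; split=> z /=; rewrite in_itv /= ler_distl.
  move=> f nf; rewrite (_ : (fun x => _) =
    (fun x => f x * (`|g x - c| <= r)%R%:R)); first exact: trig_null_ball.
  apply/funext => x; rewrite indicE; congr (_ * _%:R).
  by congr nat_of_bool; apply/idP/idP; rewrite inE.
(* The half-line from [x] is the union of the intervals from [x] to [x + n], written as balls. *)
have sray x : trig_null_stable (g @^-1` `[x, +oo[%classic).
  rewrite (_ : _ @^-1` _ =
      \bigcup_n g @^-1` [set z | `|z - (x + n%:R / 2)| <= n%:R / 2]).
    by have [_ _ sU] := sA; apply: sU => n; apply: sitv; rewrite divr_ge0.
  apply/seteqP; split=> z /=; rewrite in_itv /= andbT.
    move=> xz; exists (Num.trunc (g z - x)).+1 => //=; rewrite ler_distl.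
    have /andP[_] := truncn_itv (etrans (subr_ge0 x (g z)) xz).
    by move=> H; apply/andP; split; lra.
  by move=> [n _] /=; rewrite ler_distl => /andP[]; lra.
have mB' : (@RGenCInfty.G R).-sigma.-measurable B by rewrite -RGenCInfty.measurableE.
have : preimage_set_system setT g ((@RGenCInfty.G R).-sigma.-measurable) `<=`
    trig_null_stable.
  rewrite -g_sigma_preimageE.
  apply: smallest_sub => // _ [_ [x ->] <-].
  by rewrite setTI; exact: sray.
by apply; exists B => //; rewrite setTI.
Qed.

(** The constant 1 is in the class by [Hk]. Multiplying it by the indicator of [E] and testing
    against the cosine of the zero function leaves the integral of [k] over [E]. *)
Lemma trig_null_sigma E : <<s [set X | exists g B, [/\ L g, measurable B &
  X = g @^-1` B]] >> E -> (\int[P]_(x in E) (k x)%:E = 0)%E.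
Proof.
move=> sE; have [mE sEE] : trig_null_stable E.
  apply: sE; split; first exact: trig_null_stable_sigma_algebra.
  by move=> _ [g [B [Lg mB ->]]]; exact: trig_null_stable_preimage.
have [_ _ /(_ (cst 0) 0 L0)] := sEE _ trig_null1.
move=> H; rewrite integral_mkcond -[RHS]H; apply: eq_integral => x _ /=.
rewrite addr0 cos0 mulr1 mul1r patchE indicE.
by case: ifP => _; rewrite ?mul1r ?mul0r.
Qed.

End trig_class.

(** * Positive definite matrices *)

Section posdef_theory.
Context (R : realType).

Lemma posdef_scale d (a : R) (A : 'M[R]_d) : 0 < a -> posdef A -> posdef (a *: A).
Proof.
move=> a0 [tA pA]; split; first by rewrite linearZ /= tA.
by move=> v v0; rewrite -scalemxAr -scalemxAl mxE mulr_gt0// pA.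
Qed.

Lemma tr_mul_ge0 n (v : 'cV[R]_n) : 0 <= (v^T *m v) 0 0.
Proof. by rewrite mxE; apply: sumr_ge0 => i _; rewrite !mxE -expr2 sqr_ge0. Qed.

Lemma tr_mul_gt0 n (v : 'cV[R]_n) : v != 0 -> 0 < (v^T *m v) 0 0.
Proof.
move=> v0; rewrite lt_def tr_mul_ge0 andbT; apply: contra v0 => /eqP.
rewrite mxE => /eqP; rewrite psumr_eq0; last first.
  by move=> i _; rewrite !mxE -expr2 sqr_ge0.
move=> /allP H; apply/eqP/matrixP => i j; rewrite ord1 mxE.
by have := H i (mem_index_enum i); rewrite !mxE /= mulf_eq0 orbb => /eqP.
Qed.

Lemma posdef1 d : posdef (1%:M : 'M[R]_d).
Proof. by split=> [|v v0]; rewrite ?trmx1// mulmx1 tr_mul_gt0. Qed.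

Lemma posdef_unit d (A : 'M[R]_d) : posdef A -> A \in unitmx.
Proof.
move=> [tA pA]; rewrite -row_free_unit -kermx_eq0; apply/negPn/negP => k0.
have [i] : exists i, row i (kermx A) != 0.
  apply/existsP; rewrite -negb_forall; apply: contra k0 => /forallP H.
  by apply/eqP/row_matrixP => i; rewrite row0; apply/eqP/H.
set v := row i _ => v0.
have vA : v *m A = 0 by apply/eqP; rewrite -row_mul mulmx_ker row0.
have /pA : v^T != 0 by apply: contra v0 => /eqP v0; rewrite -[v]trmxK v0 trmx0.
by rewrite trmxK vA mul0mx mxE ltxx.
Qed.

Lemma posdef_inv d (A : 'M[R]_d) : posdef A -> posdef (invmx A).
Proof.
move=> pA; have uA := posdef_unit pA; case: (pA) => tA posA.
split; first by rewrite trmx_inv tA.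
move=> v v0; have := posA (invmx A *m v); rewrite trmx_mul trmx_inv tA.
rewrite !mulmxA mulmxKV//; apply; apply: contra v0 => /eqP H.
by rewrite -[v](mulKVmx uA) H mulmx0.
Qed.

Lemma posdef_congr m n (A : 'M[R]_m) (B : 'M[R]_(n, m)) :
  posdef A -> (forall v : 'cV_n, B^T *m v = 0 -> v = 0) -> posdef (B *m A *m B^T).
Proof.
move=> [tA pA] injB; split; first by rewrite !trmx_mul tA trmxK mulmxA.
move=> v v0; rewrite !mulmxA -mulmxA.
have := pA (B^T *m v); rewrite trmx_mul trmxK !mulmxA; apply.
by apply: contra v0 => /eqP/injB ->.
Qed.

Lemma posdef_ge0 d (A : 'M[R]_d) (v : 'cV_d) : posdef A -> 0 <= (v^T *m A *m v) 0 0.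
Proof.
move=> [_ pA]; have [->|v0] := eqVneq v 0; last exact/ltW/pA.
by rewrite mulmx0 mxE.
Qed.

Lemma posdefD_congr m n (A : 'M[R]_m) (B : 'M[R]_(n, m)) (C : 'M[R]_n) :
  posdef A -> posdef C -> posdef (C + B *m A *m B^T).
Proof.
move=> pA [tC pC]; split.
  by rewrite linearD /= tC !trmx_mul trmxK (proj1 pA) mulmxA.
move=> v v0; rewrite mulmxDr mulmxDl mxE ltr_pwDl ?pC//.
have := posdef_ge0 (B^T *m v) pA.
by rewrite trmx_mul trmxK !mulmxA.
Qed.

(* Cholesky factorization, by recursion on the Schur complement of [A 0 0]. *)
Lemma posdef_factor d (A : 'M[R]_d) : posdef A -> exists L : 'M[R]_d, A = L *m L^T.
Proof.
elim: d => [|d IH] in A *.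
  by move=> _; exists 0; apply/matrixP => -[].
move: A; rewrite -[d.+1]/(1 + d)%N => A pA; have [tA posA] := pA.
pose a := A 0 0; pose b := dlsubmx A; pose C := drsubmx A.
have AE : A = block_mx (a%:M : 'M[R]_1) b^T b C.
  rewrite -[LHS]submxK; congr (block_mx _ _ _ _).
    apply/matrixP => i j; rewrite !ord1 !mxE eqxx mulr1n.
    by congr (A _ _); apply/val_inj.
  by rewrite -[in LHS]tA; apply/matrixP => i j; rewrite !mxE.
have tC : C^T = C.
  by rewrite /C -[in LHS]tA; apply/matrixP => i j; rewrite !mxE.
have a0 : 0 < a.
  have := posA (delta_mx 0 0); rewrite trmx_delta -rowE -colE !mxE; apply.
  by apply/negP => /eqP/matrixP/(_ 0 0)/eqP; rewrite !mxE oner_eq0.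
have ra : a *: 1%:M = a%:M :> 'M[R]_1 by rewrite scalemx1.
pose S := C - a^-1 *: (b *m b^T).
have pS : posdef S.
  split; first by rewrite linearB linearZ /= trmx_mul trmxK tC.
  (* For given [w] this first coordinate minimizes the quadratic form of [A], and the minimum is the
     quadratic form of [S] at [w]. *)
  move=> w w0; pose u := col_mx (- (a^-1 *: (b^T *m w))) w.
  have Au : A *m u = col_mx 0 (S *m w).
    rewrite AE mul_block_col mul_scalar_mx scalerN scalerA divff ?gt_eqF// scale1r.
    rewrite addNr; congr col_mx.
    by rewrite mulmxN -scalemxAr mulmxBl -scalemxAl mulmxA addrC.
  have := posA u; rewrite -mulmxA Au tr_col_mx mul_row_col mulmx0 add0r mulmxA; apply.
  apply: contra w0 => /eqP u0; apply/eqP.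
  by rewrite -[w](col_mxKd (- (a^-1 *: (b^T *m w)))) -/u u0 linear0.
have [L1 SE] := IH _ pS.
pose s := Num.sqrt a.
have ss : s * s = a by rewrite -expr2 sqr_sqrtr// ltW.
have s0 : s != 0 by rewrite gt_eqF// sqrtr_gt0.
exists (block_mx (s%:M : 'M[R]_1) 0 (s^-1 *: b) L1).
rewrite tr_block_mx mulmx_block !trmx0 !mulmx0 !mul0mx !addr0 AE.
rewrite tr_scalar_mx !linearZ /=; congr block_mx.
- by rewrite -scalar_mxM ss.
- by rewrite mul_scalar_mx scalerA ?divff ?mulVf// scale1r.
- by rewrite mul_mx_scalar scalerA ?divff ?mulVf// scale1r.
- rewrite -SE -!scalemxAl.
  rewrite linearZ /= scalerA -invfM ss.
  by rewrite addrC subrK.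
Qed.

End posdef_theory.

(** * Reciprocity condition and induced models *)

Section cml_algebra.
Context (R : realType) (d : nat).
Implicit Types A B C K M : 'M[R]_d.

Lemma mulmx_inv_unique A B : A *m B = 1%:M -> invmx A = B.
Proof.
move=> AB; have [uA _] := mulmx1_unit AB.
by rewrite -[RHS](mulKmx uA) AB mulmx1.
Qed.

Lemma woodbury A C M : posdef C -> posdef M ->
  invmx (C + A *m M *m A^T) = invmx C -
    invmx C *m A *m invmx (invmx M + A^T *m invmx C *m A) *m A^T *m invmx C.
Proof.
move=> pC pM; have uC := posdef_unit pC; have uM := posdef_unit pM.
set H := invmx M + A^T *m invmx C *m A.
have uH : H \in unitmx.
  have := posdefD_congr A^T (posdef_inv pC) (posdef_inv pM).
  by rewrite trmxK => /posdef_unit.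
apply: mulmx_inv_unique.
(* The definition of [H] multiplied by [M]. It splits the last term of the expanded product into two
   parts that cancel the other corrections. *)
have E : M *m A^T *m invmx C *m A = M *m H - 1%:M.
  by rewrite /H mulmxDr mulmxV// !mulmxA [1%:M + _]addrC addrK.
rewrite mulmxDl !mulmxBr !mulmxA mulmxV// mul1mx.
have -> : A *m M *m A^T *m invmx C *m A *m invmx H *m A^T *m invmx C =
    A *m (M *m A^T *m invmx C *m A) *m invmx H *m A^T *m invmx C by rewrite !mulmxA.
rewrite E mulmxBr mulmx1 !mulmxBl !mulmxA.
have -> : A *m M *m H *m invmx H = A *m M by rewrite -mulmxA mulmxV// mulmx1.
set X := A *m invmx H *m _ *m _; set Y := A *m M *m _ *m _.
by rewrite opprB [Y + _]addrC subrK subrK.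
Qed.

Variables (N : nat) (Gprev Glast G : nat -> 'M[R]_d).
Hypothesis hG : forall k, (0 < k < N)%N -> posdef (G k).

Definition reciprocal_gains := forall k, (0 < k)%N -> (k.+1 < N)%N ->
  invmx (G k) *m Glast k = (Gprev k.+1)^T *m invmx (G k.+1) *m Glast k.+1.

Section induced.
Variables (Mprev M : nat -> 'M[R]_d).

Lemma big_mulmx_rcons (F : nat -> 'M[R]_d) s k :
  \big[mulmx/1%:M]_(i <- rcons s k) F i = (\big[mulmx/1%:M]_(i <- s) F i) *m F k.
Proof.
elim: s => [|i s IH] /=; first by rewrite big_cons !big_nil mulmx1 mul1mx.
by rewrite !big_cons IH mulmxA.
Qed.

Lemma trans_prodN : trans_prod N Mprev N = 1%:M.
Proof. by rewrite /trans_prod /index_iota subnn /= big_nil. Qed.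

Lemma trans_prodS k : (k < N)%N ->
  trans_prod N Mprev k = trans_prod N Mprev k.+1 *m Mprev k.+1.
Proof.
move=> kN; rewrite /trans_prod.
have -> : index_iota k.+1 N.+1 = k.+1 :: index_iota k.+2 N.+1.
  by rewrite /index_iota subSn.
by rewrite rev_cons big_mulmx_rcons.
Qed.

Lemma trans_covS k : (k < N)%N -> trans_cov N Mprev M k = trans_cov N Mprev M k.+1 +
  trans_prod N Mprev k.+1 *m M k.+1 *m (trans_prod N Mprev k.+1)^T.
Proof. by move=> kN; rewrite /trans_cov big_ltn// addrC. Qed.

Hypothesis pM : forall k, (0 < k <= N)%N -> posdef (M k).

Lemma trans_covN : (0 < N)%N -> trans_cov N Mprev M N.-1 = M N.
Proof.
move=> N0; have /trans_covS -> : (N.-1 < N)%N by rewrite prednK.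
rewrite prednK// trans_prodN trmx1 mul1mx mulmx1.
by rewrite /trans_cov /index_iota subnn big_nil add0r.
Qed.

Lemma trans_cov_posdef k : (k < N)%N -> posdef (trans_cov N Mprev M k).
Proof.
move=> kN; have N0 : (0 < N)%N by exact: leq_ltn_trans kN.
have kE : (k = N.-1 - (N.-1 - k))%N by rewrite subKn// -ltnS prednK.
rewrite kE; elim: (N.-1 - k)%N => [|m IH].
  by rewrite subn0 trans_covN//; apply: pM; rewrite N0 leqnn.
(* The backward induction runs over truncated subtraction: from [m = N.-1] on, the index stays at 0
   and the induction hypothesis is the goal. *)
have [le|gt] := leqP N.-1 m.
  have -> : (N.-1 - m.+1 = N.-1 - m)%N by move: le; lia.
  exact: IH.
have lt : (N.-1 - m.+1 < N)%N by move: N0; lia.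
rewrite trans_covS//; have -> : (N.-1 - m.+1).+1 = (N.-1 - m)%N by move: gt; lia.
by apply: posdefD_congr => //; apply: pM; apply/andP; split; move: gt N0; lia.
Qed.

Lemma induced_reciprocal_gains :
  CML_induced N Gprev Glast G Mprev M -> reciprocal_gains.
Proof.
move=> ind k k0 kN.
have k1N : (0 < k.+1 < N)%N by [].
have kN' : (0 < k < N)%N by rewrite k0 (ltn_trans _ kN).
have [_ gk _] := ind k kN'.
have [pk1 gk1 Gk1] := ind k.+1 k1N.
have uGk := posdef_unit (hG kN'); have uGk1 := posdef_unit (hG k1N).
have kltN : (k < N)%N by case/andP: kN'.
rewrite gk !mulmxA mulVmx// mul1mx.
rewrite trans_prodS// trans_covS//.
set A := trans_prod N Mprev k.+1; set C := trans_cov N Mprev M k.+1.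
have pC : posdef C by exact: trans_cov_posdef.
have pMk : posdef (M k.+1) by apply: pM; rewrite /= ltnW.
have [tC _] := pC; have [tG _] := hG k1N.
(* The third induction equation at [k.+1] says that the inner inverse of the Woodbury formula is
   [G k.+1] itself. *)
rewrite woodbury// -Gk1 -/A -/C.
have gE : invmx (G k.+1) *m Glast k.+1 = A^T *m invmx C.
  by rewrite gk1 !mulmxA mulVmx// mul1mx.
rewrite -[RHS]mulmxA gE pk1 -/A [in RHS]linearB /= !trmx_mul gk1 -/A -/C !trmx_mul trmxK.
rewrite trmx_inv tC tG !mulmxBr !mulmxBl !mulmxA.
by [].
Qed.

End induced.

(* The matrices [M] and [Mprev] are found by solving the induction equations
   backwards under the ansatz [C_{N|k} = S_k^-1] and [M_{N|k} = S_k^-1 K_k']. *)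
Lemma reciprocal_gains_induced : (0 < N)%N -> reciprocal_gains ->
  exists Mprev M : nat -> 'M[R]_d,
    (forall k, (0 < k <= N)%N -> posdef (M k)) /\
    CML_induced N Gprev Glast G Mprev M.
Proof.
move=> N0 rec.
have [K KE] : exists K : nat -> 'M[R]_d, forall k, K k = invmx (G k) *m Glast k.
  by exists (fun k => invmx (G k) *m Glast k).
(* The Woodbury formula makes the inverse of C_{N|k} grow by [K' G K] at each step in [k]; this is
   that recursion solved from time 0. The initial value only has to be positive definite. *)
pose S k : 'M[R]_d := 1%:M + \sum_(1 <= i < k.+1) (K i)^T *m G i *m K i.
have S0 : S 0%N = 1%:M by rewrite /S big_geq// addr0.
have SS k : S k.+1 = S k + (K k.+1)^T *m G k.+1 *m K k.+1.
  by rewrite /S big_nat_recr//= addrA.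
have pS k : (k < N)%N -> posdef (S k).
  elim: k => [|k IH] kN; first by rewrite S0; exact: posdef1.
  rewrite SS -[X in _ *m X](trmxK (K k.+1)); apply: posdefD_congr.
    exact: hG.
  by apply: IH; exact: ltnW.
(* The third equation gives [invmx (M k)] as [invmx (G k)] minus a correction in [S k]; Woodbury
   turns this into a sum, visibly positive definite, in [S k.-1]. At [N] the value is forced by
   C_{N|N-1} = M_N. *)
pose M k := if (k < N)%N then G k + Glast k *m invmx (S k.-1) *m (Glast k)^T
            else invmx (S N.-1).
(* The first equation reads [(1 - Glast M_{N|k}) Mprev = Gprev], whose left factor is
   [G k *m invmx (M k)]. At [N] the value is forced by M_{N|N-1} = M_{N,N-1}. *)
pose Mprev k := if (k < N)%N then M k *m invmx (G k) *m Gprev k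
            else invmx (S N.-1) *m (K N.-1)^T.
have N1 : (N.-1 < N)%N by rewrite prednK.
have pM k : (0 < k <= N)%N -> posdef (M k).
  move=> /andP[k0 kN]; rewrite /M; case: ifPn => [lt|ge].
    apply: posdefD_congr; last by apply: hG; rewrite k0.
    by apply/posdef_inv/pS; rewrite (leq_ltn_trans (leq_pred _)).
  exact/posdef_inv/pS.
have ME k : (0 < k < N)%N ->
    M k *m invmx (G k) = 1%:M + Glast k *m invmx (S k.-1) *m (K k)^T.
  move=> kN; have uG := posdef_unit (hG kN); have [tG _] := hG kN.
  move: (kN) => /andP[k0 lt]; rewrite /M lt mulmxDl mulmxV//.
  by rewrite KE trmx_mul trmx_inv tG !mulmxA.
have GK k : (0 < k < N)%N -> Glast k = G k *m K k.
  by move=> kN; rewrite KE mulmxA mulmxV ?mul1mx//; exact/posdef_unit/hG.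
(* The factor [M k *m invmx (G k)] lowers the index of [S] by one; both backward inductions below
   rest on this. *)
have SMG k : (0 < k < N)%N ->
    invmx (S k) *m (K k)^T *m (M k *m invmx (G k)) = invmx (S k.-1) *m (K k)^T.
  case: k => // k kN; have kN' : (k < N)%N by case/andP: kN => _ /ltnW.
  rewrite ME// -pred_Sn mulmxDr mulmx1 GK// !mulmxA.
  have uSk := posdef_unit (pS _ kN').
  have uSk1 := posdef_unit (pS k.+1 (proj2 (andP kN))).
  have E : (K k.+1)^T *m G k.+1 *m K k.+1 = S k.+1 - S k by rewrite SS addrAC subrr add0r.
  have -> : invmx (S k.+1) *m (K k.+1)^T *m G k.+1 *m K k.+1 =
     invmx (S k.+1) *m ((K k.+1)^T *m G k.+1 *m K k.+1) by rewrite !mulmxA.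
  rewrite E mulmxBr mulVmx// !mulmxBl mul1mx.
  by rewrite -[X in _ - X *m _]mulmxA mulmxV// mulmx1 addrC subrK.
have TP k : (0 < k < N)%N -> trans_prod N Mprev k = invmx (S k) *m (K k)^T.
  move=> kN; have kE : (k = N.-1 - (N.-1 - k))%N.
    by move: kN; lia.
  move: kN; rewrite kE; elim: (N.-1 - k)%N => [|m IH] kN.
    rewrite subn0 trans_prodS// prednK// trans_prodN mul1mx /Mprev ltnn.
    by [].
  set j := (N.-1 - m.+1)%N in kN *; have jS : (N.-1 - m = j.+1)%N by rewrite /j; move: kN; lia.
  rewrite jS in IH; have j1N : (0 < j.+1 < N)%N by rewrite -jS; move: kN; rewrite /j; lia.
  have jN : (j < N)%N by case/andP: kN.
  rewrite trans_prodS// IH// /Mprev (proj2 (andP j1N)) mulmxA SMG// -pred_Sn.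
  (* The reciprocity identity enters only here; transposed, it replaces [(K j.+1)^T *m Gprev j.+1]
     by [(K j)^T]. *)
  rewrite -mulmxA; congr (_ *m _); rewrite (KE j) rec//; last by case/andP: kN.
  by rewrite -mulmxA -KE trmx_mul trmxK.
have TC k : (k < N)%N -> trans_cov N Mprev M k = invmx (S k).
  move=> kN; have kE : (k = N.-1 - (N.-1 - k))%N.
    by move: kN; lia.
  move: kN; rewrite kE; elim: (N.-1 - k)%N => [|m IH] kN.
    by rewrite subn0 trans_covN// /M ltnn.
  have [le|gt] := leqP N.-1 m.
    have e : (N.-1 - m.+1 = N.-1 - m)%N by move: le; lia.
    by rewrite e in kN *; exact: IH.
  set j := (N.-1 - m.+1)%N in kN *; have jS : (N.-1 - m = j.+1)%N by rewrite /j; move: gt; lia.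
  rewrite jS in IH; have j1N : (0 < j.+1 < N)%N by rewrite -jS; move: gt; lia.
  have lt := proj2 (andP j1N).
  rewrite trans_covS// IH// TP// trmx_mul trmxK trmx_inv (proj1 (pS _ lt)).
  have uSk := posdef_unit (pS _ kN).
  have uSk1 := posdef_unit (pS _ lt).
  have := SMG _ j1N; rewrite -pred_Sn => SMGj.
  have -> : invmx (S j.+1) *m (K j.+1)^T *m M j.+1 *m (K j.+1 *m invmx (S j.+1)) =
     (invmx (S j.+1) *m (K j.+1)^T *m (M j.+1 *m invmx (G j.+1))) *m
     (G j.+1 *m K j.+1) *m invmx (S j.+1).
    rewrite !mulmxA; congr (_ *m _ *m _); rewrite -[RHS]mulmxA mulVmx ?mulmx1//.
    exact/posdef_unit/hG.
  rewrite SMGj.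
  (* From here on this is the resolvent identity: S_j^-1 (S_{j+1} - S_j) S_{j+1}^-1 = S_j^-1 -
     S_{j+1}^-1. *)
  have -> : invmx (S j) *m (K j.+1)^T *m (G j.+1 *m K j.+1) =
     invmx (S j) *m (S j.+1 - S j) by rewrite SS addrAC subrr add0r !mulmxA.
  rewrite mulmxBr mulVmx// mulmxBl mul1mx -mulmxA mulmxV// mulmx1.
  by rewrite addrC subrK.
exists Mprev, M; split=> // k kN.
have kN' : (k < N)%N by case/andP: kN.
have kp : (k.-1 < N)%N by rewrite (leq_ltn_trans (leq_pred _)).
have uG := posdef_unit (hG kN); have uS := posdef_unit (pS _ kN').
move=> MNk CNk; rewrite {}/MNk {}/CNk TP// TC// invmxK.
have tS : (S k)^T = S k by exact: (proj1 (pS _ kN')).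
have KK : (invmx (S k) *m (K k)^T)^T *m S k = K k.
  by rewrite trmx_mul trmxK trmx_inv tS mulmxKV.
have Minv : invmx (M k) = invmx (G k) - K k *m invmx (S k) *m (K k)^T.
  have -> : M k = G k + Glast k *m invmx (S k.-1) *m (Glast k)^T by rewrite /M kN'.
  rewrite woodbury; [|exact: hG|exact/posdef_inv/pS].
  have -> : invmx (invmx (S k.-1)) + (Glast k)^T *m invmx (G k) *m Glast k = S k.
    have := SS k.-1; rewrite prednK; last by case/andP: kN.
    move=> ->; rewrite invmxK.
    by rewrite KE trmx_mul trmx_inv (proj1 (hG kN)) !mulmxA mulmxKV.
  by rewrite KE trmx_mul trmx_inv (proj1 (hG kN)) !mulmxA.
split.
- have -> : Mprev k = M k *m invmx (G k) *m Gprev k by rewrite /Mprev kN'.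
  have uM := posdef_unit (pM k (introT andP (conj (proj1 (andP kN)) (ltnW kN')))).
  have H : (1%:M - Glast k *m (invmx (S k) *m (K k)^T)) *m (M k *m invmx (G k)) = 1%:M.
    have -> : 1%:M - Glast k *m (invmx (S k) *m (K k)^T) = G k *m invmx (M k).
      by rewrite Minv mulmxBr mulmxV// GK// !mulmxA.
    by rewrite mulmxA -[G k *m _ *m _]mulmxA mulVmx// mulmx1 mulmxV.
  rewrite -[LHS]mul1mx -[in LHS]H mulmxBl mul1mx mulmxBl; congr (_ - _).
  by rewrite !mulmxA.
- by rewrite -mulmxA KK GK.
- by rewrite KK Minv !mulmxA subrK invmxK.
Qed.

End cml_algebra.

(** * The standard normal law *)

Section image_measure.
Context d d' (T : measurableType d) (T' : measurableType d') (R : realType).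
Variables (m : {measure set T -> \bar R}) (f : T -> T').

(** The measurability proof is an argument, so that the measure structure, and later the probability
    structure, attaches to the term itself. *)
Definition image_measure (mf : measurable_fun [set: T] f) (A : set T') := m (f @^-1` A).

Hypothesis mf : measurable_fun [set: T] f.
Local Notation im := (image_measure mf).

Let im0 : im set0 = 0%E.
Proof. by rewrite /image_measure preimage_set0 measure0. Qed.

Let im_ge0 A : (0 <= im A)%E.
Proof. exact: measure_ge0. Qed.

Let im_sigma_additive : semi_sigma_additive im.
Proof.
move=> F mF tF mUF; rewrite /image_measure preimage_bigcup.
apply: measure_semi_sigma_additive.
- by move=> n; rewrite -[X in measurable X]setTI; exact: mf.
- apply/trivIsetP => i j _ _ ij; rewrite -preimage_setI.
  by move/trivIsetP : tF => /(_ _ _ _ _ ij) ->//; rewrite preimage_set0.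
- by rewrite -preimage_bigcup -[X in measurable X]setTI; exact: mf.
Qed.

HB.instance Definition _ := isMeasure.Build _ _ _ im im0 im_ge0 im_sigma_additive.

Lemma ge0_integral_image (g : T' -> \bar R) :
  measurable_fun setT g -> (forall y, 0 <= g y)%E ->
  (\int[im]_y g y = \int[m]_x g (f x))%E.
Proof. by move=> mg g0; rewrite -[LHS]/(\int[pushforward m f]_y g y)%E ge0_integral_pushforward. Qed.

Lemma integral_image (g : T' -> \bar R) :
  measurable_fun setT g -> (\int[im]_y g y = \int[m]_x g (f x))%E.
Proof.
move=> mg; rewrite [LHS]integralE [RHS]integralE; congr (_ - _)%E.
  have mp : measurable_fun setT (g^\+)%E by exact: measurable_funepos.
  by rewrite ge0_integral_image; [by apply: eq_integral => x _; rewrite !funeposE|exact: mp|by move=> y; exact: funepos_ge0].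
have mn : measurable_fun setT (g^\-)%E by exact: measurable_funeneg.
by rewrite ge0_integral_image; [by apply: eq_integral => x _; rewrite !funenegE|exact: mn|by move=> y; exact: funeneg_ge0].
Qed.

End image_measure.

(** * Affine changes of variable in Lebesgue integrals *)

Section lebesgue_affine.
Context (R : realType).
Local Notation mu := (@lebesgue_measure R).

(** Uniqueness of Lebesgue measure: the left-hand side is a measure in [A] that gives each half-open
    interval its length. *)
Lemma lebesgue_measure_affine (a b : R) (A : set R) : 0 < a -> measurable A ->
  (a%:E * mu ((fun x => a * x + b)%R @^-1` A) = mu A)%E.
Proof.
move=> a0 mA.
have mf : measurable_fun (setT : set (measurableTypeR R))
    (fun x : R => a * x + b : measurableTypeR R).
  by apply: measurable_funD => //; exact: measurable_funM.
pose nu : {measure set (measurableTypeR R) -> \bar R} :=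
  mscale (NngNum (ltW a0)) (image_measure (mu : {measure set _ -> \bar R}) mf).
transitivity (nu A); first by [].
apply/esym/(lebesgue_measure_unique (mu := nu)) => // _ [[x y]] _ <-.
have preE : (fun x => a * x + b) @^-1` `]x, y]%classic =
    `](x - b) / a, (y - b) / a]%classic.
  apply/seteqP; split=> z /=; rewrite !in_itv /= ltr_pdivrMr// ler_pdivlMr//.
    by move=> /andP[? ?]; apply/andP; split; lra.
  by move=> /andP[? ?]; apply/andP; split; lra.
pose J : set R := `](x - b) / a, (y - b) / a]%classic.
transitivity (a%:E * mu J)%E; last first.
  by rewrite -[RHS]/(a%:E * mu ((fun x => a * x + b)%R @^-1` `]x, y]%classic))%E preE.
rewrite /J !lebesgue_measure_itv /= !lte_fin ltr_pM2r ?invr_gt0// ltrD2r.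
case: ifP => _; last by rewrite mule0.
rewrite -!EFinB -EFinM; congr EFin; field.
by rewrite gt_eqF.
Qed.

Lemma ge0_integral_affine (a b : R) (f : R -> \bar R) : 0 < a ->
  measurable_fun setT f -> (forall x, 0 <= f x)%E ->
  (\int[mu]_x f x = a%:E * \int[mu]_x f (a * x + b)%R)%E.
Proof.
move=> a0 mf f0.
have maf : measurable_fun (setT : set (measurableTypeR R))
    (fun x : R => a * x + b : measurableTypeR R).
  by apply: measurable_funD => //; exact: measurable_funM.
pose nu : {measure set (measurableTypeR R) -> \bar R} :=
  mscale (NngNum (ltW a0)) (image_measure (mu : {measure set _ -> \bar R}) maf).
transitivity (\int[nu]_x f x)%E.
  by apply: eq_measure_integral => A mA _; exact: esym (lebesgue_measure_affine b a0 mA).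
rewrite ge0_integral_mscale//; congr (_ * _)%E.
by rewrite ge0_integral_image.
Qed.

Lemma ge0_integral_opp (f : R -> \bar R) :
  measurable_fun setT f -> (forall x, 0 <= f x)%E ->
  (\int[mu]_x f x = \int[mu]_x f (- x)%R)%E.
Proof.
move=> mf f0.
transitivity (\int[pushforward mu (-%R : R -> measurableTypeR R)]_x f x)%E.
  by apply: eq_measure_integral => A mA _; exact/esym/lebesgue_measureN.
by rewrite ge0_integral_pushforward.
Qed.

End lebesgue_affine.

(** * Integration against a measure given by a density *)

Section density.
Context d (T : measurableType d) (R : realType).
Variables (nu : {finite_measure set T -> \bar R})
  (mu : {sigma_finite_measure set T -> \bar R}) (p : T -> \bar R).
Hypothesis p0 : forall x, (0 <= p x)%E.
Hypothesis ip : mu.-integrable setT p.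
Hypothesis nuE : forall A, measurable A -> (nu A = \int[mu]_(x in A) p x)%E.

(** [p] and the Radon-Nikodym derivative of [nu] have the same integrals over all measurable sets,
    hence agree almost everywhere, and the change of variables known for the derivative passes to
    [p]. *)
Lemma ge0_integral_density (f : T -> \bar R) :
  measurable_fun setT f -> (forall x, 0 <= f x)%E ->
  (\int[nu]_x f x = \int[mu]_x (f x * p x))%E.
Proof.
move=> mf f0.
have dom : nu `<< mu.
  apply/null_content_dominatesP => A mA muA; rewrite nuE//.
  by apply: null_set_integral => //; apply: measurable_funTS; case/integrableP: ip.
have iRN := Radon_Nikodym_SigmaFinite.f_integrable dom.
have mRN := measurable_int _ iRN.
have mp := measurable_int _ ip.
rewrite -(Radon_Nikodym_SigmaFinite.change_of_variables dom)//.
apply: ge0_ae_eq_integral => //.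
- exact: emeasurable_funM.
- exact: emeasurable_funM.
- by move=> x _; rewrite mule_ge0// Radon_Nikodym_SigmaFinite.f_ge0.
- by move=> x _; rewrite mule_ge0.
- apply: ae_eqe_mul2l; apply: integral_ae_eq => // E _ mE.
  by rewrite -nuE// -Radon_Nikodym_SigmaFinite.f_integral.
Qed.

End density.

(** * Density, symmetry and second moment of the standard normal law *)

Section standard_normal.
Context (R : realType).
Local Notation mu := (@lebesgue_measure R).
Local Notation phi := (@normal_pdf R 0 1).
Definition std : probability (measurableTypeR R) R := normal_prob 0 1.

Lemma std_pdfE (x : R) : phi x = (Num.sqrt (pi *+ 2))^-1 * expR (- (x ^+ 2 / 2)).
Proof.
rewrite normal_pdfE ?oner_neq0// /normal_peak /normal_fun.
by rewrite expr1n mul1r subr0 mulNr.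
Qed.

Lemma std_pdf_gt0 (x : R) : 0 < phi x.
Proof.
rewrite std_pdfE mulr_gt0 ?expR_gt0// invr_gt0 sqrtr_gt0.
by rewrite mulrn_wgt0// pi_gt0.
Qed.

Lemma ge0_integral_std (f : R -> \bar R) :
  measurable_fun setT f -> (forall x, 0 <= f x)%E ->
  (\int[std]_x f x = \int[mu]_x (f x * (phi x)%:E))%E.
Proof.
move=> mf f0; apply: ge0_integral_density => //.
- by move=> x; rewrite lee_fin normal_pdf_ge0.
- exact: integrable_normal_pdf.
Qed.

Lemma std_probE (A : set R) : measurable A ->
  (std A = \int[mu]_x ((\1_A x)%:E * (phi x)%:E))%E.
Proof.
move=> mA; rewrite -[A in LHS]setIT -integral_indic//= ge0_integral_std//.
exact/measurable_EFinP/measurable_indic.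
Qed.

Lemma std_opp (f : R -> \bar R) : measurable_fun setT f ->
  (forall x, 0 <= f x)%E -> (\int[std]_x f x = \int[std]_x f (- x)%R)%E.
Proof.
move=> mf f0.
have mfo : measurable_fun setT (fun x : R => f (- x)).
  by apply: measurableT_comp => //; exact: measurableT_comp.
rewrite ge0_integral_std// [RHS]ge0_integral_std; [|exact: mfo|by move=> x; exact: f0].
rewrite ge0_integral_opp.
- by apply: eq_integral => x _; rewrite !std_pdfE sqrrN.
- by apply: emeasurable_funM => //; apply/measurable_EFinP; exact: measurable_normal_pdf.
- by move=> x; rewrite mule_ge0// lee_fin normal_pdf_ge0.
Qed.

Lemma measurable_affine (a b : R) : measurable_fun setT (fun x : R => a * x + b).
Proof. by apply: measurable_funD => //; exact: measurable_funM. Qed.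

Lemma measurable_preimage_affine (a b : R) (A : set R) : measurable A ->
  measurable ((fun x : R => a * x + b) @^-1` A).
Proof. by move=> mA; rewrite -[X in measurable X]setTI; exact: measurable_affine. Qed.

Lemma std_opp_set (A : set R) : measurable A -> std ((-%R) @^-1` A) = std A.
Proof.
move=> mA.
have mNA : measurable ((-%R) @^-1` A).
  by rewrite -[X in measurable X]setTI; exact: oppr_measurable.
have H : (\int[std]_x (\1_A x)%:E = \int[std]_x (\1_A (- x))%:E)%E.
  apply: std_opp; first exact/measurable_EFinP/measurable_indic.
  by move=> x; rewrite lee_fin.
rewrite -[A in RHS]setIT -integral_indic//= H -[X in std X]setIT -integral_indic//.
Qed.

Lemma normal_prob_affine (m s : R) (A : set R) : s != 0 -> measurable A ->
  (normal_prob m s A = std ((fun z => s * z + m)%R @^-1` A))%E.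
Proof.
move=> s0 mA.
(* The density depends on [s] only through [s ^+ 2], and [std] is symmetric, so the sign of [s] can
   be changed on both sides. *)
wlog sp : s s0 / 0 < s.
  move=> H; have [/H->//|] := ltP 0 s; rewrite le_eqVlt (negbTE s0)/= => sn.
  transitivity (normal_prob m (- s) A).
    rewrite /normal_prob; apply: eq_integral => x _; congr EFin.
    rewrite /normal_pdf oppr_eq0 (negbTE s0).
    by rewrite /normal_peak /normal_fun sqrrN.
  rewrite H ?oppr_eq0 ?oppr_gt0//.
  rewrite -[RHS]std_opp_set; last exact: measurable_preimage_affine.
  by congr (std _); apply/seteqP; split=> x /=; rewrite mulNr mulrN.
have mpdf : measurable_fun setT (fun x : R => (normal_pdf m s x)%:E).
  by apply/measurable_EFinP; exact: measurable_normal_pdf.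
rewrite /normal_prob integral_mkcond.
transitivity (\int[mu]_x ((\1_A x)%:E * (normal_pdf m s x)%:E))%E.
  by apply: eq_integral => x _; rewrite patchE indicE; case: ifP; rewrite ?mul1e ?mul0e.
rewrite (ge0_integral_affine (a := s) m)//; last 2 first.
- by apply: emeasurable_funM => //; exact/measurable_EFinP/measurable_indic.
- by move=> x; rewrite -EFinM lee_fin mulr_ge0// normal_pdf_ge0.
rewrite std_probE; last exact: measurable_preimage_affine.
rewrite -ge0_integralZl//; first last.
- by rewrite lee_fin ltW.
- by move=> x _; rewrite -EFinM lee_fin mulr_ge0// normal_pdf_ge0.
- apply: emeasurable_funM; apply/measurable_EFinP.
    by apply: measurable_indic; exact: measurable_preimage_affine.
  by apply: measurableT_comp; [exact: measurable_normal_pdf|exact: measurable_affine].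
apply: eq_integral => x _; rewrite -!EFinM; congr EFin.
rewrite mulrCA; congr (_ * _); rewrite !normal_pdfE ?oner_neq0//.
rewrite /normal_peak /normal_fun addrK subr0 expr1n mul1r mulrA.
congr (_ * expR _); last first.
  by rewrite -mulr_natr -[in RHS]mulr_natr; field; rewrite gt_eqF.
rewrite -mulrnAr sqrtrM ?sqr_ge0// sqrtr_sqr gtr0_norm// invfM mulrA divff// ?mul1r//.
Qed.

Definition std_var : \bar R := (\int[std]_z (z ^+ 2)%:E)%E.

Lemma measurable_sqr : measurable_fun setT (fun x : R => (x ^+ 2)%:E).
Proof. by apply/measurable_EFinP; exact: measurable_funX. Qed.

Lemma std_var_lty : (std_var < +oo)%E.
Proof.
(* With this scale [phi (a * x)] is [phi x] times the exponential of [x ^+ 2 / 4], which dominates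
   [x ^+ 2 / 4]; hence the factor 4 in the bound. *)
pose a : R := (Num.sqrt 2)^-1.
have a0 : 0 < a by rewrite invr_gt0 sqrtr_gt0.
have aa : a ^+ 2 = 2^-1 by rewrite exprVn sqr_sqrtr.
have maphi : measurable_fun setT (fun x : R => (phi (a * x + 0))%:E).
  apply/measurable_EFinP; apply: measurableT_comp; first exact: measurable_normal_pdf.
  exact: measurable_affine.
rewrite /std_var ge0_integral_std//; [|exact: measurable_sqr|by move=> x; rewrite lee_fin sqr_ge0].
apply: (@le_lt_trans _ _ (\int[mu]_x (4%:E * (phi (a * x + 0))%:E))%E).
  apply: ge0_le_integral => //.
  - by move=> x _; rewrite -EFinM lee_fin mulr_ge0 ?sqr_ge0 ?normal_pdf_ge0.
  - apply: emeasurable_funM; first exact: measurable_sqr.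
    by apply/measurable_EFinP; exact: measurable_normal_pdf.
  - exact: emeasurable_funM.
  - move=> x _; rewrite -!EFinM lee_fin addr0 !std_pdfE mulrCA [leRHS]mulrCA.
    rewrite ler_wpM2l ?invr_ge0 ?sqrtr_ge0//.
    have -> : - ((a * x) ^+ 2 / 2) = - (x ^+ 2 / 2) + x ^+ 2 / 4.
      by rewrite exprMn aa; field.
    rewrite expRD; have := expR_ge1Dx (x ^+ 2 / 4).
    have := expR_gt0 (- (x ^+ 2 / 2)).
    by set e := expR (- _); set q := expR (_ / 4); set u := x ^+ 2; nra.
have mphi : measurable_fun setT (fun x : R => (phi x)%:E).
  by apply/measurable_EFinP; exact: measurable_normal_pdf.
have phi0 x : (0 <= (phi x)%:E)%E by rewrite lee_fin normal_pdf_ge0.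
have H := ge0_integral_affine 0 a0 mphi phi0.
rewrite ge0_integralZl//.
suff -> : (\int[mu]_x (phi (a * x + 0))%:E = (a^-1)%:E)%E by rewrite -EFinM ltry.
move: H; rewrite integral_normal_pdf.
case: (\int[mu]_x _)%E => [r| |].
- by rewrite -EFinM => -[H]; congr EFin; rewrite -[LHS](mulKf (lt0r_neq0 a0)) -H mulr1.
- by rewrite gt0_muley ?lte_fin.
- by rewrite gt0_muleNy ?lte_fin.
Qed.

Lemma std_var_gt0 : (0 < std_var)%E.
Proof.
apply: (@lt_le_trans _ _ (\int[mu]_x ((phi 2)%:E * (\1_`[1, 2] x)%:E))%E).
  have I : (\int[mu]_x (\1_`[(1 : R), 2] x)%:E = 1)%E.
    rewrite integral_indic//= setIT lebesgue_measure_itv /= lte_fin ltr1n -EFinB.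
    by congr EFin; lra.
  rewrite ge0_integralZl//= ?I ?mule1 ?lte_fin ?lee_fin ?normal_pdf_ge0 ?std_pdf_gt0//.
  exact/measurable_EFinP/measurable_indic.
rewrite /std_var ge0_integral_std; [|exact: measurable_sqr|by move=> x; rewrite lee_fin sqr_ge0].
apply: ge0_le_integral => //.
- by move=> x _; rewrite -EFinM lee_fin mulr_ge0 ?normal_pdf_ge0.
- apply: emeasurable_funM; first exact: measurable_cst.
  exact/measurable_EFinP/measurable_indic.
- apply: emeasurable_funM; first exact: measurable_sqr.
  by apply/measurable_EFinP; exact: measurable_normal_pdf.
- move=> x _; rewrite -!EFinM lee_fin indicE.
  have [x12|nx] := pselect (`[(1 : R), 2]%classic x); last first.
    by rewrite memNset// mulr0 mulr_ge0 ?sqr_ge0 ?normal_pdf_ge0.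
  rewrite mem_set//; move: x12; rewrite /= in_itv /= => /andP[x1 x2]; rewrite mulr1.
  apply: (@le_trans _ _ (phi x)); last first.
    by rewrite ler_peMl ?normal_pdf_ge0// exprn_ege1.
  rewrite !std_pdfE ler_wpM2l ?invr_ge0 ?sqrtr_ge0// ler_expR; nra.
Qed.

End standard_normal.

(** * Normal random variables: moments and integrals of cosines *)

Section gaussian_variable.
Context (R : realType).
Local Notation std := (@std R).
Local Notation MR := (measurableTypeR R).

Lemma integral_std_opp (f : R -> R) : measurable_fun setT f ->
  (\int[std]_x (f x)%:E = \int[std]_x (f (- x))%:E)%E.
Proof.
move=> mf; rewrite [LHS]integralE [RHS]integralE.
have mp : measurable_fun setT (fun x => (f x)%:E) by exact/measurable_EFinP.
have E1 := std_opp (measurable_funepos mp) (funepos_ge0 _).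
have E2 := std_opp (measurable_funeneg mp) (funeneg_ge0 _).
rewrite E1 E2; congr (_ - _)%E; apply: eq_integral => x _.
  by rewrite !funeposE.
by rewrite !funenegE.
Qed.

Lemma integral_std_odd (f : R -> R) : measurable_fun setT f ->
  (forall x, f (- x) = - f x) -> std.-integrable setT (EFin \o f) ->
  (\int[std]_x (f x)%:E = 0)%E.
Proof.
move=> mf of_ if_; have := integral_std_opp mf.
under [X in _ = X]eq_integral do rewrite of_ EFinN.
have fin : (\int[std]_x (f x)%:E)%E \is a fin_num by exact: integrable_fin_num if_.
rewrite integralN; last by exact: integrable_add_def if_.
move: fin; case: (\int[std]_x _)%E => // r _; rewrite -EFinN => -[H]; congr EFin; lra.
Qed.

Lemma bounded_integrable_std (f : R -> R) M : measurable_fun setT f ->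
  (forall x, `|f x| <= M) -> std.-integrable setT (EFin \o f).
Proof. by move=> mf fM; apply: bounded_integrable => //; exists M. Qed.

(* Unlike [normal_prob m s], also meaningful for [s = 0]; the sign of [s] is
   irrelevant. *)
Definition normal_rv_law d (T : measurableType d) (P : probability T R)
    (Y : T -> R) (m s : R) :=
  forall A, measurable A -> P (Y @^-1` A) = std ((fun z => s * z + m) @^-1` A).

Lemma normal_lawP d (T : measurableType d) (P : probability T R) (Y : T -> R) :
  normal_law P Y <-> exists m s, normal_rv_law P Y m s.
Proof.
have E (m s : R) A : measurable A ->
    ((if (s == 0)%R then \d_m A else normal_prob m s A) =
    std ((fun z => s * z + m)%R @^-1` A))%E.
  move=> mA; case: eqVneq => [->|s0]; last exact: normal_prob_affine.
  rewrite diracE; have [Am|nAm] := pselect (A m).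
    rewrite mem_set// (_ : _ @^-1` _ = setT) ?probability_setT//.
    by apply/seteqP; split=> // x _ /=; rewrite mul0r add0r.
  rewrite memNset// (_ : _ @^-1` _ = set0) ?measure0//.
  by apply/seteqP; split=> // x /=; rewrite mul0r add0r.
by split=> -[m [s H]]; exists m, s => A mA; rewrite H// E.
Qed.

Section law.
Context d (T : measurableType d) (P : probability T R) (Y : T -> R) (m s : R).
Hypotheses (mY : measurable_fun setT Y) (lY : normal_rv_law P Y m s).

Let mYR : measurable_fun setT (Y : T -> MR).
Proof. exact: mY. Qed.
Let maff : measurable_fun (setT : set MR) (fun z => s * z + m : MR).
Proof. exact: measurable_affine. Qed.

Lemma integral_law (f : R -> \bar R) : measurable_fun setT f ->
  (\int[P]_t f (Y t) = \int[std]_z f (s * z + m)%R)%E.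
Proof.
move=> mf.
rewrite -(integral_image (P : {measure set _ -> \bar R}) mYR)//.
rewrite -(integral_image (std : {measure set _ -> \bar R}) maff)//.
by apply: eq_measure_integral => A mA _; exact: lY.
Qed.

Lemma integrable_law (f : R -> \bar R) : measurable_fun setT f ->
  std.-integrable setT (fun z => f (s * z + m)) -> P.-integrable setT (fun t => f (Y t)).
Proof.
move=> mf /integrableP[_ fin]; apply/integrableP; split.
  exact: measurableT_comp.
rewrite (_ : (\int[P]_x _)%E = (\int[std]_z `|f (s * z + m)%R|)%E)//.
by apply: (integral_law (f := fun x => `|f x|%E)); exact: measurableT_comp.
Qed.

End law.

Lemma integrable_std_sqr : std.-integrable setT (fun z => (z ^+ 2)%:E).
Proof.
apply/integrableP; split; first exact: measurable_sqr.
under eq_integral do rewrite gee0_abs ?lee_fin ?sqr_ge0//.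
exact: std_var_lty.
Qed.

Lemma integrable_std_id : std.-integrable setT (fun z => z%:E).
Proof.
have i1 : std.-integrable setT (EFin \o cst 1).
  by apply: (@bounded_integrable_std _ 1) => //= x; rewrite normr1.
apply: (le_integrable _ _ _ (integrableD _ i1 integrable_std_sqr)) => //.
  exact/measurable_EFinP.
move=> x _ /=; rewrite lee_fin [leRHS]ger0_norm ?addr_ge0 ?sqr_ge0//.
rewrite ler_norml; apply/andP; split; nra.
Qed.

Lemma integral_std_id : (\int[std]_z z%:E = 0)%E.
Proof.
have mid : measurable_fun setT (fun x : R => x) by exact: measurable_id.
exact: (integral_std_odd mid (fun=> erefl) integrable_std_id).
Qed.

(* Its value 1 is irrelevant here: only its positivity is used. *)
Definition std_variance : R := fine (std_var R).

Lemma std_varianceE : (\int[std]_z (z ^+ 2)%:E = std_variance%:E)%E.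
Proof.
rewrite /std_variance fineK// ge0_fin_numE ?std_var_lty//.
exact: ltW (std_var_gt0 R).
Qed.

Lemma std_variance_gt0 : 0 < std_variance.
Proof. by rewrite -lte_fin -std_varianceE; exact: std_var_gt0. Qed.

Section moments.
Context d (T : measurableType d) (P : probability T R) (Y : T -> R) (m s : R).
Hypotheses (mY : measurable_fun setT Y) (lY : normal_rv_law P Y m s).

Lemma normal_Lfun2 : Y \in Lfun P 2%:E.
Proof.
have i2 : P.-integrable setT (fun t => (Y t ^+ 2)%:E).
  apply: (integrable_law mY lY (f := fun y => (y ^+ 2)%:E)); first exact: measurable_sqr.
  have -> : (fun z : R => ((s * z + m) ^+ 2)%:E) =
     ((fun z => (s ^+ 2)%:E * (z ^+ 2)%:E) \+
      ((fun z => (2 * s * m)%:E * z%:E) \+ cst (m ^+ 2)%:E))%E.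
    by apply/funext => z /=; rewrite -!EFinM -!EFinD; congr EFin; ring.
  apply: integrableD => //; first exact: integrableZl integrable_std_sqr.
  apply: integrableD => //; first exact: integrableZl integrable_std_id.
  by apply: (@bounded_integrable_std (cst (m ^+ 2)) `|m ^+ 2|).
rewrite inE; apply/andP; split; rewrite inE//= /finite_norm unlock /Lnorm.
rewrite poweR_lty//.
have /integrableP[_] := i2; apply: le_lt_trans.
rewrite le_eqVlt; apply/orP; left; apply/eqP; apply: eq_integral => t _ /=.
by rewrite powR_mulrn// normrX.
Qed.

Lemma normal_mean : ('E_P[Y] = m%:E)%E.
Proof.
rewrite unlock (integral_law mY lY (f := EFin))//.
have -> : (\int[std]_z (s * z + m)%:E = \int[std]_z (s%:E * z%:E + (cst m z)%:E))%E.
  by apply: eq_integral.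
rewrite integralD//; [|exact: integrableZl integrable_std_id|].
  rewrite integralZl//; last exact: integrable_std_id.
  rewrite integral_std_id mule0 add0e.
  transitivity (\int[std]_x cst m%:E x)%E; first by [].
  rewrite integral_cst//; apply: etrans (mule1 _); congr (_ * _)%E.
  exact: (@probability_setT _ _ _ std).
by apply: (@bounded_integrable_std _ `|m|) => //=.
Qed.

Lemma normal_variance : ('V_P[Y] = (s ^+ 2 * std_variance)%:E)%E.
Proof.
rewrite /variance unlock normal_mean /= unlock.
transitivity (\int[P]_t ((Y t - m) ^+ 2)%:E)%E.
  by apply: eq_integral => t _; rewrite expr2.
rewrite (integral_law mY lY (f := fun y => ((y - m) ^+ 2)%:E)); last first.
  by apply/measurable_EFinP; apply: measurable_funX; exact: measurable_funB.
transitivity (\int[std]_z ((s ^+ 2)%:E * (z ^+ 2)%:E))%E.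
  by apply: eq_integral => z _; rewrite addrK exprMn EFinM.
by rewrite integralZl// ?std_varianceE//; exact: integrable_std_sqr.
Qed.

End moments.

(* Its value [expR (- s ^+ 2 / 2)] is irrelevant here: only [std_charf_mul] is
   used. *)
Definition std_charf (s : R) : R := fine (\int[std]_z (cos (s * z))%:E)%E.

Lemma measurable_cosM (s th : R) : measurable_fun setT (fun z : R => cos (s * z + th)).
Proof.
apply: (measurableT_comp (continuous_measurable_fun (@continuous_cos R))).
exact: measurable_affine.
Qed.

(** The sine term of the addition formula is odd and integrates to zero against a symmetric law. *)
Lemma integral_std_cos s th :
  (\int[std]_z (cos (s * z + th))%:E = (cos th * std_charf s)%:E)%E.
Proof.
have mc : measurable_fun setT (fun z : R => cos (s * z)).
  by have := measurable_cosM s 0; under eq_fun do rewrite addr0.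
have ms : measurable_fun setT (fun z : R => sin (s * z)).
  apply: (measurableT_comp (continuous_measurable_fun (@continuous_sin R))).
  exact: measurable_funM.
have ic : std.-integrable setT (EFin \o (fun z => cos (s * z))).
  by apply: (@bounded_integrable_std _ 1) => // x; exact: cos_max.
have is_ : std.-integrable setT (EFin \o (fun z => sin (s * z))).
  by apply: (@bounded_integrable_std _ 1) => // x; exact: sin_max.
transitivity (\int[std]_z ((cos th)%:E * (cos (s * z))%:E +
    (- sin th)%:E * (sin (s * z))%:E))%E.
  by apply: eq_integral => z _; rewrite cosD -!EFinM -EFinD; congr EFin; ring.
rewrite integralD//; [|exact: integrableZl ic|exact: integrableZl is_].
rewrite !integralZl//= (integral_std_odd ms)//; last by move=> x; rewrite mulrN sinN.
by rewrite mule0 adde0 EFinM /std_charf fineK//; exact: integrable_fin_num ic.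
Qed.

(* Completing the square: the exponent [x ^+ 2 + ((r * z - a * x) / b) ^+ 2] is
   symmetric in [x] and [z] when [r ^+ 2 = a ^+ 2 + b ^+ 2]. *)
Lemma std_rotation_gt0 (a b r : R) A : 0 < b -> 0 < r -> r ^+ 2 = a ^+ 2 + b ^+ 2 ->
  measurable A ->
  (\int[std]_x std ((fun y => b * y + a * x)%R @^-1` A) = std ((fun z => r * z + 0)%R @^-1` A))%E.
Proof.
move=> b0 r0 rab mA.
pose mu := @lebesgue_measure R.
pose phi := @normal_pdf R 0 1.
pose q := r / b; have q0 : 0 < q by rewrite divr_gt0.
have phi0 x : 0 <= phi x by exact: normal_pdf_ge0.
have mphi : measurable_fun setT phi by exact: measurable_normal_pdf.
have phiE x z : phi x * phi (q * z - a * x / b) = phi z * phi (q * x - a * z / b).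
  rewrite /phi !std_pdfE.
  rewrite mulrACA [RHS]mulrACA -!expRD; congr (_ * expR _).
  have bn := lt0r_neq0 b0.
  have E1 u v : (q * u - a * v / b) ^+ 2 = (r * u - a * v) ^+ 2 / b ^+ 2.
    by rewrite /q; field.
  have E2 : (r * x - a * z) ^+ 2 = (r * z - a * x) ^+ 2 + b ^+ 2 * (x ^+ 2 - z ^+ 2).
    have -> : b ^+ 2 = r ^+ 2 - a ^+ 2 by rewrite rab; ring.
    by ring.
  by rewrite !E1 E2; field.
(* Substituting [q * z - a * x / b] for [y] turns [b * y + a * x] into [r * z]; [g] is the integrand
   after this substitution and [q] its Jacobian. *)
pose g (p : MR * MR) : R := \1_A (r * p.2 + 0) * phi (q * p.2 - a * p.1 / b).
have g0 p : 0 <= g p by rewrite mulr_ge0// indicE.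
have m1 : measurable_fun setT (fun p : MR * MR => p.1 : R) by exact: measurable_fst.
have m2 : measurable_fun setT (fun p : MR * MR => p.2 : R) by exact: measurable_snd.
have mA2 : measurable_fun setT (fun p : MR * MR => \1_A (r * p.2 + 0) : R).
  have ml : measurable_fun setT (fun p : MR * MR => r * p.2 + 0 : R).
    by apply: measurable_funD => //; exact: measurable_funM.
  have mS : measurable ((fun p : MR * MR => r * p.2 + 0) @^-1` A).
    by rewrite -[X in measurable X]setTI; exact: ml.
  rewrite (_ : (fun p => _) = \1_((fun p : MR * MR => r * p.2 + 0) @^-1` A)).
    exact: measurable_indic.
  apply/funext => p; rewrite !indicE.
  have -> : (p \in (fun p : MR * MR => r * p.2 + 0) @^-1` A) = (r * p.2 + 0 \in A).
    by apply/idP/idP; rewrite !inE.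
  by [].
have mg : measurable_fun setT g.
  apply: measurable_funM => //; apply: (measurableT_comp mphi).
  by apply: measurable_funB => //; [|apply: measurable_funM => //]; exact: measurable_funM.
have step1 x : (std ((fun y => b * y + a * x)%R @^-1` A) =
    q%:E * \int[mu]_z (g (x, z))%:E)%E.
  rewrite std_probE; last exact: measurable_preimage_affine.
  rewrite (ge0_integral_affine (- (a * x / b)) q0); last 2 first.
  - apply: emeasurable_funM; apply/measurable_EFinP => //.
    by apply: measurable_indic; exact: measurable_preimage_affine.
  - by move=> y; rewrite -EFinM lee_fin mulr_ge0// indicE.
  congr (_ * _)%E; apply: eq_integral => z _; rewrite -EFinM /g; congr (_ * _)%:E.
  rewrite !indicE; congr (nat_of_bool _)%:R; apply/idP/idP; rewrite !inE /=.
    by rewrite (_ : b * _ + _ = r * z + 0)// /q; field; rewrite lt0r_neq0.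
  by rewrite [X in A X -> _](_ : _ = b * (q * z - a * x / b) + a * x)// /q; field; rewrite lt0r_neq0.
have mgE : measurable_fun setT (EFin \o g) by exact/measurable_EFinP.
have gE0 (p : MR * MR) : (0 <= (g p)%:E)%E by rewrite lee_fin.
have mF : measurable_fun setT (fun x => \int[mu]_z (g (x, z))%:E)%E.
  exact: (measurable_fun_fubini_tonelli_F (m2 := mu) (EFin \o g) mgE gE0).
have F0 x : (0 <= \int[mu]_z (g (x, z))%:E)%E by apply: integral_ge0.
pose H (p : MR * MR) := g p * phi p.1.
have mH : measurable_fun setT (EFin \o H).
  apply/measurable_EFinP; apply: measurable_funM => //.
  exact: (measurableT_comp mphi m1).
have H0 p : (0 <= (EFin \o H) p)%E by rewrite lee_fin mulr_ge0.
have HE x z : H (x, z) = \1_A (r * z + 0) * phi z * phi (q * x + - (a * z / b)).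
  have := phiE x z; rewrite /H /g /=; move: (phi x) (phi z) (phi _) (phi _) (\1_A _) => p1 p2 p3 p4 i E.
  by rewrite -[LHS]mulrA [X in _ * X]mulrC E mulrA.
have ZL (f : R -> \bar R) : measurable_fun setT f -> (forall x, 0 <= f x)%E ->
    (\int[mu]_x (q%:E * f x) = q%:E * \int[mu]_x f x)%E.
  by move=> mf f0; apply: ge0_integralZl => //; rewrite lee_fin ltW.
have mHF : measurable_fun setT (fun x => \int[mu]_z (EFin \o H) (x, z))%E.
  exact: (measurable_fun_fubini_tonelli_F (m2 := mu) (EFin \o H) mH H0).
have mHG : measurable_fun setT (fun z => \int[mu]_x (EFin \o H) (x, z))%E.
  exact: (measurable_fun_fubini_tonelli_G (m1 := mu) (EFin \o H) mH H0).
transitivity (q%:E * \int[mu]_x \int[mu]_z (EFin \o H) (x, z))%E.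
  transitivity (\int[std]_x (q%:E * \int[mu]_z (g (x, z))%:E))%E.
    by apply: eq_integral => x _.
  rewrite ge0_integral_std; last 2 first.
  - by apply: emeasurable_funM; [exact: measurable_cst|exact: mF].
  - by move=> x; rewrite mule_ge0// lee_fin ltW.
  have HF0 x : (0 <= \int[mu]_z (EFin \o H) (x, z))%E.
    by apply: integral_ge0 => z _; exact: H0.
  apply: etrans (ZL _ mHF HF0).
  apply: eq_integral => x _; rewrite -muleA; congr (_ * _)%E.
  rewrite -ge0_integralZr; [by []|by []| | |by rewrite lee_fin].
    exact: measurableT_comp mgE (measurable_pair1 x).
  by move=> z _; exact: gE0.
(* Once the order is exchanged, [x] occurs by [HE] only in a rescaled and shifted normal density,
   whose integral cancels the factor [q]. *)
rewrite (fubini_tonelli (m1 := mu) (m2 := mu) (EFin \o H) mH H0).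
have HG0 z : (0 <= \int[mu]_x (EFin \o H) (x, z))%E.
  by apply: integral_ge0 => x _; exact: H0.
apply: etrans (esym (ZL _ mHG HG0)) _.
rewrite std_probE; last exact: measurable_preimage_affine.
apply: eq_integral => z _.
have mphiE : measurable_fun setT (fun x : R => (phi x)%:E) by exact/measurable_EFinP.
have E1 := ge0_integral_affine (- (a * z / b)) q0 mphiE (fun x => phi0 x).
have mphiq : measurable_fun setT (fun x : R => (phi (q * x + - (a * z / b)))%:E).
  by apply/measurable_EFinP; apply: (measurableT_comp mphi); exact: measurable_affine.
transitivity (q%:E * ((\1_A (r * z + 0) * phi z)%:E *
    \int[mu]_x (phi (q * x + - (a * z / b)))%:E))%E.
  have c0 : (0 <= (\1_A (r * z + 0) * phi z)%:E)%E by rewrite lee_fin mulr_ge0// indicE.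
  have ZE := @ge0_integralZl _ _ R mu setT measurableT
    (fun x => (phi (q * x + - (a * z / b)))%:E) mphiq _ (fun x _ => phi0 _) c0.
  rewrite -ZE; congr (_ * _)%E; apply: eq_integral => x _.
  by rewrite -EFinM -HE.
rewrite muleCA -E1 integral_normal_pdf mule1 EFinM; congr (_ * _)%E.
Qed.

End gaussian_variable.

(** * Sums of independent normal variables *)

Section rotation.
Context (R : realType).
Local Notation std := (@std R).
Local Notation MR := (measurableTypeR R).

Lemma std_sign (s s' : R) (A : set R) : s ^+ 2 = s' ^+ 2 -> measurable A ->
  std ((fun z => s * z + 0) @^-1` A) = std ((fun z => s' * z + 0) @^-1` A).
Proof.
move=> ss mA; have : (s == s') || (s == - s') by rewrite -eqf_sqr ss.
case/orP => /eqP ->//.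
rewrite -[RHS]std_opp_set; last exact: measurable_preimage_affine.
by congr (std _); apply/seteqP; split=> z /=; rewrite mulrN mulNr.
Qed.

(** By Fubini the left-hand side is the law of [a X + b Y] for independent standard normal X and Y.
    Signs are removed by symmetry; [b = 0] is treated apart because the change of variables divides
    by [b]. *)
Lemma std_rotation (a b r : R) A : r ^+ 2 = a ^+ 2 + b ^+ 2 -> measurable A ->
  (\int[std]_x std ((fun y => b * y + a * x)%R @^-1` A) =
   std ((fun z => r * z + 0)%R @^-1` A))%E.
Proof.
move=> rab mA; have [b0|b0] := eqVneq b 0.
  have ra : r ^+ 2 = a ^+ 2 by rewrite rab b0 expr0n addr0.
  rewrite (std_sign ra mA) -[X in _ = std X]setIT -integral_indic//; last first.
    exact: measurable_preimage_affine.
  apply: eq_integral => x _; rewrite b0 indicE.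
  have [Ax|nAx] := pselect (A (a * x + 0)).
    rewrite mem_set// (_ : _ @^-1` _ = setT); first exact: (@probability_setT _ _ _ std).
    by apply/seteqP; split=> // y _ /=; rewrite mul0r addrC.
  rewrite memNset// (_ : _ @^-1` _ = set0); first exact: (measure0 std).
  by apply/seteqP; split=> // y /=; rewrite mul0r addrC.
have r0 : r != 0.
  apply/eqP => r0; have : 0 < a ^+ 2 + b ^+ 2.
    by rewrite ltr_wpDl ?sqr_ge0// exprn_even_gt0.
  by rewrite -rab r0 expr0n ltxx.
have sq (x : R) : `|x| ^+ 2 = x ^+ 2 by rewrite real_normK ?num_real.
apply: etrans (std_sign (sq r) mA).
have bp : 0 < `|b| by rewrite normr_gt0.
have rp : 0 < `|r| by rewrite normr_gt0.
have rab' : `|r| ^+ 2 = a ^+ 2 + `|b| ^+ 2 by rewrite !sq.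
apply: etrans (std_rotation_gt0 bp rp rab' mA).
apply: eq_integral => x _.
have mA' := measurable_preimage_affine 1 (a * x) mA.
have H := std_sign (sq b) mA'.
have E (c : R) : (fun z => c * z + 0) @^-1` ((fun z => 1 * z + a * x) @^-1` A) =
    (fun y => c * y + a * x) @^-1` A.
  by apply/seteqP; split=> z /=; rewrite mul1r addr0.
by move: H; rewrite !E => ->.
Qed.

(** The two laws equated by [std_rotation] give the cosine the same integral. Over the product law,
    integrating out [y] in [cos (b * y + a * x)] leaves a multiple of [cos (a * x)]. *)
Lemma std_charf_mul (a b r : R) : r ^+ 2 = a ^+ 2 + b ^+ 2 -> std_charf r = std_charf a * std_charf b.
Proof.
move=> rab.
have mL : measurable_fun setT (fun p : MR * MR => b * p.2 + a * p.1 : MR).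
  by apply: measurable_funD; apply: measurable_funM.
pose nu : {measure set MR -> \bar R} :=
  image_measure ((std \x std)%E : {measure set (MR * MR) -> \bar R}) mL.
have mr : measurable_fun (setT : set MR) (fun z => r * z + 0 : MR).
  exact: measurable_affine.
have mcos th : measurable_fun setT (fun z : MR => (cos (z + th))%:E).
  apply/measurable_EFinP.
  by have := measurable_cosM 1 th; under eq_fun do rewrite mul1r.
have mcos0 : measurable_fun setT (fun z : MR => (cos z)%:E).
  by have := mcos 0; under eq_fun do rewrite addr0.
have : (\int[nu]_z (cos z)%:E =
    \int[image_measure (std : {measure set _ -> \bar R}) mr]_z (cos z)%:E)%E.
  apply: eq_measure_integral => A mA _.
  rewrite -[RHS](std_rotation rab mA) /nu /image_measure /product_measure1.
  apply: eq_integral => x _ /=; congr (std _).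
  by apply/seteqP; split=> y; rewrite xsectionE.
rewrite !integral_image//.
pose f (p : MR * MR) : R := cos (b * p.2 + a * p.1).
have bc p : `|f p| <= 1 by exact: cos_max.
have mf : measurable_fun setT f.
  apply: (measurableT_comp (continuous_measurable_fun (@continuous_cos R))).
  exact: mL.
have ss1 : ((std \x std)%E [set: MR * MR] < +oo)%E.
  have -> : (std \x std)%E [set: MR * MR] = 1%E; last by rewrite ltry.
  rewrite -setXTT product_measure1E//; apply: etrans (mule1 1); congr (_ * _)%E.
    exact: (@probability_setT _ _ _ std).
  exact: (@probability_setT _ _ _ std).
have if_ : (std \x std)%E.-integrable setT (EFin \o f).
  apply: measurable_bounded_integrable => //.
  exists 1; split; first exact: num_real.
  by move=> x x1 p _; exact: le_trans (bc p) (ltW x1).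
rewrite -[X in X = _ -> _](integral12_prod_meas1 if_) /fubini_F.
have -> : (\int[std]_x \int[std]_y (EFin \o f) (x, y) =
    \int[std]_x ((std_charf b)%:E * (cos (a * x + 0))%:E))%E.
  apply: eq_integral => x _.
  have := integral_std_cos b (a * x); rewrite /f /= => ->.
  by rewrite addr0 -EFinM mulrC.
have ica : std.-integrable setT (fun x => (cos (a * x + 0))%:E).
  by apply: (@bounded_integrable_std _ _ 1); [exact: measurable_cosM|move=> x; exact: cos_max].
have icr := integral_std_cos r 0.
rewrite integralZl// integral_std_cos cos0 mul1r -EFinM.
by rewrite icr cos0 mul1r => -[<-]; rewrite mulrC.
Qed.

End rotation.

(** * Conditional independence *)

Section image_probability.
Context d d' (T : measurableType d) (T' : measurableType d') (R : realType).
Variables (P : probability T R) (f : T -> T').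
Hypothesis mf : measurable_fun [set: T] f.

Let imT : image_measure (P : {measure set _ -> \bar R}) mf setT = 1%E.
Proof. by rewrite /image_measure preimage_setT; exact: (@probability_setT _ _ _ P). Qed.

HB.instance Definition _ := Measure_isProbability.Build _ _ R
  (image_measure (P : {measure set _ -> \bar R}) mf) imT.

End image_probability.

(* Diagonal form of Fubini's theorem: if [u] and [y] are independent, sampling
   them at the same point is sampling them at two independent points. *)
Section independent_sections.
Context d (T : measurableType d) (R : realType) (P : probability T R).
Context d1 d2 (E1 : measurableType d1) (E2 : measurableType d2).
Variables (u : T -> E1) (y : T -> E2).
Hypotheses (mu : measurable_fun setT u) (my : measurable_fun setT y).
Hypothesis uy : forall A B, measurable A -> measurable B ->
  (P (u @^-1` A `&` y @^-1` B) = P (u @^-1` A) * P (y @^-1` B))%E.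

Let Pu : probability E1 R := image_measure (P : {measure set _ -> \bar R}) mu.
Let Py : probability E2 R := image_measure (P : {measure set _ -> \bar R}) my.

Lemma measurable_section (E : set (E1 * E2)) : measurable E ->
  measurable_fun setT (fun x => P (y @^-1` xsection E x)).
Proof. by move=> mE; exact: (measurable_fun_xsection Py mE). Qed.

Lemma independent_section (E : set (E1 * E2)) (D : set E1) :
  measurable E -> measurable D ->
  (P ([set t | E (u t, y t)] `&` u @^-1` D) =
   \int[P]_(t in u @^-1` D) P (y @^-1` xsection E (u t)))%E.
Proof.
move=> mE mD.
have muy : measurable_fun setT (fun t => (u t, y t)) by exact: measurable_fun_pair.
pose m' : {measure set (E1 * E2) -> \bar R} :=
  image_measure (P : {measure set _ -> \bar R}) muy.
(* Independence says that the law of the pair [(u, y)] and the product of the two laws agree on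
   rectangles, which determines the product measure. *)
have uniq X : measurable X -> (Pu \x Py)%E X = m' X.
  by apply: product_measure_unique => A B mA mB; exact: uy.
transitivity (m' (E `&` (D `*` setT))).
  congr (P _); apply/seteqP; split=> t /=; first by move=> [].
  by move=> [? []].
rewrite -uniq; last by apply: measurableI => //; exact: measurableX.
rewrite /product_measure1 /= [RHS]integral_mkcond.
have mDP : measurable_fun setT ((fun x => P (y @^-1` xsection E x)) \_ D).
  by rewrite -measurable_restrictT//; apply: measurable_funTS; exact: measurable_section.
rewrite (_ : (fun t => _) = (fun t => ((fun x => P (y @^-1` xsection E x)) \_ D) (u t))); last first.
  by apply/funext => t; rewrite !patchE.
rewrite -(integral_image (P : {measure set _ -> \bar R}) mu)//.
apply: eq_integral => x _; rewrite patchE /=; case: ifPn; rewrite ?inE => Dx.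
  congr (P (y @^-1` _)); apply/seteqP; split=> z; rewrite !xsectionE /=; first by move=> [].
    by move=> Ez; split.
apply: etrans (measure0 Py); congr (Py _).
apply/seteqP; split=> z //; rewrite xsectionE /= => -[_ [Dx' _]].
by move: Dx; rewrite notin_setE.
Qed.

End independent_sections.

(** * Pulling factors out of conditional expectations *)

Section sub_sigma_algebra_integral.
Import HBNNSimple.
Context d (T : measurableType d) (R : realType) (P : probability T R).
Variable F : set (set T).
Hypothesis sF : sigma_algebra setT F.
Hypothesis mF : forall A, F A -> measurable A.

Definition F_measurable (f : T -> R) := forall B : set R, measurable B -> F (f @^-1` B).

Lemma integral_indic_mul (g : T -> R) D : measurable D ->
  (\int[P]_t (\1_D t * g t)%:E = \int[P]_(t in D) (g t)%:E)%E.
Proof.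
move=> mD; rewrite [RHS]integral_mkcond; apply: eq_integral => t _.
by rewrite patchE indicE; case: ifP; rewrite ?mul1r ?mul0r.
Qed.

Lemma integrable_indic_mul (g : T -> R) D : measurable D ->
  P.-integrable setT (EFin \o g) -> P.-integrable setT (fun t => (\1_D t * g t)%:E).
Proof.
move=> mD ig; have mg : measurable_fun setT g by apply/measurable_EFinP; exact: measurable_int ig.
apply: (le_integrable _ _ _ ig) => //.
  by apply/measurable_EFinP; apply: measurable_funM.
move=> t _ /=; rewrite lee_fin normrM indicE; case: (t \in D).
  by rewrite normr1 mul1r.
by rewrite normr0 mul0r.
Qed.

(** The last hypothesis says that [g] and [h] have the same conditional expectation given [F]. For
    simple [f] the claim is a finite sum of instances of it, and dominated convergence does the
    rest. *)
Lemma integral_mul_F_ge0 (f g h : T -> R) : F_measurable f -> (forall t, 0 <= f t) ->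
  P.-integrable setT (EFin \o g) -> P.-integrable setT (EFin \o h) ->
  P.-integrable setT (fun t => (f t * g t)%:E) ->
  P.-integrable setT (fun t => (f t * h t)%:E) ->
  (forall D, F D -> \int[P]_(t in D) (g t)%:E = \int[P]_(t in D) (h t)%:E)%E ->
  (\int[P]_t (f t * g t)%:E = \int[P]_t (f t * h t)%:E)%E.
Proof.
move=> Ff f0 ig ih ifg ifh gh.
(* Approximating [f] on the space equipped with [F] alone puts the level sets of the simple
   functions in [F]. *)
pose TF := g_sigma_algebraType F.
have FE : F.-sigma.-measurable = F by exact: sigma_algebra_id.
have FE' A : F.-sigma.-measurable A -> F A by rewrite FE.
have mfF : measurable_fun (setT : set TF) (EFin \o f : TF -> \bar R).
  apply/measurable_EFinP => _ B mB; rewrite setTI.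
  by rewrite -[measurable _]/(F.-sigma.-measurable _) FE; exact: Ff.
pose f_ := nnsfun_approx measurableT mfF.
have f_F n y : F (f_ n @^-1` [set y]).
  apply/FE'; have := @measurable_funPT _ _ _ _ (f_ n) measurableT [set y] (measurable_set1 y).
  by rewrite setTI.
have f_m n : measurable_fun setT (f_ n : T -> R).
  move=> _ B mB; rewrite setTI; apply/mF/FE'.
  by have := @measurable_funPT _ _ _ _ (f_ n) measurableT B mB; rewrite setTI.
have f_f t : (fun n => f_ n t) @ \oo --> f t.
  have := @cvg_nnsfun_approx _ TF R setT measurableT (EFin \o f) mfF (fun t _ => f0 t) t I.
  by move/fine_cvgP => [].
have f_le n t : 0 <= f_ n t <= f t.
  apply/andP; split; first exact: fun_ge0.
  rewrite /f_ nnsfun_approxE -lee_fin.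
  exact: (@le_approx _ _ _ setT (EFin \o f) n t (fun t _ => f0 t) I).
have simple n (k : T -> R) : P.-integrable setT (EFin \o k) ->
    (\int[P]_t (f_ n t * k t)%:E =
     \sum_(y <- fset_set (range (f_ n))) y%:E * \int[P]_(t in f_ n @^-1` [set y]) (k t)%:E)%E.
  move=> ik.
  transitivity (\int[P]_t (\sum_(y <- fset_set (range (f_ n)))
      (y%:E * (\1_(f_ n @^-1` [set y]) t * k t)%:E)))%E.
    apply: eq_integral => t _; rewrite fimfunE fsbig_finite//= mulr_suml -sumEFin.
    by apply: eq_bigr => y _; rewrite -EFinM mulrA.
  rewrite integral_sum//; last first.
    by move=> y; apply: integrableZl => //; apply: integrable_indic_mul => //; exact: mF.
  apply: eq_bigr => y _; rewrite integralZl//; last first.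
    by apply: integrable_indic_mul => //; exact: mF.
  by rewrite integral_indic_mul//; exact: mF.
have lim (k : T -> R) : P.-integrable setT (EFin \o k) ->
    P.-integrable setT (fun t => (f t * k t)%:E) ->
    (fun n => \int[P]_t (f_ n t * k t)%:E)%E @ \oo --> (\int[P]_t (f t * k t)%:E)%E.
  move=> ik ifk.
  have mk : measurable_fun setT k by apply/measurable_EFinP; exact: measurable_int ik.
  have [] // := @dominated_convergence _ _ _ P setT measurableT
    (fun n t => (f_ n t * k t)%:E) (fun t => (f t * k t)%:E) (fun t => `|(f t * k t)%:E|%E).
  - by move=> n; apply/measurable_EFinP; exact: measurable_funM.
  - exact: measurable_int ifk.
  - apply: aeW => t _; apply/cvg_EFin; first exact: nearW.
    by apply: cvgM; [exact: f_f|exact: cvg_cst].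
  - exact: integrable_abse.
  - apply: aeW => t n _ /=; rewrite lee_fin !normrM ler_wpM2r//.
    by have /andP[a b] := f_le n t; rewrite !ger0_norm.
have E : (fun n => \int[P]_t (f_ n t * g t)%:E)%E = (fun n => \int[P]_t (f_ n t * h t)%:E)%E.
  apply/funext => n; rewrite !simple//; apply: eq_bigr => y _; congr (_ * _)%E.
  exact: gh.
by have := lim g ig ifg; rewrite E => /(cvg_unique _ (lim h ih ifh)) ->.
Qed.

Lemma integral_mul_F (f g h : T -> R) : F_measurable f ->
  P.-integrable setT (EFin \o g) -> P.-integrable setT (EFin \o h) ->
  P.-integrable setT (fun t => (f t * g t)%:E) ->
  P.-integrable setT (fun t => (f t * h t)%:E) ->
  (forall D, F D -> \int[P]_(t in D) (g t)%:E = \int[P]_(t in D) (h t)%:E)%E ->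
  (\int[P]_t (f t * g t)%:E = \int[P]_t (f t * h t)%:E)%E.
Proof.
move=> Ff ig ih ifg ifh gh.
have mf : measurable_fun setT f.
  by move=> _ B mB; rewrite setTI; apply: mF; exact: Ff.
pose fp t := Num.max (f t) 0; pose fn t := Num.max (- f t) 0.
have Fp : F_measurable fp.
  move=> B mB; have m : measurable_fun setT (fun x : R => Num.max x 0).
    exact: measurable_maxr.
  by have := Ff _ (m measurableT _ mB); rewrite setTI.
have Fn : F_measurable fn.
  move=> B mB; have m : measurable_fun setT (fun x : R => Num.max (- x) 0).
    by apply: measurable_maxr => //; exact: oppr_measurable.
  by have := Ff _ (m measurableT _ mB); rewrite setTI.
have fE t : f t = fp t - fn t by rewrite /fp /fn; case: (leP 0 (f t)) => ?; case: leP => ?; lra.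
have lep t : `|fp t| <= `|f t|.
  by rewrite /fp; case: (leP (f t) 0); rewrite ?normr0.
have len t : `|fn t| <= `|f t|.
  by rewrite /fn; case: (leP (- f t) 0); rewrite ?normr0 ?normrN.
have dom (p k : T -> R) : F_measurable p -> (forall t, `|p t| <= `|f t|) ->
    P.-integrable setT (EFin \o k) ->
    P.-integrable setT (fun t => (f t * k t)%:E) -> P.-integrable setT (fun t => (p t * k t)%:E).
  move=> Fq le ik; apply: le_integrable => //.
    apply/measurable_EFinP; apply: measurable_funM.
      by move=> _ B mB; rewrite setTI; apply: mF; exact: Fq.
    by apply/measurable_EFinP; exact: measurable_int ik.
  by move=> t _; rewrite lee_fin !normrM ler_wpM2r.
have split (k : T -> R) : P.-integrable setT (EFin \o k) ->
    P.-integrable setT (fun t => (f t * k t)%:E) ->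
    (\int[P]_t (f t * k t)%:E = \int[P]_t (fp t * k t)%:E - \int[P]_t (fn t * k t)%:E)%E.
  move=> ik ifk; rewrite -integralB//; [|exact: dom ifk|exact: dom ifk].
  by apply: eq_integral => t _; rewrite fE -EFinB mulrBl.
rewrite !split//; congr (_ - _)%E.
  by apply: integral_mul_F_ge0 => //; [move=> t; rewrite le_max lexx orbT|exact: dom ifg|exact: dom ifh].
by apply: integral_mul_F_ge0 => //; [move=> t; rewrite le_max lexx orbT|exact: dom ifg|exact: dom ifh].
Qed.

End sub_sigma_algebra_integral.

Lemma measurable_sg (R : realType) : measurable_fun setT (Num.sg : R -> R).
Proof.
rewrite (_ : Num.sg = (fun x : R => \1_`]0, +oo[%classic x - \1_`]-oo, 0[%classic x)).
  by apply: measurable_funB; exact: measurable_indic.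
apply/funext => x; rewrite !indicE !mem_setE !in_itv /= andbT.
by case: sgrP => _; rewrite ?subr0 ?sub0r ?subrr.
Qed.

(** * From independence to conditional independence *)

Section conditional_independence.
Context d (T : measurableType d) (R : realType) (P : probability T R).
Implicit Types (G : set (set T)) (Fam : set (T -> R)).

Definition sigma_fam Fam := <<s \bigcup_(f in Fam) preimage_set_system setT f measurable >>.

Lemma g_sigma_measurable G : G `<=` measurable -> forall A, <<s G >> A -> measurable A.
Proof. by move=> Gm; apply: smallest_sub => //; exact: sigma_algebra_measurable. Qed.

(** Preimages under the diagonal form a sigma-algebra, and a generator [f] of [Fam] is the pullback
    of [f1 p.1 + f2 p.2]. This makes precise, at the level of events, that [Fam] consists of
    functions of two independent pieces of information. *)
Lemma diagonal_lift G1 G2 Fam :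
  (forall f, Fam f -> exists f1 f2, [/\ forall t, f t = f1 t + f2 t,
     F_measurable <<s G1 >> f1 & F_measurable <<s G2 >> f2]) ->
  forall A, sigma_fam Fam A ->
  exists2 E : set (g_sigma_algebraType G1 * g_sigma_algebraType G2),
    measurable E & A = [set t | E (t, t)].
Proof.
move=> dec A FA.
pose delta (t : T) : g_sigma_algebraType G1 * g_sigma_algebraType G2 := (t, t).
have [E mE <-] : preimage_set_system setT delta measurable A.
  apply: FA; split.
    exact/sigma_algebra_preimage/sigma_algebra_measurable.
  move=> _ [f Ff [B mB <-]]; have [f1 [f2 [fE F1 F2]]] := dec f Ff.
  have m1 : measurable_fun (setT : set (g_sigma_algebraType G1)) (f1 : _ -> R).
    by move=> _ C mC; rewrite setTI; exact: F1.
  have m2 : measurable_fun (setT : set (g_sigma_algebraType G2)) (f2 : _ -> R).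
    by move=> _ C mC; rewrite setTI; exact: F2.
  have m12 : measurable_fun (setT : set (g_sigma_algebraType G1 * g_sigma_algebraType G2))
      (fun p => f1 p.1 + f2 p.2 : R).
    apply: measurable_funD.
      by apply: measurableT_comp => //; exact: measurable_fst.
    by apply: measurableT_comp => //; exact: measurable_snd.
  exists ((fun p => f1 p.1 + f2 p.2) @^-1` B).
    by have := m12 measurableT _ mB; rewrite setTI.
  by rewrite !setTI; apply/seteqP; split=> t /=; rewrite fE.
by exists E => //; rewrite setTI.
Qed.

(* The sections at [t] of [EA] and [EB] give versions [t |-> P (xsection E t)] of
   the conditional probabilities. *)
Lemma cond_indep_of_independent (GU GI GW FA FB : set (set T)) :
  GU `<=` measurable -> GI `<=` measurable -> GW `<=` measurable ->
  (forall A, FA A -> exists2 E : set (g_sigma_algebraType GU * g_sigma_algebraType GI),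
     measurable E & A = [set t | E (t, t)]) ->
  (forall A, FB A -> exists2 E : set (g_sigma_algebraType GU * g_sigma_algebraType GW),
     measurable E & A = [set t | E (t, t)]) ->
  (forall A B : set T, <<s GU >> A -> <<s GI `|` GW >> B -> P (A `&` B) = P A * P B)%E ->
  (forall A B : set T, <<s GI >> A -> <<s GW >> B -> P (A `&` B) = P A * P B)%E ->
  cond_indep P <<s GU >> FA FB.
Proof.
move=> mU mI mW liftA liftB indU indIW A B FAA FBB.
have [EA mEA AE] := liftA A FAA; have [EB mEB BE] := liftB B FBB.
pose T1 := g_sigma_algebraType GU.
pose T2 := g_sigma_algebraType (GI `|` GW).
have mIW : GI `|` GW `<=` measurable by rewrite subUset.
have mid1 : measurable_fun (setT : set T) (id : T -> T1).
  by move=> _ C mC; rewrite setTI; exact: (g_sigma_measurable mU).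
have mid2 : measurable_fun (setT : set T) (id : T -> T2).
  by move=> _ C mC; rewrite setTI; exact: (g_sigma_measurable mIW).
(* [GU] is independent of [GI] and [GW] jointly, so both lifted events are viewed in the product
   whose second factor is generated by both families. *)
have widen G : G `<=` GI `|` GW -> forall E : set (T1 * g_sigma_algebraType G),
    measurable E -> measurable (E : set (T1 * T2)).
  move=> GG E mE.
  have m : measurable_fun (setT : set (T1 * T2)) (fun p => (p.1, p.2 : g_sigma_algebraType G)).
    apply: measurable_fun_pair; first exact: measurable_fst.
    move=> _ C mC; have mC' : measurable (C : set T2).
      have sub : <<s G >> `<=` <<s GI `|` GW >>.
        apply: smallest_sub; first exact: smallest_sigma_algebra.
        by move=> X GX; apply: sub_sigma_algebra; exact: GG.
      exact: sub.
    by have := @measurable_snd _ _ T1 T2 measurableT C mC'.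
  have := m measurableT E mE; rewrite setTI; congr measurable.
  by apply/seteqP; split=> -[].
have mEA' := widen GI (@subsetUl _ _ _) _ mEA.
have mEB' := widen GW (@subsetUr _ _ _) _ mEB.
have uy C D : measurable C -> measurable D ->
    (P ((id : T -> T1) @^-1` C `&` (id : T -> T2) @^-1` D) =
     P ((id : T -> T1) @^-1` C) * P ((id : T -> T2) @^-1` D))%E.
  by move=> mC mD; exact: indU.
pose ver (E : set (T1 * T2)) (t : T) : R := fine (P (xsection E t)).
have mver E : measurable E -> measurable_fun (setT : set T1) (ver E).
  move=> mE; apply: (measurableT_comp (@fine_measurable R setT measurableT)).
  exact: (measurable_section _ mid2 mE).
have verP (E : set (T1 * T2)) : measurable E ->
    cond_prob_version P <<s GU >> [set t | E (t, t)] (ver E).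
  move=> mE.
  have msec (t : T) : measurable (xsection E t : set T).
    apply: (g_sigma_measurable mIW); exact: (measurable_xsection (t : T1) mE).
  have mvT : measurable_fun (setT : set T) (ver E).
    exact: (measurableT_comp (mver E mE) mid1).
  split.
  - by move=> C mC; have := mver E mE measurableT C mC; rewrite setTI.
  - apply: (@bounded_integrable _ _ _ P (ver E)) => //; exists 1 => t.
    rewrite ger0_norm ?fine_ge0// -lee_fin fineK ?fin_num_measure//.
    exact: probability_le1.
  - move=> D FD; rewrite -[D in RHS]/((id : T -> T1) @^-1` D).
    rewrite (independent_section mid1 mid2 uy mE)//.
    by apply: eq_integral => t _; rewrite /ver fineK ?fin_num_measure.
exists (ver EA), (ver EB); split.
- by rewrite AE; exact: verP.
- by rewrite BE; exact: verP.
(* At each [t] the two sections belong to the independent sigma-algebras of [GI] and [GW], so the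
   probability of their intersection is the product. *)
- have -> : (fun t => ver EA t * ver EB t) = ver (EA `&` EB).
    apply/funext => t; rewrite /ver xsectionI.
    have sA : <<s GI >> (xsection EA t) by exact: (measurable_xsection (t : T1) mEA).
    have sB : <<s GW >> (xsection EB t) by exact: (measurable_xsection (t : T1) mEB).
    rewrite indIW// fineM// fin_num_measure//.
      exact: (g_sigma_measurable mI).
    exact: (g_sigma_measurable mW).
  have -> : A `&` B = [set t | (EA `&` EB) (t, t)].
    by rewrite AE BE; apply/seteqP; split.
  by apply: verP; exact: measurableI.
Qed.

End conditional_independence.

(** * From conditional independence to independence *)

Section cond_indep_independent.
Context d (T : measurableType d) (R : realType) (P : probability T R).
Variables FU FA FB : set (set T).
Hypotheses (sU : sigma_algebra setT FU) (sA : sigma_algebra setT FA) (sB : sigma_algebra setT FB).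
Hypotheses (mU : FU `<=` measurable) (mA : FA `<=` measurable) (mB : FB `<=` measurable).
Hypothesis ci : cond_indep P FU FA FB.

Lemma sigma_algebra_setT (F : set (set T)) : sigma_algebra setT F -> F setT.
Proof. by move=> [F0 FC _]; have := FC _ F0; rewrite setD0. Qed.

Lemma indic_integrable (A : set T) : measurable A -> P.-integrable setT (fun t => (\1_A t)%:E).
Proof.
move=> mA'; apply: (@bounded_integrable _ _ _ P (\1_A)) => //.
by exists 1 => t; rewrite indicE normr_nat lern1 leq_b1.
Qed.

Lemma integral_indicE (A D : set T) : measurable A -> measurable D ->
  (\int[P]_(t in D) (\1_A t)%:E = P (A `&` D))%E.
Proof. by move=> mA' mD; rewrite integral_indic. Qed.

(* Under conditional independence, a version of [P(A | FU)] is also a version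
   of the conditional probability given the larger sigma-algebra generated by
   [FU] and [FB]. *)
Lemma cond_indep_version A : FA A -> exists2 f : T -> R, cond_prob_version P FU A f &
  forall C, <<s [set B `&` D | B in FB & D in FU] >> C ->
    (\int[P]_(t in C) (f t)%:E = P (A `&` C))%E.
Proof.
move=> AA; have mA' := mA AA.
have [fA [gA [vA _ _]]] := ci AA (sigma_algebra_setT sB).
have [fAF ifA EfA] := vA.
exists fA => //.
have base B D : FB B -> FU D -> (\int[P]_(t in B `&` D) (fA t)%:E = P (A `&` (B `&` D)))%E.
  move=> BB DD; have mB' := mB BB; have mD := mU DD.
  have [f [g [[fF if_ Ef] [gF ig Eg] [_ ifg Efg]]]] := ci AA BB.
  have mf : measurable_fun setT f by apply/measurable_EFinP; exact: measurable_int if_.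
  have mfA : measurable_fun setT fA by apply/measurable_EFinP; exact: measurable_int ifA.
  have mulF (u v : T -> R) : F_measurable FU u -> F_measurable FU v ->
      forall op : R -> R -> R, (measurable_fun setT (fun p : R * R => op p.1 p.2)) ->
      F_measurable FU (fun t => op (u t) (v t)).
    move=> Fu Fv op mop C mC.
    have FE : FU.-sigma.-measurable = FU by exact: sigma_algebra_id.
    have mu : measurable_fun (setT : set (g_sigma_algebraType FU)) (u : _ -> R).
      by move=> _ Y mY; rewrite setTI; apply: sub_sigma_algebra; exact: Fu.
    have mv : measurable_fun (setT : set (g_sigma_algebraType FU)) (v : _ -> R).
      by move=> _ Y mY; rewrite setTI; apply: sub_sigma_algebra; exact: Fv.
    have := measurableT_comp mop (measurable_fun_pair mu mv) measurableT mC.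
    by rewrite setTI -[measurable _]/(FU.-sigma.-measurable _) FE.
  have F1D : F_measurable FU (\1_D : T -> R).
    move=> C mC.
    have FE : FU.-sigma.-measurable = FU by exact: sigma_algebra_id.
    have mD1 : measurable (D : set (g_sigma_algebraType FU)) by exact: sub_sigma_algebra.
    have mi : measurable_fun (setT : set (g_sigma_algebraType FU)) (\1_D : _ -> R).
      exact: measurable_indic.
    have := mi measurableT C mC.
    by rewrite setTI -[measurable _]/(FU.-sigma.-measurable _) FE.
  (* Each [B] comes with its own version [f] for [A]. Testing against the sign of [f - fA] shows
     that [f] agrees almost surely with the version fixed at the start. *)
  pose s t : R := Num.sg (f t - fA t).
  have Fs : F_measurable FU s.
    apply: (mulF f fA fF fAF (fun x y => Num.sg (x - y))).
    apply: (measurableT_comp (@measurable_sg R)).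
    by apply: measurable_funB; [exact: measurable_fst|exact: measurable_snd].
  have s1 t : `|s t| <= 1.
    by rewrite /s; case: sgrP => _; rewrite ?normr0 ?normrN ?normr1.
  have ms : measurable_fun setT s by move=> _ C mC; rewrite setTI; apply: mU; exact: Fs.
  have is_ (h : T -> R) : P.-integrable setT (EFin \o h) -> P.-integrable setT (fun t => (s t * h t)%:E).
    move=> ih; apply: (le_integrable _ _ _ ih) => //.
      apply/measurable_EFinP/measurable_funM => //.
      by apply/measurable_EFinP; exact: measurable_int ih.
    by move=> t _; rewrite lee_fin normrM ler_piMl.
  have E0 : (\int[P]_t (s t * f t)%:E = \int[P]_t (s t * fA t)%:E)%E.
    apply: (integral_mul_F sU mU) => //; [exact: is_|exact: is_|].
    by move=> D' D'F; rewrite Ef// EfA.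
  have ae : ae_eq P setT (EFin \o f) (EFin \o fA).
    have iB : P.-integrable setT (EFin \o (fun t => f t - fA t)).
      rewrite (_ : _ \o _ = (EFin \o f) \- (EFin \o fA))%E; first exact: integrableB.
      by apply/funext => t; rewrite /= EFinB.
    have : (\int[P]_t `|(f t - fA t)%:E|)%E = 0%E.
      transitivity (\int[P]_t ((s t * f t)%:E - (s t * fA t)%:E))%E.
        apply: eq_integral => t _; by rewrite -EFinB -mulrBr /s /= -normrEsg.
      rewrite integralB//; [|exact: is_|exact: is_].
      by rewrite E0 subee//; apply: integrable_fin_num => //; exact: is_.
    move/(ae_eq_integral_abs P measurableT (measurable_int _ iB)).1.
    apply: filterS => t /= /(_ I) H _; congr EFin.
    by move: H => [] /eqP; rewrite subr_eq0 => /eqP.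
  transitivity (\int[P]_(t in B `&` D) (f t)%:E)%E.
    apply: ae_eq_integral => //; first exact: measurableI.
    - by apply: measurable_funTS; exact: measurable_int ifA.
    - by apply: measurable_funTS; exact: measurable_int if_.
    - by apply: filterS ae => t /= H _; rewrite H.
  rewrite -integral_indic_mul//; last exact: measurableI.
  (* [\1_D * f] is [FU]-measurable, so the indicator of [B] may be replaced under the integral by
     its conditional probability [g]. *)
  transitivity (\int[P]_t ((\1_D t * f t) * g t)%:E)%E; last first.
    transitivity (\int[P]_(t in D) (f t * g t)%:E)%E.
      rewrite -[RHS]integral_indic_mul//.
      by apply: eq_integral => t _; rewrite mulrA.
    by rewrite Efg// setIA.
  transitivity (\int[P]_t ((\1_D t * f t) * \1_B t)%:E)%E.
    by apply: eq_integral => t _; rewrite indicI /=; congr EFin; ring.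
  apply/esym; apply: (integral_mul_F sU mU (f := fun t => \1_D t * f t)) => //.
  - by apply: (mulF _ _ F1D fF (fun x y => x * y)); apply: measurable_funM;
      [exact: measurable_fst|exact: measurable_snd].
  - exact: indic_integrable.
  - rewrite (_ : (fun t => _) = (fun t => (\1_D t * (f t * g t))%:E)).
      by apply: (integrable_indic_mul (g := fun t => f t * g t)).
    by apply/funext => t; rewrite mulrA.
  - rewrite (_ : (fun t => _) = (fun t => (\1_B t * (\1_D t * f t))%:E)).
      apply: (integrable_indic_mul (g := fun t => \1_D t * f t)) => //.
      exact: integrable_indic_mul.
    by apply/funext => t; rewrite mulrC.
  - by move=> D' D'F; rewrite Eg// integral_indicE//; exact: mU.
pose G := [set B `&` D | B in FB & D in FU].
have Gm : G `<=` measurable.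
  by move=> _ [B BB [D DD <-]]; apply: measurableI; [exact: mB|exact: mU].
have GT : G setT.
  exists setT; first exact: sigma_algebra_setT.
  by exists setT; [exact: sigma_algebra_setT|rewrite setIT].
move=> C sC.
have sGm := g_sigma_measurable Gm.
pose k t : R := \1_A t - fA t.
have ik : P.-integrable setT (EFin \o k).
  rewrite (_ : _ \o _ = (EFin \o \1_A) \- (EFin \o fA))%E.
    by apply: integrableB => //; exact: indic_integrable.
  by apply/funext => t; rewrite /= EFinB.
have kE D : measurable D -> (\int[P]_(t in D) (k t)%:E =
    P (A `&` D) - \int[P]_(t in D) (fA t)%:E)%E.
  move=> mD; transitivity (\int[P]_(t in D) ((\1_A t)%:E - (fA t)%:E))%E.
    by apply: eq_integral => t _; rewrite EFinB.
  rewrite integralB//.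
  - by rewrite integral_indicE.
  - by apply: (integrableS measurableT) => //; exact: indic_integrable.
  - exact: (integrableS measurableT).
have fin D : measurable D -> (\int[P]_(t in D) (fA t)%:E)%E \is a fin_num.
  by move=> mD; apply: integrable_fin_num => //; exact: (integrableS measurableT).
have k0 : (\int[P]_(t in C) (k t)%:E = 0)%E.
  (* The sets [B] intersected with [D] are closed under intersection, and the sets over which [k]
     has zero integral form a Dynkin system. *)
  apply: (@dynkin_induction _ (g_sigma_algebraType G) G
    (fun D => (\int[P]_(t in D) (k t)%:E = 0)%E)) => //.
  - move=> _ _ [B BB [D DD <-]] [B' BB' [D' DD' <-]].
    have [_ _ UB] := sB; have [_ _ UU] := sU.
    have sI (F : set (set T)) : sigma_algebra setT F -> forall X Y, F X -> F Y -> F (X `&` Y).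
      move=> sF X Y FX FY.
      have FE : F.-sigma.-measurable = F by exact: sigma_algebra_id.
      have := @measurableI _ (g_sigma_algebraType F) X Y.
      by rewrite -[measurable]/(F.-sigma.-measurable) FE; apply.
    exists (B `&` B'); first exact: sI.
    by exists (D `&` D'); [exact: sI|rewrite setIACA].
  - case: GT => B BB [D DD BDE]; rewrite -BDE kE; last first.
      by apply: measurableI; [exact: mB|exact: mU].
    by rewrite base// subee// fin_num_measure//; do 2 apply: measurableI => //; [exact: mB|exact: mU].
  - move=> _ [B BB [D DD <-]] /=; have mBD : measurable (B `&` D).
      by apply: measurableI; [exact: mB|exact: mU].
    by rewrite kE// base// subee// fin_num_measure//; exact: measurableI.
  - move=> D mD D0; have mD' := sGm _ mD.
    have kT : (\int[P]_(t in setT) (k t)%:E = 0)%E.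
      case: GT => B BB [E EE BDE]; rewrite -BDE kE; last first.
        by apply: measurableI; [exact: mB|exact: mU].
      by rewrite base// subee// fin_num_measure//; do 2 apply: measurableI => //; [exact: mB|exact: mU].
    have mk := measurable_int _ ik.
    move: kT; rewrite -(setUv D) integral_setU.
    + by rewrite D0 add0e.
    + exact: mD'.
    + exact: measurableC.
    + by rewrite setUv.
    + by apply/disj_setPS; rewrite setICr.
  - move=> F mF tF F0; have mF' n := sGm _ (mF n).
    rewrite integral_bigcup//.
      by rewrite eseries0// => n _ _; exact: F0.
    by apply: (integrableS measurableT) => //; exact: bigcup_measurable.
have mC := sGm _ sC.
move: k0; rewrite kE//.
have : P (A `&` C) \is a fin_num by rewrite fin_num_measure//; exact: measurableI.
have := fin _ mC; case: (\int[P]_(t in C) _)%E => // r _; case: (P (A `&` C)) => // r' _.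
by rewrite -EFinB => -[H]; congr EFin; lra.
Qed.

(** P(A and C) is the integral over [C] of a version of P(A | FU) by [cond_indep_version]; this
    version is [FU]-measurable and [C] is independent of [FU], so P(C) factors out. *)
Lemma cond_indep_independent A C :
  FA A -> <<s [set B `&` D | B in FB & D in FU] >> C ->
  (forall D, FU D -> P (C `&` D) = P C * P D)%E -> (P (A `&` C) = P A * P C)%E.
Proof.
move=> AA sC CU.
have mC : measurable C.
  apply: g_sigma_measurable sC => _ [B BB [D DD <-]].
  by apply: measurableI; [exact: mB|exact: mU].
have [f [fF if_ Ef] Ef'] := cond_indep_version AA.
rewrite -Ef'// -integral_indic_mul//.
have mf : measurable_fun setT f by apply/measurable_EFinP; exact: measurable_int if_.
have PCf : P C = (fine (P C))%:E by rewrite fineK// fin_num_measure.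
transitivity (\int[P]_t (f t * \1_C t)%:E)%E.
  by apply: eq_integral => t _; rewrite mulrC.
rewrite (integral_mul_F sU mU (h := cst (fine (P C))))//.
- under eq_integral do rewrite mulrC EFinM.
  rewrite integralZl//.
  have /= := Ef _ (sigma_algebra_setT sU); rewrite setIT => ->.
  by rewrite -PCf muleC.
- exact: indic_integrable.
- by apply: (@bounded_integrable _ _ _ P (cst (fine (P C)))) => //; exists `|fine (P C)|.
- rewrite (_ : (fun t => _) = (fun t => (\1_C t * f t)%:E)); last first.
    by apply/funext => t; rewrite mulrC.
  exact: integrable_indic_mul.
- rewrite (_ : (fun t => _) = (fun t => (fine (P C))%:E * (f t)%:E)%E); last first.
    by apply/funext => t; rewrite -EFinM mulrC.
  exact: integrableZl.
- move=> D DD; have mD := mU DD.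
  rewrite integral_indicE// CU//.
  transitivity (\int[P]_(t in D) cst (fine (P C))%:E t)%E; last by [].
  by rewrite integral_cst// -PCf.
Qed.

End cond_indep_independent.

(** * Gaussian vectors *)

Section gaussian_vector.
Context d (T : measurableType d) (R : realType) (P : probability T R) (n : nat).
Implicit Types (a b : 'rV[R]_n) (X : 'I_n -> T -> R) (S : 'M[R]_n).

Definition lincomb X a (t : T) : R := \sum_i a 0 i * X i t.

Definition quad S a : R := (a *m S *m a^T) 0 0.

(* [S] is the covariance matrix of [X] divided by [std_variance R]. *)
Definition gaussian_vec X S := (forall i, measurable_fun setT (X i)) /\
  forall a, normal_rv_law P (lincomb X a) 0 (Num.sqrt (quad S a)).

Lemma measurable_lincomb X a : (forall i, measurable_fun setT (X i)) ->
  measurable_fun setT (lincomb X a).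
Proof. by move=> mX; apply: measurable_sum => i; exact: measurable_funM. Qed.

Lemma lincombD X a b : lincomb X (a + b) = lincomb X a \+ lincomb X b.
Proof.
apply/funext => t; rewrite /lincomb /= -big_split /=.
by apply: eq_bigr => i _; rewrite !mxE mulrDl.
Qed.

Lemma lincombZ X c a : lincomb X (c *: a) = fun t => c * lincomb X a t.
Proof.
by apply/funext => t; rewrite /lincomb mulr_sumr; apply: eq_bigr => i _; rewrite !mxE mulrA.
Qed.

Lemma lincomb0 X : lincomb X 0 = cst 0.
Proof. by apply/funext => t; rewrite /lincomb big1// => i _; rewrite mxE mul0r. Qed.

Lemma quadDB S a b c : S^T = S -> quad S (a + c *: b) =
  quad S a + c ^+ 2 * quad S b + 2 * c * (a *m S *m b^T) 0 0.
Proof.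
move=> tS; rewrite /quad linearD linearZ /= mulmxDr !mulmxDl -!scalemxAl -!scalemxAr.
have -> : (b *m S *m a^T) = (a *m S *m b^T)^T by rewrite !trmx_mul trmxK tS mulmxA.
by rewrite !mxE; ring.
Qed.

Lemma quad_ge0 S a : posdef S -> 0 <= quad S a.
Proof. by move=> pS; have := posdef_ge0 a^T pS; rewrite trmxK. Qed.

Section fixed.
Variables (X : 'I_n -> T -> R) (S : 'M[R]_n).
Hypotheses (gX : gaussian_vec X S) (pS : posdef S).

Let mX := gX.1.
Let tS := pS.1.

Lemma gaussian_cos a th :
  (\int[P]_t (cos (lincomb X a t + th))%:E = (cos th * std_charf (Num.sqrt (quad S a)))%:E)%E.
Proof.
have mc : measurable_fun setT (fun x : R => (cos (x + th))%:E).
  by apply/measurable_EFinP; have := measurable_cosM 1 th; under eq_fun do rewrite mul1r.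
rewrite (integral_law (measurable_lincomb a mX) (gX.2 a) mc).
by under eq_integral do rewrite addr0; exact: integral_std_cos.
Qed.

(** The product is half the sum of the cosines for [a + b] and [a - b]. Without a cross term both
    have quadratic form [quad S a + quad S b], so [std_charf_mul] splits them alike and the phases
    recombine. *)
Lemma gaussian_cos_mul a b th eta : (a *m S *m b^T) 0 0 = 0 ->
  (\int[P]_t (cos (lincomb X a t + th) * cos (lincomb X b t + eta))%:E =
   (cos th * std_charf (Num.sqrt (quad S a)) * (cos eta * std_charf (Num.sqrt (quad S b))))%:E)%E.
Proof.
move=> ab0.
have mc c e : measurable_fun setT (fun t => cos (lincomb X c t + e)).
  by apply: measurable_cosD; exact: measurable_lincomb.
have ic c e : P.-integrable setT (fun t => (cos (lincomb X c t + e))%:E).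
  apply: (@bounded_integrable _ _ _ _ (fun t => cos (lincomb X c t + e))) => //.
  by exists 1 => t; exact: cos_max.
transitivity (\int[P]_t ((2^-1)%:E * (cos (lincomb X (a + 1 *: b) t + (th + eta)))%:E +
   (2^-1)%:E * (cos (lincomb X (a + -1 *: b) t + (th - eta)))%:E))%E.
  apply: eq_integral => t _; rewrite -!EFinM -EFinD !lincombD !lincombZ /=; congr EFin.
  set u := lincomb X a t; set v := lincomb X b t.
  have -> : u + 1 * v + (th + eta) = (u + th) + (v + eta) by ring.
  have -> : u + -1 * v + (th - eta) = (u + th) - (v + eta) by ring.
  by rewrite (cosD (u + th)) (cosB (u + th)); field.
rewrite integralD//; [|exact: integrableZl|exact: integrableZl].
rewrite !integralZl// !gaussian_cos.
have sqa := sqr_sqrtr (quad_ge0 a pS); have sqb := sqr_sqrtr (quad_ge0 b pS).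
have q c : c ^+ 2 = 1 -> std_charf (Num.sqrt (quad S (a + c *: b))) =
    std_charf (Num.sqrt (quad S a)) * std_charf (Num.sqrt (quad S b)).
  move=> c2; apply: std_charf_mul; rewrite sqa sqb sqr_sqrtr ?quad_ge0//.
  by rewrite quadDB// ab0 c2; ring.
rewrite !q ?expr1n ?sqrrN ?expr1n// -!EFinM -EFinD; congr EFin.
by rewrite (cosD th) (cosB th); field.
Qed.

(** All combinations of the rows are taken as generators, not the rows alone, because the
    trigonometric argument needs a family stable under sums and multiples. *)
Definition lin_gens p (A : 'M[R]_(p, n)) := [set E | exists g B,
  [/\ [set lincomb X (c *m A) | c in [set: 'rV[R]_p]] g, measurable B & E = g @^-1` B]].

Definition sigma_lin p (A : 'M[R]_(p, n)) := <<s lin_gens A >>.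

Lemma sigma_lin_measurable p (A : 'M[R]_(p, n)) E : sigma_lin A E -> measurable E.
Proof.
apply: smallest_sub; first exact: sigma_algebra_measurable.
move=> _ [_ [B [[c _ <-] mB ->]]]; rewrite -[X in measurable X]setTI.
exact: measurable_lincomb.
Qed.

(** [trig_null_sigma] is applied twice: to a centred cosine of a combination of the rows of [B],
    which decorrelates it from the events of [A]; then to the centred indicator of [E], tested
    against these cosines. *)
Lemma gaussian_indep p q (A : 'M[R]_(p, n)) (B : 'M[R]_(q, n)) E F :
  A *m S *m B^T = 0 -> sigma_lin A E -> sigma_lin B F ->
  (P (E `&` F) = P E * P F)%E.
Proof.
move=> AB0 sE sF.
have mE := sigma_lin_measurable sE; have mF := sigma_lin_measurable sF.
pose L r (C : 'M[R]_(r, n)) := [set lincomb X (c *m C) | c in [set: 'rV[R]_r]].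
have L0 r (C : 'M[R]_(r, n)) : L r C (cst 0) by exists 0 => //; rewrite mul0mx lincomb0.
have LD r (C : 'M[R]_(r, n)) f g : L r C f -> L r C g -> L r C (f \+ g).
  by move=> [c _ <-] [c' _ <-]; exists (c + c') => //; rewrite mulmxDl lincombD.
have LZ r (C : 'M[R]_(r, n)) (a : R) f : L r C f -> L r C (fun x => a * f x).
  by move=> [c _ <-]; exists (a *: c) => //; rewrite -scalemxAl lincombZ.
have Lm r (C : 'M[R]_(r, n)) f : L r C f -> measurable_fun setT f.
  by move=> [c _ <-]; exact: measurable_lincomb.
have bint (f : T -> R) : measurable_fun setT f -> (forall t, `|f t| <= 1) ->
    P.-integrable setT (EFin \o f).
  by move=> mf f1; apply: bounded_integrable => //; exists 1.
have mcos (f : T -> R) th : measurable_fun setT f -> measurable_fun setT (fun t : T => cos (f t + th)).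
  by move=> mf; exact: measurable_cosD.
have mulb (f g : T -> R) : (forall t, `|f t| <= 1) -> (forall t, `|g t| <= 1) ->
    forall t, `|f t * g t| <= 1.
  by move=> f1 g1 t; rewrite normrM -[leRHS]mulr1 ler_pM.
have i1 (D : set T) t : `|\1_D t : R| <= 1 by rewrite indicE normr_nat lern1 leq_b1.
have PE1 : `|fine (P E)| <= 1.
  rewrite ger0_norm ?fine_ge0// -lee_fin fineK ?fin_num_measure//.
  exact: probability_le1.
have step1 g eta : L _ B g -> (\int[P]_t (\1_E t * cos (g t + eta))%:E =
    (fine (P E))%:E * \int[P]_t (cos (g t + eta))%:E)%E.
  move=> Lg; have mg := Lm _ _ _ Lg.
  pose m := fine (\int[P]_t (cos (g t + eta))%:E)%E.
  have icg : P.-integrable setT (EFin \o (fun t => cos (g t + eta))).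
    by apply: bint; [exact: mcos|move=> t; exact: cos_max].
  have mE' : (\int[P]_t (cos (g t + eta))%:E = m%:E)%E.
    by rewrite /m fineK//; exact: integrable_fin_num icg.
  have m1 : `|m| <= 1.
    rewrite -lee_fin -[leLHS]/(`|m%:E|%E) -mE'; apply: le_trans (le_abse_integral _ _ _) _ => //.
      by case/integrableP: icg.
    rewrite -[leRHS](@probability_setT _ _ _ P) -[leRHS]mul1e -integral_cst//.
    apply: ge0_le_integral => //; first by apply: measurableT_comp; case/integrableP: icg.
    by move=> t _ /=; rewrite lee_fin cos_max.
  pose k t := cos (g t + eta) - m.
  have km : measurable_fun setT k by apply: measurable_funB => //; exact: mcos.
  have kb : exists M : R, forall x, `|k x| <= M.
    by exists 2 => t; rewrite (le_trans (ler_normB _ _))// -[2]/(1 + 1) lerD// cos_max.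
  have Hk f th : L _ A f -> (\int[P]_x (cos (f x + th) * k x)%:E = 0)%E.
    move=> [c _ <-]; case: Lg => c' _ gE.
    have z : (c *m A *m S *m (c' *m B)^T) 0 0 = 0.
      rewrite trmx_mul !mulmxA.
      have -> : c *m A *m S *m B^T = c *m (A *m S *m B^T) by rewrite !mulmxA.
      by rewrite AB0 mulmx0 mul0mx mxE.
    have := gaussian_cos_mul th eta z; rewrite gE => E1.
    have ic1 : P.-integrable setT (EFin \o (fun t => cos (lincomb X (c *m A) t + th))).
      by apply: bint; [apply: mcos; exact: measurable_lincomb|move=> t; exact: cos_max].
    have ic2 : P.-integrable setT (EFin \o (fun t => cos (lincomb X (c *m A) t + th) * cos (g t + eta))).
      apply: bint; last by apply: mulb => t; exact: cos_max.
      by apply: measurable_funM; apply: mcos => //; exact: measurable_lincomb.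
    transitivity (\int[P]_x ((cos (lincomb X (c *m A) x + th) * cos (g x + eta))%:E
       - m%:E * (cos (lincomb X (c *m A) x + th))%:E))%E.
      by apply: eq_integral => t _; rewrite /k -EFinM -EFinB; congr EFin; ring.
    rewrite integralB//; last exact: integrableZl.
    rewrite integralZl// E1 gaussian_cos.
    have := gaussian_cos (c' *m B) eta; rewrite gE mE' => -[->].
    by rewrite -EFinM -EFinB; congr EFin; ring.
  have := trig_null_sigma (L0 _ A) (@LD _ A) (@LZ _ A) (@Lm _ A) km kb Hk sE.
  rewrite -integral_indic_mul// => H.
  have : (\int[P]_t (\1_E t * k t)%:E = \int[P]_t (\1_E t * cos (g t + eta))%:E -
      \int[P]_t (m%:E * (\1_E t)%:E))%E.
    rewrite -integralB//; last 2 first.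
    - exact: integrable_indic_mul.
    - by apply: integrableZl => //; exact: bint.
    by apply: eq_integral => t _; rewrite -EFinM -EFinB /k; congr EFin; ring.
  rewrite H integralZl//; last exact: bint.
  rewrite integral_indic// setIT mE' -[X in (_ * X)%E]fineK ?fin_num_measure// -EFinM.
  have : (\int[P]_t (\1_E t * cos (g t + eta))%:E)%E \is a fin_num.
    by apply: integrable_fin_num => //; exact: integrable_indic_mul.
  case: (\int[P]_t _)%E => // r _; rewrite -EFinB => -[H'].
  by rewrite -EFinM; congr EFin; lra.
pose k t : R := \1_E t - fine (P E).
have km : measurable_fun setT k by apply: measurable_funB => //; exact: measurable_indic.
have kb : exists M : R, forall x, `|k x| <= M.
  by exists 2 => t; rewrite (le_trans (ler_normB _ _))// -[2]/(1 + 1) lerD.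
have Hk f th : L _ B f -> (\int[P]_x (cos (f x + th) * k x)%:E = 0)%E.
  move=> Lf; have mf := Lm _ _ _ Lf.
  have icf : P.-integrable setT (EFin \o (fun t => cos (f t + th))).
    by apply: bint; [exact: mcos|move=> t; exact: cos_max].
  transitivity (\int[P]_t ((\1_E t * cos (f t + th))%:E -
      (fine (P E))%:E * (cos (f t + th))%:E))%E.
    by apply: eq_integral => t _; rewrite /k -EFinM -EFinB; congr EFin; ring.
  rewrite integralB//; last 2 first.
  - exact: integrable_indic_mul.
  - exact: integrableZl.
  rewrite step1// integralZl// subee// fin_numM//.
  exact: integrable_fin_num icf.
have := trig_null_sigma (L0 _ B) (@LD _ B) (@LZ _ B) (@Lm _ B) km kb Hk sF.
rewrite -integral_indic_mul// => H.
have : (\int[P]_t (\1_F t * k t)%:E = \int[P]_t (\1_(E `&` F) t)%:E -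
    \int[P]_t ((fine (P E))%:E * (\1_F t)%:E))%E.
  rewrite -integralB//; last 2 first.
  - by apply: bint => //; apply: measurable_indic; exact: measurableI.
  - by apply: integrableZl => //; exact: bint.
  by apply: eq_integral => t _; rewrite -EFinM -EFinB /k indicI /=; congr EFin; ring.
rewrite H integralZl//; last exact: bint.
rewrite !integral_indic//; last exact: measurableI.
rewrite !setIT fineK ?fin_num_measure//.
have f1 : P (E `&` F) \is a fin_num by rewrite fin_num_measure//; exact: measurableI.
have f2 : (P E * P F)%E \is a fin_num by rewrite fin_numM// fin_num_measure.
move=> H'; have {}H' : (0 = P (E `&` F) - P E * P F)%E by exact: H'.
move: f1 f2 H'; move: (P (E `&` F)) (P E * P F)%E => [r| |] [s| |] //= _ _.
by rewrite -EFinB => -[H']; congr EFin; lra.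
Qed.

(** Polarization: the product is a quarter of the difference of the squares of [a + b] and [a - b],
    whose second moments are known. *)
Lemma gaussian_mul a b : P.-integrable setT (fun t => (lincomb X a t * lincomb X b t)%:E) /\
  (\int[P]_t (lincomb X a t * lincomb X b t)%:E = (std_variance R * (a *m S *m b^T) 0 0)%:E)%E.
Proof.
have ml c := measurable_lincomb c mX.
have L2 c : lincomb X c \in Lfun P 2%:E by exact: normal_Lfun2 (ml c) (gX.2 c).
have isq c : P.-integrable setT (fun t => (lincomb X c t ^+ 2)%:E) by exact: Lfun2_integrable_sqr.
have Esq c : (\int[P]_t (lincomb X c t ^+ 2)%:E = (quad S c * std_variance R)%:E)%E.
  have := normal_variance (ml c) (gX.2 c).
  rewrite varianceE// (normal_mean (ml c) (gX.2 c)) expe2 mule0 sube0 unlock.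
  by rewrite sqr_sqrtr ?quad_ge0.
split; first by apply/Lfun1_integrable; exact: Lfun2_mul_Lfun1.
transitivity (\int[P]_t ((4^-1)%:E * (lincomb X (a + 1 *: b) t ^+ 2)%:E -
   (4^-1)%:E * (lincomb X (a + -1 *: b) t ^+ 2)%:E))%E.
  apply: eq_integral => t _; rewrite -!EFinM -EFinB !lincombD !lincombZ /=; congr EFin.
  by field.
rewrite integralB//; [|exact: integrableZl|exact: integrableZl].
rewrite !integralZl// !Esq !quadDB// -!EFinM -EFinB; congr EFin.
by field.
Qed.

Lemma gaussian_mean a : P.-integrable setT (fun t => (lincomb X a t)%:E) /\
  (\int[P]_t (lincomb X a t)%:E = 0)%E.
Proof.
have ml := measurable_lincomb a mX.
split; last by have := normal_mean ml (gX.2 a); rewrite unlock.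
apply/Lfun1_integrable; apply: Lfun_subset12; first exact: fin_num_measure.
exact: normal_Lfun2 ml (gX.2 a).
Qed.

End fixed.

End gaussian_vector.

(** * Conditional independence of coordinates and zeros of the precision matrix *)

Section gaussian_conditional_independence.
Context d (T : measurableType d) (R : realType) (P : probability T R) (n : nat).
Variables (X : 'I_n -> T -> R) (S : 'M[R]_n).
Hypotheses (gX : gaussian_vec P X S) (pS : posdef S).
Implicit Types (I J U W : pred 'I_n).

(** Coordinate projections replace submatrices, so that all blocks live in dimension [n] and index
    sets need no renumbering. *)
Definition mask J : 'M[R]_n := diag_mx (\row_i (J i)%:R).

Lemma maskM J J' : mask J *m mask J' = mask (predI J J').
Proof.
rewrite /mask mul_diag_mx; apply/matrixP => i j; rewrite !mxE.
by case: eqVneq => [->|_]; rewrite ?mulr1n ?mulr0n ?mulr0// -natrM mulnb.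
Qed.

Lemma mask_idem J : mask J *m mask J = mask J.
Proof. by rewrite maskM; congr mask; apply/funext => i; rewrite /= andbb. Qed.

Lemma mask_disjoint J J' : (forall i, ~~ (J i && J' i)) -> mask J *m mask J' = 0.
Proof.
move=> JJ; rewrite maskM; apply/matrixP => i j.
by rewrite !mxE /= (negbTE (JJ i)) mul0rn.
Qed.

Lemma tr_mask J : (mask J)^T = mask J.
Proof. exact: tr_diag_mx. Qed.

Lemma mask_mul J (A : 'M[R]_n) i j : (mask J *m A) i j = (J i)%:R * A i j.
Proof. by rewrite /mask mul_diag_mx !mxE. Qed.

Lemma mul_mask J m (A : 'M[R]_(m, n)) i j : (A *m mask J) i j = A i j * (J j)%:R.
Proof. by rewrite /mask mul_mx_diag !mxE. Qed.

Let Q := invmx S.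
Let uS := posdef_unit pS.
Let pQ := posdef_inv pS.

Lemma mask_mul0 J J' (A : 'M[R]_n) : (forall i j, J i -> J' j -> A i j = 0) ->
  mask J *m A *m mask J' = 0.
Proof.
move=> A0; apply/matrixP => i j; rewrite mul_mask mask_mul mxE.
by case Ji: (J i); case Jj: (J' j); rewrite ?mul0r ?mulr0// A0// mulr0 mul0r.
Qed.

(* The principal submatrix of [Q] on [J], padded with the identity. *)
Definition padded J := mask J *m Q *m mask J + (1%:M - mask J).

Lemma padded_posdef J : posdef (padded J).
Proof.
have C : (1%:M - mask J) *m (1%:M - mask J)^T = 1%:M - mask J.
  rewrite linearB /= trmx1 tr_mask mulmxBl !mulmxBr !mulmx1 !mul1mx mask_idem.
  by rewrite subrr subr0.
split.
  by rewrite /padded linearD linearB /= trmx1 !trmx_mul !tr_mask (pQ.1) mulmxA.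
move=> v v0; rewrite /padded mulmxDr mulmxDl mxE.
have E1 : v^T *m (mask J *m Q *m mask J) *m v = (mask J *m v)^T *m Q *m (mask J *m v).
  by rewrite trmx_mul tr_mask !mulmxA.
have E2 : v^T *m (1%:M - mask J) *m v = ((1%:M - mask J)^T *m v)^T *m ((1%:M - mask J)^T *m v).
  rewrite trmx_mul trmxK [RHS]mulmxA.
  by rewrite -[v^T *m (1%:M - mask J) *m (1%:M - mask J)^T]mulmxA C.
(* The first term is positive unless the projection of [v] on [J] vanishes, and then the second is
   the squared norm of [v]. *)
rewrite E1 E2; have [z|nz] := eqVneq (mask J *m v) 0; last first.
  by rewrite ltr_pwDl ?(pQ.2)// tr_mul_ge0.
rewrite ltr_wpDl ?(posdef_ge0 _ pQ)// tr_mul_gt0//.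
by rewrite linearB /= trmx1 tr_mask mulmxBl mul1mx z subr0.
Qed.

Let H J := invmx (padded J).

Lemma padded_inv J : H J *m (mask J *m Q *m mask J) = mask J.
Proof.
have -> : mask J *m Q *m mask J = padded J *m mask J.
  by rewrite /padded mulmxDl mulmxBl mul1mx mask_idem subrr addr0 -[RHS]mulmxA mask_idem.
by rewrite mulKmx// posdef_unit//; exact: padded_posdef.
Qed.

Lemma mask_partition I U W : (forall i, (I i + U i + W i = 1)%N) ->
  mask I + mask U + mask W = 1%:M.
Proof.
move=> part; apply/matrixP => i j; rewrite !mxE.
case: eqVneq => [_|]; rewrite ?mulr0n ?addr0// !mulr1n -!natrD part.
by [].
Qed.

(** Applied to X, with Y = Q X: as the block Q_IW is zero, Y_I = Q_II X_I + Q_IU X_U, and this is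
    solved for X_I. *)
Lemma regression I U W : (forall i, (I i + U i + W i = 1)%N) ->
  mask I *m Q *m mask W = 0 ->
  mask I = H I *m (mask I *m Q) - H I *m (mask I *m Q *m mask U).
Proof.
move=> part IW0.
have E : mask I *m Q = mask I *m Q *m mask I + mask I *m Q *m mask U.
  by rewrite -[LHS]mulmx1 -(mask_partition part) !mulmxDr IW0 addr0.
rewrite -[RHS]mulmxBr.
have -> : mask I *m Q - mask I *m Q *m mask U = mask I *m Q *m mask I by rewrite [X in X - _]E addrK.
by rewrite padded_inv.
Qed.

Definition coord_fam J := [set X i | i in [set i | J i]].

Lemma lincomb_coord i : X i = lincomb X (delta_mx 0 i).
Proof.
apply/funext => t; rewrite /lincomb (bigD1 i)//= big1 ?addr0 ?mxE ?eqxx ?mul1r//.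
by move=> j ji; rewrite mxE (negbTE ji) andbF mul0r.
Qed.

Lemma sigma_lin_lincomb p (A : 'M[R]_(p, n)) c :
  F_measurable (sigma_lin X A) (lincomb X (c *m A)).
Proof.
by move=> B mB; apply: sub_sigma_algebra; exists (lincomb X (c *m A)), B; split=> //; exists c.
Qed.

Lemma coord_fam_lincomb J a : a *m mask J = a ->
  F_measurable (sigma_fam (coord_fam J)) (lincomb X a).
Proof.
move=> aJ; set Gs := \bigcup_(f in coord_fam J) preimage_set_system setT f measurable.
have m : measurable_fun (setT : set (g_sigma_algebraType Gs)) (lincomb X a : _ -> R).
  apply: measurable_sum => i.
  have [Ji|nJi] := boolP (J i).
    apply: measurable_funM => //; move=> _ B mB; rewrite setTI.
    by apply: sub_sigma_algebra; exists (X i); [exists i|exists B => //; rewrite setTI].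
  have -> : a 0 i = 0 by rewrite -aJ mul_mask (negbTE nJi) mulr0.
  rewrite (_ : (fun _ => _) = cst 0); first exact: measurable_cst.
  by apply/funext => t; rewrite mul0r.
by move=> B mB; have := m measurableT B mB; rewrite setTI.
Qed.

Lemma coord_fam_sub_sigma_lin J : sigma_fam (coord_fam J) `<=` sigma_lin X (mask J).
Proof.
apply: smallest_sub; first exact: smallest_sigma_algebra.
move=> _ [_ [i Ji <-] [B mB <-]]; rewrite setTI.
have -> : X i = lincomb X (delta_mx 0 i *m mask J).
  rewrite lincomb_coord; congr lincomb; apply/matrixP => k l.
  rewrite mul_mask !mxE; case: (l =P i) => [->|_]; last by rewrite andbF mul0r.
  by rewrite Ji mulr1.
exact: sigma_lin_lincomb.
Qed.

Lemma lin_gens_measurable p (A : 'M[R]_(p, n)) : lin_gens X A `<=` measurable.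
Proof.
move=> E GE; apply: (sigma_lin_measurable gX (A := A)).
exact: sub_sigma_algebra.
Qed.

Let coord_gens J := \bigcup_(f in coord_fam J) preimage_set_system setT f measurable.

Lemma coord_gens_measurable J : coord_gens J `<=` measurable.
Proof.
move=> E GE; apply: (sigma_lin_measurable gX (A := mask J)).
by apply: coord_fam_sub_sigma_lin; exact: sub_sigma_algebra.
Qed.

Lemma gaussian_coord_lift I U W : (forall i, (I i + U i + W i = 1)%N) ->
  mask I *m Q *m mask W = 0 ->
  forall A, sigma_fam (coord_fam I) A ->
  exists2 E : set (g_sigma_algebraType (coord_gens U) *
                   g_sigma_algebraType (lin_gens X (mask I *m Q))),
    measurable E & A = [set t | E (t, t)].
Proof.
move=> part IW0; apply: diagonal_lift => _ [i Ii <-].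
pose h := (delta_mx 0 i : 'rV[R]_n) *m H I.
exists (lincomb X (- (h *m (mask I *m Q) *m mask U))), (lincomb X (h *m (mask I *m Q))).
split.
- move=> t; rewrite lincomb_coord.
  have -> : (delta_mx 0 i : 'rV[R]_n) = delta_mx 0 i *m mask I.
    apply/matrixP => k l; rewrite mul_mask !mxE.
    case: (l =P i) => [->|_]; last by rewrite andbF mul0r.
    by rewrite Ii mulr1.
  rewrite [in LHS](regression part IW0) mulmxBr addrC lincombD /= /h !mulmxA.
  by [].
- by apply: coord_fam_lincomb; rewrite mulNmx -[_ *m mask U *m mask U]mulmxA mask_idem.
- exact: sigma_lin_lincomb.
Qed.

(* Put [Y = Q X]. Then [X_U], [Y_I] and [Y_W] are uncorrelated, hence independent,
   while [X_I] is a function of [X_U] and [Y_I], and [X_W] one of [X_U] and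
   [Y_W]. *)
Lemma gaussian_cond_indep I U W : (forall i, (I i + U i + W i = 1)%N) ->
  (forall i j, I i -> W j -> Q i j = 0) ->
  cond_indep P (sigma_fam (coord_fam U)) (sigma_fam (coord_fam I))
    (sigma_fam (coord_fam W)).
Proof.
move=> part IW.
have dis J J' : (forall i, (J i + J' i <= 1)%N) -> mask J *m mask J' = 0.
  move=> JJ; apply: mask_disjoint => i; have := JJ i.
  by case: (J i); case: (J' i).
have tQ : Q^T = Q := pQ.1.
have IW0 : mask I *m Q *m mask W = 0 by exact: mask_mul0.
have WI0 : mask W *m Q *m mask I = 0.
  by apply: mask_mul0 => i j Wi Ij; rewrite -tQ mxE IW.
have partW i : (W i + U i + I i = 1)%N by have := part i; lia.
have UI : mask U *m mask I = 0 by apply: dis => i; have := part i; lia.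
have UW : mask U *m mask W = 0 by apply: dis => i; have := part i; lia.
have SQ : S *m Q = 1%:M by rewrite mulmxV.
have QS : Q *m S = 1%:M by rewrite mulVmx.
apply: (@cond_indep_of_independent _ _ _ _ (coord_gens U)
  (lin_gens X (mask I *m Q)) (lin_gens X (mask W *m Q))).
- exact: coord_gens_measurable.
- exact: lin_gens_measurable.
- exact: lin_gens_measurable.
- exact: gaussian_coord_lift part IW0.
- exact: gaussian_coord_lift partW WI0.
- move=> A B sA sB.
  apply: (gaussian_indep gX pS (A := mask U) (B := col_mx (mask I *m Q) (mask W *m Q))).
  + rewrite tr_col_mx mul_mx_row !trmx_mul tQ !tr_mask !mulmxA.
    rewrite -[mask U *m S *m Q]mulmxA SQ mulmx1 UI UW.
    by rewrite row_mx0.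
  + exact: coord_fam_sub_sigma_lin.
  + move: B sB; apply: smallest_sub; first exact: smallest_sigma_algebra.
    move=> E [] [_ [B [[c _ <-] mB ->]]].
      have -> : c *m (mask I *m Q) = row_mx c 0 *m col_mx (mask I *m Q) (mask W *m Q).
        by rewrite mul_row_col mul0mx addr0.
      exact: sigma_lin_lincomb.
    have -> : c *m (mask W *m Q) = row_mx 0 c *m col_mx (mask I *m Q) (mask W *m Q).
      by rewrite mul_row_col mul0mx add0r.
    exact: sigma_lin_lincomb.
- move=> A B sA sB; apply: (gaussian_indep gX pS (A := mask I *m Q) (B := mask W *m Q)) => //.
  rewrite trmx_mul tQ tr_mask -[mask I *m Q *m S]mulmxA QS mulmx1 mulmxA.
  by rewrite IW0.
Qed.

(* [Z X] is the residual of the regression of [Y_W] on [Y_I], for [Y = Q X]: it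
   is a combination of [X_U] and [X_W] uncorrelated with [X_U], so that
   conditional independence makes it independent of [X_I]. Its covariance with
   [X_I] is [- D], and [D] determines the block [Q_WI]. *)
Lemma gaussian_cond_indep_precision I U W : (forall i, (I i + U i + W i = 1)%N) ->
  cond_indep P (sigma_fam (coord_fam U)) (sigma_fam (coord_fam I))
    (sigma_fam (coord_fam W)) ->
  forall i j, I i -> W j -> Q i j = 0.
Proof.
move=> part ci.
have dis J J' : (forall i, (J i + J' i <= 1)%N) -> mask J *m mask J' = 0.
  move=> JJ; apply: mask_disjoint => i; have := JJ i.
  by case: (J i); case: (J' i).
have tQ : Q^T = Q := pQ.1.
have SQ : S *m Q = 1%:M by rewrite mulmxV.
have QS : Q *m S = 1%:M by rewrite mulVmx.
have IU : mask I *m mask U = 0 by apply: dis => i; have := part i; lia.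
have WU : mask W *m mask U = 0 by apply: dis => i; have := part i; lia.
have WI : mask W *m mask I = 0 by apply: dis => i; have := part i; lia.
pose D := mask W *m Q *m mask I *m H I *m mask I.
pose Z := mask W *m Q - D *m Q.
have ZI : Z *m mask I = 0.
  rewrite /Z /D mulmxBl.
  have -> : mask W *m Q *m mask I *m H I *m mask I *m Q *m mask I =
     mask W *m Q *m mask I *m (H I *m (mask I *m Q *m mask I)) by rewrite !mulmxA.
  by rewrite padded_inv -[X in _ - X]mulmxA mask_idem subrr.
have ZS : Z *m S = mask W - D.
  rewrite /Z mulmxBl -[mask W *m Q *m S]mulmxA QS mulmx1.
  by rewrite -[D *m Q *m S]mulmxA QS mulmx1.
have DU : D *m mask U = 0 by rewrite /D -[LHS]mulmxA IU mulmx0.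
have DI : D *m mask I = D by rewrite /D -[LHS]mulmxA mask_idem.
have ZSU : Z *m S *m mask U = 0.
  by rewrite ZS mulmxBl WU DU subrr.
have ZSI : Z *m S *m mask I = - D.
  by rewrite ZS mulmxBl WI DI sub0r.
suff D0 : D = 0.
  move=> i j Ii Wj; have E : mask W *m Q *m mask I = D *m (Q *m mask I).
    rewrite /D.
    have -> : mask W *m Q *m mask I *m H I *m mask I *m (Q *m mask I) =
     mask W *m Q *m mask I *m (H I *m (mask I *m Q *m mask I)) by rewrite !mulmxA.
    by rewrite padded_inv -[RHS]mulmxA mask_idem.
  move: E; rewrite D0 mul0mx => /matrixP/(_ j i).
  have -> : Q i j = Q j i by rewrite -[in LHS]tQ mxE.
  by rewrite mul_mask mask_mul Ii Wj mul1r mulr1 [RHS]mxE.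
apply: oppr_inj; rewrite -ZSI oppr0; apply/matrixP => w i.
rewrite mul_mask [RHS]mxE; case Ii : (I i); last by rewrite mulr0.
rewrite mulr1.
pose z := row w Z.
pose di : 'rV[R]_n := delta_mx 0 i.
have zS : (di *m S *m z^T) 0 0 = (Z *m S) w i.
  have -> : di *m S *m z^T = (z *m S *m di^T)^T.
    by rewrite !trmx_mul trmxK (pS.1) mulmxA.
  by rewrite mxE /di trmx_delta -colE mxE /z -row_mul mxE.
have [imul Emul] := gaussian_mul gX pS di z.
have [iz Ez] := gaussian_mean gX z.
have [iX EX] := gaussian_mean gX di.
rewrite -lincomb_coord in imul Emul iX EX.
have mfam J : sigma_fam (coord_fam J) `<=` measurable.
  move=> E sE; apply: (sigma_lin_measurable gX (A := mask J)).
  exact: coord_fam_sub_sigma_lin.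
have sfam J : sigma_algebra setT (sigma_fam (coord_fam J)) by exact: smallest_sigma_algebra.
pose Fz := preimage_set_system setT (lincomb X z) measurable.
have sFz : sigma_algebra setT Fz by apply/sigma_algebra_preimage/sigma_algebra_measurable.
have mz := measurable_lincomb z gX.1.
have mFz : Fz `<=` measurable.
  by move=> _ [B mB <-]; exact: mz.
have zA C : Fz C -> sigma_lin X Z C.
  move=> [B mB <-]; rewrite setTI.
  have -> : z = delta_mx 0 w *m Z by rewrite -rowE.
  exact: sigma_lin_lincomb.
(* By [ZI] the coefficients of [z] on [I] vanish, so [lincomb X z] involves only coordinates in [U]
   and [W]. *)
have zUW C : Fz C -> <<s [set B `&` D' | B in sigma_fam (coord_fam W) & D' in sigma_fam (coord_fam U)] >> C.
  move=> [B mB <-]; rewrite setTI.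
  set G := [set B `&` D' | B in _ & D' in _].
  have mco J j : (sigma_fam (coord_fam J) `<=` <<s G >>) -> J j ->
      measurable_fun (setT : set (g_sigma_algebraType G)) (X j : _ -> R).
    move=> JG Jj _ C' mC'; rewrite setTI; apply: JG; apply: sub_sigma_algebra.
    by exists (X j); [exists j|exists C' => //; rewrite setTI].
  have WG : sigma_fam (coord_fam W) `<=` <<s G >>.
    move=> E sE; apply: sub_sigma_algebra; exists E => //.
    by exists setT; [exact: sigma_algebra_setT|rewrite setIT].
  have UG : sigma_fam (coord_fam U) `<=` <<s G >>.
    move=> E sE; apply: sub_sigma_algebra; exists setT; first exact: sigma_algebra_setT.
    by exists E => //; rewrite setTI.
  have m : measurable_fun (setT : set (g_sigma_algebraType G)) (lincomb X z : _ -> R).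
    apply: measurable_sum => j; have := part j.
    case Ij : (I j); case Uj : (U j); case Wj : (W j) => // _.
    + have -> : z 0 j = 0.
        have := ZI => /matrixP/(_ w j); rewrite mul_mask Ij mulr1 [in RHS]mxE => Zwj.
        by rewrite /z mxE.
      rewrite (_ : (fun _ => _) = cst 0); first exact: measurable_cst.
      by apply/funext => t; rewrite mul0r.
    + by apply: measurable_funM => //; exact: mco UG Uj.
    + by apply: measurable_funM => //; exact: mco WG Wj.
  by have := m measurableT B mB; rewrite setTI.
have indep A C : sigma_fam (coord_fam I) A -> Fz C -> (P (A `&` C) = P A * P C)%E.
  move=> sA FzC.
  apply: (cond_indep_independent (sfam U) (sfam W) (mfam U) (mfam I) (mfam W) ci sA (zUW _ FzC)).
  move=> D' sD'; apply: (gaussian_indep gX pS (A := Z) (B := mask U)).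
  - by rewrite tr_mask.
  - exact: zA.
  - exact: coord_fam_sub_sigma_lin.
have FzM : F_measurable Fz (lincomb X z).
  by move=> B mB; exists B => //; rewrite setTI.
have FIM : F_measurable (sigma_fam (coord_fam I)) (X i).
  by move=> B mB; apply: sub_sigma_algebra; exists (X i); [exists i|exists B => //; rewrite setTI].
have step1 A : sigma_fam (coord_fam I) A -> (\int[P]_(t in A) (lincomb X z t)%:E = 0)%E.
  move=> sA; have mA := mfam I _ sA.
  have icst : P.-integrable setT (EFin \o cst (fine (P A))).
    by apply: bounded_integrable => //; exists `|fine (P A)|.
  rewrite -integral_indic_mul//.
  transitivity (\int[P]_t (lincomb X z t * \1_A t)%:E)%E.
    by apply: eq_integral => t _; rewrite mulrC.
  rewrite (integral_mul_F sFz mFz (h := cst (fine (P A))))//.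
  - under eq_integral do rewrite mulrC EFinM.
    by rewrite integralZl// Ez mule0.
  - exact: indic_integrable.
  - rewrite (_ : (fun t => _) = (fun t => (\1_A t * lincomb X z t)%:E)).
      exact: integrable_indic_mul.
    by apply/funext => t; rewrite mulrC.
  - rewrite (_ : (fun t => _) = (fun t => (fine (P A))%:E * (lincomb X z t)%:E)%E).
      exact: integrableZl.
    by apply/funext => t; rewrite -EFinM mulrC.
  - move=> C FzC; have mC := mFz _ FzC.
    rewrite integral_indicE// indep//.
    transitivity (\int[P]_(t in C) cst (fine (P A))%:E t)%E; last by [].
    by rewrite integral_cst// fineK// fin_num_measure.
(* By [step1] the residual has conditional expectation zero given X_I, so it is orthogonal to X_i;
   [gaussian_mul] computes the same integral from [Z *m S]. *)
have : (\int[P]_t (X i t * lincomb X z t)%:E = \int[P]_t (X i t * 0)%:E)%E.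
  apply: (integral_mul_F (sfam I) (mfam I) (h := cst 0)) => //.
  - by apply: bounded_integrable => //; exists 0 => t; rewrite normr0.
  - rewrite (_ : (fun t => _) = EFin \o cst 0).
      by apply: bounded_integrable => //; exists 0 => t; rewrite normr0.
    by apply/funext => t; rewrite /= mulr0.
  - by move=> A sA; rewrite step1//= integral0.
rewrite Emul zS; under eq_integral do rewrite mulr0.
rewrite integral0 => -[/eqP]; rewrite mulf_eq0 gt_eqF ?std_variance_gt0//= => /eqP ->.
by [].
Qed.

End gaussian_conditional_independence.

(** * Linear images and almost sure modifications of Gaussian vectors *)

Section gaussian_transforms.
Context d (T : measurableType d) (R : realType) (P : probability T R).

Lemma lincomb_lincomb n m (X : 'I_n -> T -> R) (A : 'M[R]_(m, n)) (a : 'rV[R]_m) :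
  lincomb (fun i => lincomb X (row i A)) a = lincomb X (a *m A).
Proof.
apply/funext => t; rewrite /lincomb.
under eq_bigr do rewrite mulr_sumr.
rewrite exchange_big /=; apply: eq_bigr => j _.
rewrite mxE mulr_suml; apply: eq_bigr => i _.
by rewrite mxE mulrA.
Qed.

Lemma gaussian_linear n m (X : 'I_n -> T -> R) S (A : 'M[R]_(m, n)) :
  gaussian_vec P X S -> gaussian_vec P (fun i => lincomb X (row i A)) (A *m S *m A^T).
Proof.
move=> [mX lX]; split=> [i|a]; first exact: measurable_lincomb.
rewrite lincomb_lincomb (_ : quad _ a = quad S (a *m A)); first exact: lX.
by rewrite /quad trmx_mul !mulmxA.
Qed.

(** The model equations hold only almost surely, so the sequence coincides with the linear image of
    its noise only up to a null set. *)
Lemma gaussian_ae n (X Y : 'I_n -> T -> R) S : (forall i, measurable_fun setT (Y i)) ->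
  {ae P, forall t, forall i, Y i t = X i t} -> gaussian_vec P X S -> gaussian_vec P Y S.
Proof.
move=> mY YX [mX lX]; split=> // a A mA; rewrite -lX//.
have mpre (f : T -> R) : measurable_fun setT f -> measurable (f @^-1` A).
  by move=> mf; rewrite -[X in measurable X]setTI; exact: mf.
have m1 := mpre _ (measurable_lincomb a mY).
have m2 := mpre _ (measurable_lincomb a mX).
have i1 (D : set T) : measurable D -> P D = (\int[P]_t (\1_D t)%:E)%E.
  by move=> mD; rewrite integral_indic// setIT.
rewrite i1// [RHS]i1//; apply: ae_eq_integral => //.
- exact/measurable_EFinP/measurable_indic.
- exact/measurable_EFinP/measurable_indic.
- apply: filterS YX => t YXt _; rewrite !indicE; congr (_%:R%:E).
  have E : lincomb Y a t = lincomb X a t by apply: eq_bigr => i _; rewrite YXt.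
  by congr nat_of_bool; apply/idP/idP; rewrite !inE /= E.
Qed.

Lemma Lfun2_lincomb n (X : 'I_n -> T -> R) (a : 'rV[R]_n) :
  (forall i, X i \in Lfun P 2%:E) -> lincomb X a \in Lfun P 2%:E.
Proof.
move=> LX; rewrite (_ : lincomb X a = \sum_i (a 0 i \o* X i)); last first.
  by apply/funext => t; rewrite fct_sumE; apply: eq_bigr => i _ /=; rewrite mulrC.
apply: (big_ind (fun f : T -> R => f \in Lfun P 2%:E)) => [|f g lf lg|i _].
- by rewrite rpred0 ?lee1n.
- by rewrite rpredD ?lee1n.
- by rewrite Lfun_scale ?ler1n.
Qed.

Lemma covariance_lincombl n (X : 'I_n -> T -> R) (Y : T -> R) (a : 'rV[R]_n) :
  (forall i, X i \in Lfun P 2%:E) -> Y \in Lfun P 2%:E ->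
  (covariance P (lincomb X a) Y = \sum_i (a 0 i)%:E * covariance P (X i) Y)%E.
Proof.
move=> LX LY.
have Pfin : P setT \is a fin_num := fin_num_measure P _ measurableT.
have E (s : seq 'I_n) : (fun t => \sum_(i <- s) a 0 i * X i t) \in Lfun P 2%:E /\
    (covariance P (fun t => \sum_(i <- s) a 0 i * X i t)%R Y =
     \sum_(i <- s) (a 0 i)%:E * covariance P (X i) Y)%E.
  elim: s => [|i s [Ls IH]].
    under eq_fun do rewrite big_nil.
    split; last by rewrite big_nil; exact: covariance_cst_l.
    exact: Lfun_cst.
  have EE : (fun t => \sum_(j <- i :: s) a 0 j * X j t) =
      (a 0 i \o* X i) \+ (fun t => \sum_(j <- s) a 0 j * X j t).
    by apply/funext => t; rewrite big_cons /= mulrC.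
  have La : (a 0 i \o* X i) \in Lfun P 2%:E by rewrite Lfun_scale ?ler1n.
  rewrite EE; split; first by rewrite rpredD ?lee1n.
  rewrite covarianceDl// IH big_cons covarianceZl//.
  - exact: Lfun_subset12.
  - exact: Lfun_subset12.
  - exact: Lfun2_mul_Lfun1.
exact: (E (index_enum 'I_n)).2.
Qed.

End gaussian_transforms.

(** * The precision matrix of a CM_L sequence *)

Section blocks.
Context (R : realType) (d N : nat).
Local Notation K := ('I_N.+1 * 'I_d)%type.
Definition dim := #|{: K}|.
Definition blk (p : 'I_dim) : 'I_N.+1 := (enum_val p).1.
Definition cmp (p : 'I_dim) : 'I_d := (enum_val p).2.
(** [inord] returns a default beyond [N], whence the side condition [k <= N] in the lemmas on
    blocks. *)
Definition idx (k : nat) (i : 'I_d) : 'I_dim := enum_rank ((inord k : 'I_N.+1), i).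

Lemma blk_idx k i : (k <= N)%N -> blk (idx k i) = k :> nat.
Proof. by move=> kN; rewrite /blk enum_rankK /= inordK. Qed.

Lemma cmp_idx k i : cmp (idx k i) = i.
Proof. by rewrite /cmp enum_rankK. Qed.

Lemma idx_blk p : idx (blk p) (cmp p) = p.
Proof. by rewrite /idx inord_val /blk /cmp -surjective_pairing enum_valK. Qed.

Lemma sum_idx (V : nmodType) (f : 'I_dim -> V) :
  \sum_p f p = \sum_(k < N.+1) \sum_(i < d) f (idx k i).
Proof.
rewrite pair_bigA /= (reindex (fun p : 'I_dim => enum_val p)) /=.
  by apply: eq_bigr => p _; rewrite -[p in LHS]idx_blk.
by apply: onW_bij; exact: enum_val_bij.
Qed.

Definition bigm (F : nat -> nat -> 'M[R]_d) : 'M[R]_dim :=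
  \matrix_(p, q) F (blk p) (blk q) (cmp p) (cmp q).

Lemma bigm_mul F F' : bigm F *m bigm F' =
  bigm (fun k l => \sum_(m < N.+1) F k m *m F' m l).
Proof.
apply/matrixP => p q; rewrite !mxE sum_idx summxE; apply: eq_bigr => k _.
rewrite !mxE; apply: eq_bigr => i _.
by rewrite !mxE blk_idx ?cmp_idx// -ltnS.
Qed.

Lemma tr_bigm F : (bigm F)^T = bigm (fun k l => (F l k)^T).
Proof. by apply/matrixP => p q; rewrite !mxE. Qed.

Definition bdiag (D : nat -> 'M[R]_d) := bigm (fun k l => (k == l)%:R *: D k).

Lemma eq_bigm F F' : (forall k l, (k <= N)%N -> (l <= N)%N -> F k l = F' k l) -> bigm F = bigm F'.
Proof. by move=> E; apply/matrixP => p q; rewrite !mxE E// -ltnS. Qed.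

Lemma sum_delta (V : lmodType R) (F : nat -> V) k : (k <= N)%N ->
  \sum_(r < N.+1) (r == k :> nat)%:R *: F r = F k.
Proof.
move=> kN; rewrite (bigD1 (Ordinal (kN : (k < N.+1)%N)))//= eqxx scale1r big1 ?addr0//.
move=> i ik; rewrite (_ : (i == k :> nat) = false) ?scale0r//.
by apply: contraNF ik => /eqP ik; apply/eqP/val_inj.
Qed.

Lemma bdiag1 : bdiag (fun=> 1%:M) = 1%:M.
Proof.
apply/matrixP => p q; rewrite !mxE -natrM mulnb; congr (nat_of_bool _)%:R.
apply/andP/eqP => [[/eqP k /eqP i]|->]; last by rewrite !eqxx.
by rewrite -[p]idx_blk -[q]idx_blk k i.
Qed.

Lemma bdiagM D D' : bdiag D *m bdiag D' = bdiag (fun k => D k *m D' k).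
Proof.
rewrite bigm_mul; apply: eq_bigm => k l kN lN.
under eq_bigr do rewrite -scalemxAl eq_sym.
rewrite (sum_delta (fun r => D k *m ((r == l)%:R *: D' r)))//.
by rewrite -scalemxAr.
Qed.

Lemma tr_bdiag D : (bdiag D)^T = bdiag (fun k => (D k)^T).
Proof.
rewrite tr_bigm; apply: eq_bigm => k l _ _; rewrite linearZ /= eq_sym.
by case: eqVneq => [->|]; rewrite ?scale0r.
Qed.

(** Factoring each block as L_k L_k' exhibits the matrix as a congruence of the identity by an
    invertible block diagonal matrix. *)
Lemma bdiag_posdef D : (forall k, (k <= N)%N -> posdef (D k)) -> posdef (bdiag D).
Proof.
move=> pD.
have [L LE] : exists L : nat -> 'M[R]_d, forall k, (k <= N)%N -> D k = L k *m (L k)^T.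
  have H k : exists L : 'M[R]_d, (k <= N)%N -> D k = L *m L^T.
    have [kN|_] := boolP (k <= N)%N; last by exists 0.
    by have [L E] := posdef_factor (pD k kN); exists L.
  by have [L LE] := choice H; exists L.
have -> : bdiag D = bdiag L *m 1%:M *m (bdiag L)^T.
  rewrite mulmx1 tr_bdiag bdiagM; apply: eq_bigm => k l kN _; congr (_ *: _).
  exact: LE.
apply: posdef_congr; first exact: posdef1.
move=> v; rewrite tr_bdiag => Lv.
have uL k : (k <= N)%N -> (L k)^T \in unitmx.
  move=> kN; have := posdef_unit (pD k kN); rewrite LE// unitmx_mul => /andP[_]//.
have : bdiag (fun k => invmx (L k)^T) *m (bdiag (fun k => (L k)^T) *m v) = v.
  rewrite mulmxA bdiagM (_ : bdiag _ = 1%:M) ?mul1mx// -bdiag1.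
  by apply: eq_bigm => k l kN _; rewrite mulVmx// uL.
by rewrite Lv mulmx0.
Qed.

Lemma bdiag_inv D : (forall k, (k <= N)%N -> posdef (D k)) ->
  invmx (bdiag D) = bdiag (fun k => invmx (D k)).
Proof.
move=> pD; apply: mulmx_inv_unique; rewrite bdiagM -bdiag1.
by apply: eq_bigm => k l kN _; rewrite mulmxV//; exact: posdef_unit (pD k kN).
Qed.

End blocks.

(** * The model as a block linear system *)

Section cml_gaussian.
Context (R : realType) (d N : nat) (hN : (0 < N)%N).
Variables (Gprev Glast G : nat -> 'M[R]_d).
Hypothesis hG : forall k, (0 < k < N)%N -> posdef (G k).
Variables (B C0 CN : 'M[R]_d).
Hypotheses (pC0 : posdef C0) (pCN : posdef CN).
Local Notation n := (dim d N).

(* The model reads [e = Tb x] with [Tb] block unitriangular for the order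
   N, 0, 1, ..., N-1 of the times. *)
Definition Tb (k l : nat) : 'M[R]_d := (k == l)%:R *: 1%:M
  - ((k < N)%N && (l == N))%:R *: (if k == 0%N then B else Glast k)
  - ((0 < k < N)%N && (l == k.-1))%:R *: Gprev k.

Definition Dc (k : nat) : 'M[R]_d :=
  if k == 0%N then C0 else if k == N then CN else G k.

Lemma Dc_posdef k : (k <= N)%N -> posdef (Dc k).
Proof.
move=> kN; rewrite /Dc; case: eqVneq => // k0; case: eqVneq => // kN'.
by apply: hG; rewrite lt0n k0 ltn_neqAle kN' kN.
Qed.

Let BT : 'M[R]_n := bigm N Tb.
Let BD : 'M[R]_n := bdiag N Dc.

Lemma sum_Tb m (v : nat -> 'M[R]_(d, m)) k : (k <= N)%N ->
  \sum_(l < N.+1) Tb k l *m v l = v k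
    - (k < N)%N%:R *: ((if k == 0%N then B else Glast k) *m v N)
    - (0 < k < N)%N%:R *: (Gprev k *m v k.-1).
Proof.
move=> kN.
transitivity (\sum_(l < N.+1) (l == k :> nat)%:R *: v l
   - \sum_(l < N.+1) (l == N :> nat)%:R *: ((k < N)%N%:R *: ((if k == 0%N then B else Glast k) *m v l))
   - \sum_(l < N.+1) (l == k.-1 :> nat)%:R *: ((0 < k < N)%N%:R *: (Gprev k *m v l))).
  rewrite -!sumrB; apply: eq_bigr => l _.
  rewrite /Tb !mulmxBl -!scalemxAl mul1mx !scalerA -!natrM !mulnb eq_sym.
  by rewrite [(l == N :> nat) && _]andbC [(l == k.-1 :> nat) && _]andbC.
rewrite (sum_delta v kN) (sum_delta (fun l => (k < N)%N%:R *: ((if k == 0%N then B else Glast k) *m v l)) (leqnn N)).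
by rewrite (sum_delta (fun l => (0 < k < N)%N%:R *: (Gprev k *m v l)))// (leq_trans (leq_pred _)).
Qed.

Lemma bigm_mulv (F : nat -> nat -> 'M[R]_d) (v : 'cV[R]_n) k i : (k <= N)%N ->
  (bigm N F *m v) (idx N k i) 0 =
  (\sum_(l < N.+1) F k l *m (\col_j v (idx N l j) 0)) i 0.
Proof.
move=> kN; rewrite mxE sum_idx summxE; apply: eq_bigr => l _.
rewrite mxE; apply: eq_bigr => j _.
by rewrite !mxE !blk_idx ?cmp_idx// -ltnS.
Qed.

Lemma BT_inj (v : 'cV[R]_n) : BT *m v = 0 -> v = 0.
Proof.
move=> Tv; pose w l : 'cV[R]_d := \col_j v (idx N l j) 0.
have E k : (k <= N)%N -> w k
    - (k < N)%N%:R *: ((if k == 0%N then B else Glast k) *m w N)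
    - (0 < k < N)%N%:R *: (Gprev k *m w k.-1) = 0.
  move=> kN; rewrite -(sum_Tb w kN); apply/matrixP => i j; rewrite ord1.
  by rewrite -bigm_mulv// -/BT Tv !mxE.
have wN : w N = 0 by have := E N (leqnn N); rewrite ltnn andbF !scale0r !subr0.
have w0 k : (k <= N)%N -> w k = 0.
  elim: k => [|k IH] kN.
    by have := E 0%N kN; rewrite wN mulmx0 scaler0 scale0r !subr0.
  by have := E k.+1 kN; rewrite wN mulmx0 scaler0 IH ?(ltnW kN)// mulmx0 scaler0 !subr0.
apply/matrixP => p q; rewrite ord1 -[p]idx_blk mxE.
have := w0 (blk p); rewrite -ltnS => /(_ (ltn_ord _))/matrixP/(_ (cmp p) 0).
by rewrite !mxE.
Qed.

Lemma inj_unitmx m (A : 'M[R]_m) : (forall v : 'cV_m, A *m v = 0 -> v = 0) -> A \in unitmx.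
Proof.
move=> injA; have := posdef_unit (posdef_congr (B := A^T) (posdef1 R m) _).
rewrite trmxK mulmx1 unitmx_mul => H.
by have /andP[] := H injA.
Qed.

Lemma BT_unit : BT \in unitmx.
Proof. exact: inj_unitmx BT_inj. Qed.

Let SE := (std_variance R)^-1 *: BD.

Lemma SE_posdef : posdef SE.
Proof.
apply: posdef_scale; first by rewrite invr_gt0 std_variance_gt0.
by apply: bdiag_posdef => k; exact: Dc_posdef.
Qed.

(** The covariance matrix of x = BT^-1 e, in the normalization of [gaussian_vec]. *)
Definition SX := invmx BT *m SE *m (invmx BT)^T.

Lemma SX_posdef : posdef SX.
Proof.
apply: posdef_congr; first exact: SE_posdef.
move=> v; rewrite trmx_inv => H.
by rewrite -[v](mulKVmx (_ : BT^T \in unitmx)) ?unitmx_tr ?BT_unit// H mulmx0.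
Qed.

Lemma SX_inv : invmx SX = std_variance R *: bigm N (fun k m =>
  \sum_(r < N.+1) (Tb r k)^T *m invmx (Dc r) *m Tb r m).
Proof.
have uBT := BT_unit; have uBTt : BT^T \in unitmx by rewrite unitmx_tr.
have uBD : BD \in unitmx by apply/posdef_unit/bdiag_posdef => k; exact: Dc_posdef.
have -> : bigm N (fun k m => \sum_(r < N.+1) (Tb r k)^T *m invmx (Dc r) *m Tb r m) =
    BT^T *m invmx BD *m BT.
  rewrite bdiag_inv; last by move=> k; exact: Dc_posdef.
  rewrite tr_bigm /bdiag bigm_mul bigm_mul; apply: eq_bigm => k l kN lN.
  apply: eq_bigr => r _; congr (_ *m _).
  under eq_bigr => j _ do rewrite -scalemxAr.
  exact/esym/(@sum_delta R N _ (fun j => (Tb j k)^T *m invmx (Dc j)) r (ltnSE (ltn_ord r))).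
apply: mulmx_inv_unique; rewrite /SX /SE -!scalemxAr -!scalemxAl scalerA.
rewrite mulfV ?gt_eqF ?std_variance_gt0// scale1r trmx_inv !mulmxA.
rewrite -[_ *m invmx BT^T *m BT^T]mulmxA mulVmx// mulmx1.
rewrite -[_ *m BD *m invmx BD]mulmxA mulmxV// mulmx1.
by rewrite mulVmx.
Qed.

Lemma SX_inv_block k m : (0 < k < N)%N -> (m <= N)%N ->
  m != k -> m.+1 != k -> m != k.+1 ->
  \sum_(r < N.+1) (Tb r k)^T *m invmx (Dc r) *m Tb r m =
  (m == N)%:R *: ((k.+1 < N)%N%:R *: ((Gprev k.+1)^T *m invmx (G k.+1) *m Glast k.+1)
     - invmx (G k) *m Glast k).
Proof.
move=> kN mN mk m1k mk1; case/andP: (kN) => k0 ltkN.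
have TbE r : Tb r k = (r == k)%:R *: 1%:M - ((r == k.+1) && (k.+1 < N)%N)%:R *: Gprev r.
  rewrite /Tb (_ : (k == N) = false) ?andbF ?scale0r ?subr0; last by rewrite ltn_eqF.
  congr (_ - _%:R *: _); case: r => [|r]; first by [].
  rewrite /= eqSS; case: (eqVneq r k) => [->|nrk]; first by rewrite andbT.
  by rewrite andbF.
have TbM r : (r < N)%N -> r = k \/ r = k.+1 -> Tb r m = - ((m == N)%:R *: Glast r).
  move=> rN rk; rewrite /Tb rN.
  have -> : (r == m) = false by case: rk => ->; rewrite eq_sym; apply/negbTE.
  have -> : (m == r.-1) = false.
    case: rk => ->; last by apply/negbTE.
    by apply/negbTE; apply: contra m1k => /eqP ->; rewrite prednK.
  have -> : (r == 0)%N = false by case: rk => ->//; rewrite gtn_eqF.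
  by rewrite andbF !scale0r sub0r subr0.
transitivity (\sum_(r < N.+1) (r == k :> nat)%:R *: (invmx (Dc r) *m Tb r m) -
   \sum_(r < N.+1) (r == k.+1 :> nat)%:R *:
     ((k.+1 < N)%N%:R *: ((Gprev r)^T *m invmx (Dc r) *m Tb r m))).
  rewrite -sumrB; apply: eq_bigr => r _; rewrite TbE.
  have -> : ((r == k :> nat)%:R *: 1%:M - ((r == k.+1 :> nat) && (k.+1 < N)%N)%:R *: Gprev r)^T = (r == k :> nat)%:R *: 1%:M - ((r == k.+1 :> nat) && (k.+1 < N)%N)%:R *: (Gprev r)^T.
    by apply/matrixP => i j; rewrite !mxE [j == i]eq_sym.
  rewrite !mulmxBl -!scalemxAl !mul1mx scalerA -natrM mulnb.
  by [].
rewrite (sum_delta (fun r => invmx (Dc r) *m Tb r m) (ltnW ltkN)).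
rewrite (sum_delta (fun r => (k.+1 < N)%N%:R *: ((Gprev r)^T *m invmx (Dc r) *m Tb r m)) ltkN).
rewrite TbM//; last by left.
have Dk : Dc k = G k by rewrite /Dc gtn_eqF// ltn_eqF.
rewrite Dk mulmxN -scalemxAr.
case: (ltnP k.+1 N) => k1N; last by rewrite !scale0r subr0 sub0r scalerN.
rewrite !scale1r TbM//; last by right.
have -> : Dc k.+1 = G k.+1 by rewrite /Dc /= ltn_eqF.
by rewrite mulmxN -scalemxAr opprK addrC -scalerBr.
Qed.

Section governed.
Context (disp : measure_display) (T : measurableType disp) (P : probability T R).
Implicit Types x e : nat -> random_vector d P.

Definition flat x (p : 'I_n) : T -> R := x (blk p) (cmp p).

Lemma flat_blocks x e t :
  (\col_p flat e p t = BT *m \col_p flat x p t) <->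
  [/\ value (x N) t = value (e N) t,
      value (x 0%N) t = B *m value (x N) t + value (e 0%N) t &
      forall k, (0 < k < N)%N -> value (x k) t = Gprev k *m value (x k.-1) t
        + Glast k *m value (x N) t + value (e k) t].
Proof.
have flatE z k : (k <= N)%N -> \col_j (\col_p flat z p t) (idx N k j) 0 = value (z k) t.
  by move=> kN; apply/matrixP => i j; rewrite !mxE /flat blk_idx// cmp_idx.
have E : (\col_p flat e p t = BT *m \col_p flat x p t) <->
    (forall k, (k <= N)%N -> value (e k) t = \sum_(l < N.+1) Tb k l *m value (x l) t).
  have S k : (k <= N)%N -> \sum_(l < N.+1) Tb k l *m value (x l) t =
      \col_i (BT *m \col_p flat x p t) (idx N k i) 0.
    move=> kN; apply/matrixP => i j; rewrite mxE bigm_mulv// ord1; congr (fun_of_matrix _ _ _).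
    by apply: eq_bigr => l _; rewrite flatE// -ltnS.
  split=> [H k kN|H].
    by rewrite S// -H flatE.
  apply/matrixP => p j; rewrite ord1 -[p]idx_blk.
  have kN : (blk p <= N)%N by rewrite -ltnS.
  have := H _ kN; rewrite S// -flatE// => /matrixP/(_ (cmp p) 0).
  by rewrite !mxE.
rewrite E; split=> [H|[HN H0 Hk] k kN].
  split.
  - have := H N (leqnn N); rewrite (sum_Tb (fun l => value (x l) t))// ltnn andbF !scale0r !subr0.
    by move=> ->.
  - have := H 0%N (leq0n N); rewrite (sum_Tb (fun l => value (x l) t))// hN /= scale1r scale0r subr0.
    by move=> ->; rewrite addrC subrK.
  - move=> k /andP[k0 kN]; have := H k (ltnW kN).
    rewrite (sum_Tb (fun l => value (x l) t) (ltnW kN)) k0 kN gtn_eqF// !scale1r => ->.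
    have Z (V : zmodType) (u a b : V) : u = a + b + (u - b - a).
      by rewrite -[u - b - a]addrA -opprD (addrC b) [RHS]addrC subrK.
    exact: Z.
rewrite (sum_Tb (fun l => value (x l) t))//.
have [->|k0] := eqVneq k 0%N.
  by rewrite hN /= scale1r scale0r subr0 H0 addrAC subrr add0r.
have [->|kN'] := eqVneq k N.
  by rewrite ltnn andbF !scale0r !subr0 HN.
have k1 : (0 < k < N)%N by rewrite lt0n k0 ltn_neqAle kN' kN.
rewrite k1; case/andP: (k1) => _ ->; rewrite !scale1r (Hk k k1).
have H (V : zmodType) (a b c : V) : c = a + b + c - b - a.
  by rewrite -[_ - _ - _]addrA -opprD (addrC b) addrC addKr.
exact: H.
Qed.

End governed.
End cml_gaussian.

(** * White noise as one Gaussian vector *)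

Section white_gaussian_flat.
Context (R : realType) (d N : nat).
Context (disp : measure_display) (T : measurableType disp) (P : probability T R).
Local Notation n := (dim d N).
Local Notation flat := (@flat R d N disp T P).

Lemma measurable_flat (x : nat -> random_vector d P) p : measurable_fun [set: T] (flat x p).
Proof. exact: measurable_funPT. Qed.

Lemma lincomb_flat (x : nat -> random_vector d P) (a : 'rV[R]_n) : lincomb (flat x) a =
  (fun t => \sum_(k < N.+1) \sum_(i < d) a 0 (idx N k i) * x k i t).
Proof.
apply/funext => t; rewrite /lincomb sum_idx; apply: eq_bigr => k _.
by apply: eq_bigr => i _; rewrite /flat blk_idx ?cmp_idx// -ltnS.
Qed.

Lemma expectation_lincomb (X : 'I_n -> T -> R) (a : 'rV[R]_n) :
  (forall i, X i \in Lfun P 1) ->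
  ('E_P[lincomb X a] = \sum_i (a 0 i)%:E * 'E_P[X i])%E.
Proof.
move=> LX.
have E (s : seq 'I_n) : (fun t => \sum_(i <- s) a 0 i * X i t) \in Lfun P 1 /\
    ('E_P[fun t => \sum_(i <- s) a 0 i * X i t]%R = \sum_(i <- s) (a 0 i)%:E * 'E_P[X i])%E.
  elim: s => [|i s [Ls IH]].
    under eq_fun do rewrite big_nil.
    by split; [exact: Lfun_cst|rewrite big_nil; exact: expectation_cst].
  have EE : (fun t => \sum_(j <- i :: s) a 0 j * X j t) =
      (a 0 i \o* X i) \+ (fun t => \sum_(j <- s) a 0 j * X j t).
    by apply/funext => t; rewrite big_cons /= mulrC.
  have La : (a 0 i \o* X i) \in Lfun P 1 by rewrite Lfun_scale.
  rewrite EE; split; first by rewrite rpredD.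
  by rewrite expectationD// IH big_cons expectationZl.
exact: (E (index_enum 'I_n)).2.
Qed.

(** Joint normality provides some mean [m] and some scale [s] for each combination. The first two
    moments identify [m] and [s ^+ 2], and the sign of [s] does not affect a centred law. *)
Lemma white_gaussian_flat (D : nat -> 'M[R]_d) (e : nat -> random_vector d P) :
  (forall k, (k <= N)%N -> posdef (D k)) ->
  white_gaussian N e -> (forall k, (k <= N)%N -> cov (e k) (e k) = D k) ->
  gaussian_vec P (flat e) ((std_variance R)^-1 *: bdiag N D).
Proof.
move=> pD [jg zm unc _] covD; split=> [p|a]; first exact: measurable_flat.
have mE b : measurable_fun [set: T] (lincomb (flat e) b).
  by apply: measurable_lincomb => p; exact: measurable_flat.
have law b : exists m s, normal_rv_law P (lincomb (flat e) b) m s.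
  by apply/normal_lawP; rewrite lincomb_flat; exact: (jg (fun k i => b 0 (idx N k i))).
have L2 p : flat e p \in Lfun P 2%:E.
  have [m [s l]] := law (delta_mx 0 p); rewrite lincomb_coord.
  by apply: normal_Lfun2 l.
have LL b : lincomb (flat e) b \in Lfun P 2%:E by apply: Lfun2_lincomb.
have L1 p : flat e p \in Lfun P 1 by apply: Lfun_subset12 => //; exact: fin_num_measure.
have [m [s l]] := law a.
have m0 : m = 0.
  apply: EFin_inj; rewrite -(normal_mean (mE a) l) expectation_lincomb//.
  by rewrite big1// => i _; rewrite [X in (_ * X)%E](zm _ (ltnSE (ltn_ord (blk i)))) mule0.
have cE p q : covariance P (flat e p) (flat e q) = (bdiag N D p q)%:E.
  have fin : covariance P (flat e p) (flat e q) \is a fin_num.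
    by apply: covariance_fin_num; rewrite ?L1// Lfun2_mul_Lfun1.
  rewrite -(fineK fin); congr EFin; rewrite mxE.
  have -> : fine (covariance P (flat e p) (flat e q)) = cov (e (blk p)) (e (blk q)) (cmp p) (cmp q).
    by rewrite mxE.
  have pN := ltnSE (ltn_ord (blk p)); have qN := ltnSE (ltn_ord (blk q)).
  case: eqVneq => [E|/eqP ne]; first by rewrite -E covD// scale1r.
  by rewrite unc// scale0r.
have V : s ^+ 2 * std_variance R = (a *m bdiag N D *m a^T) 0 0.
  apply: EFin_inj; rewrite -(normal_variance (mE a) l) /variance.
  rewrite covariance_lincombl// mxE.
  under eq_bigr => i _.
    rewrite covarianceC covariance_lincombl//.
    under eq_bigr => j _ do rewrite cE -EFinM.
    rewrite sumEFin -EFinM; over.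
  rewrite sumEFin; congr EFin; apply: eq_bigr => i _; rewrite !mxE mulrC; congr (_ * _).
have s2 : s ^+ 2 = quad ((std_variance R)^-1 *: bdiag N D) a.
  rewrite /quad -scalemxAr -scalemxAl mxE -V mulrC mulfK// gt_eqF//; exact: std_variance_gt0.
move=> A mA; rewrite (l A mA) m0; apply: std_sign => //.
by rewrite sqr_sqrtr// -s2 sqr_ge0.
Qed.

End white_gaussian_flat.

(** * Reciprocity of a governed sequence *)

Section reciprocal_gaussian.
Context (R : realType) (d N : nat) (hN : (0 < N)%N).
Variables (Gprev Glast G : nat -> 'M[R]_d).
Hypothesis hG : forall k, (0 < k < N)%N -> posdef (G k).
Variables (B C0 CN : 'M[R]_d).
Hypotheses (pC0 : posdef C0) (pCN : posdef CN).
Context (disp : measure_display) (T : measurableType disp) (P : probability T R).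
Variable x : nat -> random_vector d P.
Local Notation n := (dim d N).
Local Notation flat := (@flat R d N disp T P).
Local Notation S := (SX N Gprev Glast G B C0 CN).

Lemma CML_governed_gaussian : CML_governed N Gprev Glast G B C0 CN x ->
  gaussian_vec P (flat x) S.
Proof.
move=> [e [we [c0 cN ck] aN a0 ak]].
have covD k : (k <= N)%N -> cov (e k) (e k) = Dc N G C0 CN k.
  move=> kN; rewrite /Dc; case: eqVneq => [->//|k0]; case: eqVneq => [->//|kN'].
  by apply: ck; rewrite lt0n k0 ltn_neqAle kN' kN.
have gE := white_gaussian_flat (Dc_posdef hG pC0 pCN) we covD.
pose BT := bigm N (Tb N Gprev Glast B).
apply: gaussian_ae (gaussian_linear (invmx BT) gE); first exact: measurable_flat.
have ak' : {ae P, forall t, forall k, (0 < k < N)%N ->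
   value (x k) t = Gprev k *m value (x k.-1) t + Glast k *m value (x N) t + value (e k) t}.
  apply: ae_foralln => k; have [kN|kN] := boolP (0 < k < N)%N; last exact: aeW.
  by apply: filterS (ak k kN).
have H : {ae P, forall t, \col_p flat e p t = BT *m \col_p flat x p t}.
  apply: filterS3 aN a0 ak' => t tN t0 tk.
  by apply/(flat_blocks hN Gprev Glast B).
apply: filterS H => t Ht p.
have : (invmx BT *m \col_p flat e p t) p 0 = flat x p t by rewrite Ht mulKmx ?mxE// BT_unit.
by move=> <-; rewrite mxE; apply: eq_bigr => q _; rewrite !mxE.
Qed.

Lemma sigma_of_fam (K : set nat) (J : pred 'I_n) :
  (forall k, K k -> (k <= N)%N) -> (forall p, J p <-> K (blk p)) ->
  sigma_of x K = sigma_fam (coord_fam (flat x) J).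
Proof.
move=> KN JK; congr (<<s _ >>); apply/seteqP; split=> A.
  move=> [k Kk [i _ H]]; exists (x k i : T -> R) => //.
  have kN := KN k Kk.
  by exists (idx N k i); [apply/JK; rewrite blk_idx|rewrite /flat blk_idx// cmp_idx].
by move=> [_ [p /JK Jp <-] H]; exists (blk p) => //; exists (cmp p).
Qed.

Lemma reciprocal_precision : gaussian_vec P (flat x) S -> reciprocal N x <->
  forall j l, (j < l <= N)%N -> forall p q : 'I_n, (j < blk p < l)%N ->
    (blk q < j)%N || (l < blk q)%N -> invmx S p q = 0.
Proof.
move=> gx; have pS := SX_posdef Gprev Glast hG B pC0 pCN.
have E j l : (j < l <= N)%N ->
    (cond_indep P (sigma_of x [set k | k = j \/ k = l])
               (sigma_of x [set k | (j < k < l)%N])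
               (sigma_of x [set k | (k < j)%N \/ (l < k <= N)%N])) <->
    forall p q : 'I_n, (j < blk p < l)%N -> (blk q < j)%N || (l < blk q)%N -> invmx S p q = 0.
  move=> /andP[jl lN].
  pose I := [pred p : 'I_n | (j < blk p < l)%N].
  pose U := [pred p : 'I_n | (blk p == j :> nat) || (blk p == l :> nat)].
  pose W := [pred p : 'I_n | (blk p < j)%N || (l < blk p)%N].
  have part p : (I p + U p + W p = 1)%N by rewrite /I /U /W /=; lia.
  rewrite (@sigma_of_fam [set k | k = j \/ k = l] U); first last.
  - move=> p; rewrite /U /=; split => [/orP[]/eqP ->|[] ->]; [by left|by right|..]; by rewrite eqxx ?orbT.
  - by move=> k /= [] ->; lia.
  rewrite (@sigma_of_fam [set k | (j < k < l)%N] I)//; last first.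
  - by move=> k /=; lia.
  rewrite (@sigma_of_fam [set k | (k < j)%N \/ (l < k <= N)%N] W); first last.
  - move=> p; have pN := ltnSE (ltn_ord (blk p)); rewrite /W /= pN andbT.
    by split => [/orP//|/orP].
  - by move=> k /=; lia.
  split=> [H|H]; first exact: gaussian_cond_indep_precision H.
  exact: (gaussian_cond_indep gx pS).
by split=> H j l jl; apply/(E j l jl); exact: H.
Qed.

Lemma reciprocal_iff_gains : gaussian_vec P (flat x) S ->
  reciprocal N x <-> reciprocal_gains N Gprev Glast G.
Proof.
move=> gx; rewrite reciprocal_precision// SX_inv//.
split=> [H k k0 kN|H j l jl p q pI qW].
  have kN' : (0 < k < N)%N by rewrite k0 ltnW.
  have := @SX_inv_block R d N Gprev Glast G B C0 CN k N kN' (leqnn N).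
  rewrite eqxx kN !scale1r => E; apply/esym/eqP; rewrite -subr_eq0 -E; [|lia..].
  apply/eqP/matrixP => i j; rewrite [RHS]mxE.
  (* Between [k.-1] and [k.+1] there is only [k], while [N] lies outside because [k.+1 < N]. *)
  have := H k.-1 k.+1 _ (idx N k i) (idx N N j).
  rewrite mxE [bigm _ _ _ _]mxE !blk_idx ?(ltnW (ltnW kN))// !cmp_idx prednK// => /(_ _ _ _)/eqP.
  rewrite mulf_eq0 gt_eqF ?std_variance_gt0//= => /(_ _ _ _)/eqP; apply; lia.
have qN := ltnSE (ltn_ord (blk q)).
(* The time of [p] is strictly inside (j, l) and that of [q] outside [j, l], so they are neither
   equal nor adjacent. *)
rewrite mxE [bigm _ _ _ _]mxE SX_inv_block//; [|lia..].
have [qE|] := eqVneq (blk q : nat) N; last by rewrite scale0r mxE mulr0.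
(* If [q] has time [N], it lies beyond [l], so [l < N] and the identity at [blk p] is available. *)
have k1 : ((blk p).+1 < N)%N by lia.
by rewrite k1 !scale1r -H ?subrr ?mxE ?mulr0//; lia.
Qed.

End reciprocal_gaussian.

(** * Realization of a CM_L model *)

Section standard_gaussian.
Context (R : realType).
Local Notation MR := (measurableTypeR R).
Local Notation std := (@std R).

Lemma quad1 n (a : 'rV[R]_n) : quad 1%:M a = \sum_i a 0 i ^+ 2.
Proof.
by rewrite /quad mulmx1 mxE; apply: eq_bigr => i _; rewrite mxE expr2.
Qed.

Definition cons_coord d (T : measurableType d) n (X : 'I_n -> T -> R)
    (i : 'I_n.+1) (t : T * MR) : R :=
  if unlift ord0 i is Some j then X j t.1 else t.2.

Lemma lincomb_cons_coord d (T : measurableType d) n (X : 'I_n -> T -> R)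
    (a : 'rV[R]_n.+1) t : lincomb (cons_coord X) a t =
  a 0 ord0 * t.2 + lincomb X (\row_j a 0 (lift ord0 j)) t.1.
Proof.
rewrite /lincomb big_ord_recl /cons_coord unlift_none; congr (_ + _).
by apply: eq_bigr => i _; rewrite liftK mxE.
Qed.

(** A combination is [b] times the new coordinate plus an independent normal variable of known
    scale; [std_rotation] gives the law of the sum. *)
Lemma gaussian_cons d (T : measurableType d) (P : probability T R) n
    (X : 'I_n -> T -> R) : gaussian_vec P X 1%:M ->
  gaussian_vec (P \x std)%E (cons_coord X) 1%:M.
Proof.
move=> [mX lX]; split=> [i|a A mA].
  rewrite /cons_coord; case: unliftP => [j _|_].
    by apply: measurableT_comp => //; exact: mX.
  exact: measurable_snd.
pose a' : 'rV[R]_n := \row_j a 0 (lift ord0 j); pose b := a 0 ord0.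
have mL : measurable_fun (setT : set (MR * MR)) (fun p => b * p.2 + p.1 : MR).
  by apply: measurable_funD => //; apply: measurable_funM.
have mB : measurable ((fun p : MR * MR => b * p.2 + p.1) @^-1` A).
  by rewrite -[X in measurable X]setTI; exact: mL.
pose f (x : R) : \bar R := std ((fun y => b * y + x) @^-1` A).
have mf : measurable_fun setT (f : MR -> \bar R).
  apply: eq_measurable_fun (measurable_fun_xsection std mB) => x _ /=.
  by congr (std _); apply/seteqP; split=> y; rewrite xsectionE.
transitivity (\int[P]_t f (lincomb X a' t))%E.
  apply: eq_integral => t _ /=; congr (std _); apply/seteqP.
  by split=> y; rewrite xsectionE /= lincomb_cons_coord.
have mL' : measurable_fun setT (lincomb X a') by apply: measurable_lincomb.
rewrite (integral_law mL' (lX a'))//.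
have r2 : Num.sqrt (quad 1%:M a) ^+ 2 = Num.sqrt (quad 1%:M a') ^+ 2 + b ^+ 2.
  have q0 m (c : 'rV[R]_m) : 0 <= quad 1%:M c.
    by rewrite quad1 sumr_ge0// => i _; exact: sqr_ge0.
  rewrite !sqr_sqrtr// !quad1 big_ord_recl addrC; congr (_ + _).
  by apply: eq_bigr => i _; rewrite mxE.
apply: etrans (std_rotation r2 mA); apply: eq_integral => x _.
by rewrite /f addr0.
Qed.

Lemma standard_gaussian_exists n : exists (d : measure_display) (T : measurableType d)
  (P : probability T R) (X : 'I_n -> T -> R), gaussian_vec P X 1%:M.
Proof.
elim: n => [|n [d [T [P [X gX]]]]].
  exists _, MR, std, (fun _ _ => 0); split=> [i|a A mA]; first exact: measurable_cst.
  have l0 : lincomb (fun (_ : 'I_0) (_ : MR) => 0) a = fun=> 0.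
    by apply/funext => t; rewrite /lincomb big_ord0.
  rewrite l0 quad1 big_ord0 sqrtr0; congr (std _).
  by apply/seteqP; split=> z /=; rewrite mul0r addr0.
by exists _, (T * MR)%type, (P \x std)%E, (cons_coord X); exact: gaussian_cons.
Qed.

End standard_gaussian.

Section realization.
Context (R : realType) (d N : nat) (hN : (0 < N)%N).
Variables (Gprev Glast G : nat -> 'M[R]_d).
Hypothesis hG : forall k, (0 < k < N)%N -> posdef (G k).
Variables (B C0 CN : 'M[R]_d).
Hypotheses (pC0 : posdef C0) (pCN : posdef CN).
Local Notation n := (dim d N).
Local Notation D := (Dc N G C0 CN).
Local Notation BT := (bigm N (Tb N Gprev Glast B)).

(** The noise will be [A X] with X standard, so [A] has to be a square root of its normalized
    covariance. *)
Lemma Dc_factor : exists A : 'M[R]_n, A *m A^T = (std_variance R)^-1 *: bdiag N D.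
Proof.
have [L LE] := posdef_factor (SE_posdef hG pC0 pCN).
by exists L.
Qed.

Section rv.
Context (disp : measure_display) (T : measurableType disp) (P : probability T R).
Variables (X : 'I_n -> T -> R) (gX : gaussian_vec P X 1%:M).

Let mX (a : 'rV[R]_n) : measurable_fun setT (lincomb X a).
Proof. by apply: measurable_lincomb; case: gX. Qed.

Definition lincomb_rv (a : 'rV[R]_n) : {RV P >-> R} :=
  HB.pack (lincomb X a) (isMeasurableFun.Build _ _ _ _ (lincomb X a) (mX a)).

Definition realize (A : 'M[R]_n) (k : nat) : random_vector d P :=
  fun i => lincomb_rv (row (idx N k i) A).

Lemma flat_realize A : @flat R d N _ T P (realize A) = fun p => lincomb X (row p A).
Proof. by apply/funext => p; rewrite /flat /realize /= idx_blk. Qed.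

Lemma col_realize A t : \col_p @flat R d N _ T P (realize A) p t = A *m \col_p X p t.
Proof.
apply/matrixP => p j; rewrite flat_realize !mxE; apply: eq_bigr => q _.
by rewrite !mxE.
Qed.

Variable A : 'M[R]_n.
Hypothesis AE : A *m A^T = (std_variance R)^-1 *: bdiag N D.

Lemma cov_realize k l : (k <= N)%N -> (l <= N)%N ->
  cov (realize A k) (realize A l) = (k == l)%:R *: D k.
Proof.
move=> kN lN; apply/matrixP => i j; rewrite mxE.
have L2 b : lincomb X b \in Lfun P 2%:E := normal_Lfun2 (mX b) (gX.2 b).
have L1 b : lincomb X b \in Lfun P 1.
  by apply: Lfun_subset12 => //; exact: fin_num_measure.
have E b : ('E_P[lincomb X b] = 0)%E := normal_mean (mX b) (gX.2 b).
have cE a b : covariance P (lincomb X a) (lincomb X b) = (std_variance R * (a *m b^T) 0 0)%:E.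
  rewrite covarianceE ?L1 ?Lfun2_mul_Lfun1// !E mule0 sube0 unlock.
  by rewrite (gaussian_mul gX (posdef1 R n) a b).2 mulmx1.
rewrite [covariance _ _ _]cE /=.
have -> : (row (idx N k i) A *m (row (idx N l j) A)^T) 0 0 = (A *m A^T) (idx N k i) (idx N l j).
  by rewrite !mxE; apply: eq_bigr => q _; rewrite !mxE.
rewrite AE [in LHS]mxE mulrA mulfV; last by rewrite gt_eqF ?std_variance_gt0.
rewrite mul1r.
by rewrite [in LHS]mxE !blk_idx// !cmp_idx.
Qed.

Lemma white_gaussian_realize : white_gaussian N (realize A).
Proof.
split=> [a|k kN i|k l kN lN kl|k kN].
- apply/normal_lawP; pose b : 'rV[R]_n := \row_p a (blk p) (cmp p).
  have -> : (fun t => \sum_(k < N.+1) \sum_(i < d) a k i * realize A k i t) =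
      lincomb X (b *m A).
    rewrite -lincomb_lincomb -flat_realize lincomb_flat; apply/funext => t.
    apply: eq_bigr => k _; apply: eq_bigr => i _.
    by rewrite mxE blk_idx ?cmp_idx// -ltnS.
  by exists 0, (Num.sqrt (quad 1%:M (b *m A))); exact: gX.2.
- exact: (normal_mean (mX _) (gX.2 _)).
- by rewrite cov_realize//; move/eqP/negbTE: kl => ->; rewrite scale0r.
- by rewrite cov_realize// eqxx scale1r; apply/posdef_unit/Dc_posdef.
Qed.

Lemma CML_governed_realize :
  CML_governed N Gprev Glast G B C0 CN (realize (invmx BT *m A)).
Proof.
have E t : \col_p flat (realize A) p t = BT *m \col_p flat (realize (invmx BT *m A)) p t.
  by rewrite !col_realize !mulmxA mulmxV ?BT_unit// mul1mx.
have H t := (flat_blocks hN Gprev Glast B (realize (invmx BT *m A)) (realize A) t).1 (E t).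
exists (realize A); split.
- exact: white_gaussian_realize.
- have cE k : (k <= N)%N -> cov (realize A k) (realize A k) = D k.
    by move=> kN; rewrite cov_realize// eqxx scale1r.
  split; rewrite ?cE//.
  + by rewrite /Dc eqxx gtn_eqF.
  + move=> k /andP[k0 kN]; rewrite cE; last exact: ltnW.
    by rewrite /Dc gtn_eqF// ltn_eqF.
- by apply: aeW => t; case: (H t).
- by apply: aeW => t; case: (H t).
- by move=> k kN; apply: aeW => t; case: (H t) => _ _; exact.
Qed.

End rv.

Lemma CML_governed_exists : exists (disp : measure_display) (T : measurableType disp)
  (P : probability T R) (x : nat -> random_vector d P),
  CML_governed N Gprev Glast G B C0 CN x.
Proof.
have [A AE] := Dc_factor.
have [disp [T [P [X gX]]]] := standard_gaussian_exists R n.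
by exists disp, T, P, (realize gX (invmx BT *m A)); exact: CML_governed_realize.
Qed.

End realization.

Theorem corollary3p4 (R : realType) (d N : nat) (hN : (0 < N)%N)
    (Gprev Glast G : nat -> 'M[R]_d)
    (hG : forall k, (0 < k < N)%N -> posdef (G k)) :
  CML_for_reciprocal N Gprev Glast G <->
  exists Mprev M : nat -> 'M[R]_d,
    (forall k, (0 < k <= N)%N -> posdef (M k)) /\
    CML_induced N Gprev Glast G Mprev M.
Proof.
split=> [rec|[Mprev [M [pM ind]]] B C0 CN pC0 pCN disp T P x gov].
  apply: reciprocal_gains_induced => //.
  have p1 := posdef1 R d.
  (* The identity to be extracted does not involve the boundary parameters, so the simplest ones
     will do: [B = 0] and identity covariances. *)
  have [disp [T [P [x gov]]]] := CML_governed_exists hN Gprev Glast hG 0 p1 p1.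
  have gx := CML_governed_gaussian hN hG p1 p1 gov.
  have rx := rec _ _ _ p1 p1 _ _ _ _ gov.
  exact: (iffLR (reciprocal_iff_gains hN hG p1 p1 gx) rx).
apply/(reciprocal_iff_gains hN hG pC0 pCN (CML_governed_gaussian hN hG pC0 pCN gov)).
exact: induced_reciprocal_gains ind.
Qed.
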